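(* In the setting described in the context (with $K_n=Av(\log n\vee\log(ab/\sigma))$ for a sufficiently large absolute constant $A$), suppose that $b^2K_n\le n\sigma^2$. Then for every $\delta>0$ there exists a set $S_{n,0}\in\mathcal{S}^n$ such that $\mathrm{P}(X_1^n\in S_{n,0})\ge1-3/n$ and, for every $x_1^n\in S_{n,0}$, one can construct on an enriched probability space a random variable $W^0$ such that (i) $W^0$ has the same distribution as $\|B\|_{\mathcal{G}}$ and (ii) $$\mathrm{P}\bigl(|\widetilde W_n(x_1^n)-W^0|>\psi_n+\delta\bigr)\le A''\gamma_n(\delta),$$ where $A''$ is an absolute constant.
   Context: $X_1,\dots,X_n$ are i.i.d. random variables taking values in a measurable space $(S,\mathcal{S})$, $X_1^n=(X_1,\dots,X_n)$, and $\mathcal{S}^n$ is the product $\sigma$-field on $S^n$. $\mathcal{G}$ is a pointwise measurable VC$(b,a,v)$ type class of measurable functions on $S$, for some $b>0$, $a\ge e$, $v\ge1$. Here VC$(b,a,v)$ type means $\sup_{g\in\mathcal{G}}\|g\|_\infty\le b$ and $\sup_QN(\mathcal{G},L_2(Q),b\tau)\le(a/\tau)^v$ for all $0<\tau<1$, the supremum being over finitely discrete probability measures $Q$ on $(S,\mathcal{S})$, with $N(\mathcal{G},L_2(Q),\epsilon)$ the $\epsilon$-covering number of $\mathcal{G}$ in the $L_2(Q)$-semimetric; pointwise measurable means there is a countable subclass such that each $g\in\mathcal{G}$ is the pointwise limit of a sequence from it. $\sigma^2>0$ is any constant such that $\sup_{g\in\mathcal{G}}\mathrm{E}[g(X_1)^2]\le\sigma^2\le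 b^2$. $\|z\|_{\mathcal{G}}=\sup_{g\in\mathcal{G}}|z(g)|$. $B=\{B(g):g\in\mathcal{G}\}$ is a tight Gaussian random element in $\ell^\infty(\mathcal{G})$ (bounded functions on $\mathcal{G}$ with the sup norm) with mean zero and covariance $\mathrm{E}[B(g_1)B(g_2)]=\mathrm{E}[g_1(X_1)g_2(X_1)]-\mathrm{E}[g_1(X_1)]\mathrm{E}[g_2(X_1)]$ (it exists under the VC type assumption). $K_n:=Av(\log n\vee\log(ab/\sigma))$ for some sufficiently large absolute constant $A$; in particular $K_n\ge1$. $\xi_1,\dots,\xi_n$ are independent $N(0,1)$ random variables independent of $X_1^n$ (with $X_1,\dots,X_n,\xi_1,\dots,\xi_n$ coordinate projections of a product probability space). For $x_1^n=(x_1,\dots,x_n)\in S^n$, $$\widetilde W_n(x_1^n)=\sup_{g\in\mathcal{G}}\Bigl|\frac1{\sqrt n}\sum_{i=1}^n\xi_i\Bigl(g(x_i)-\frac1n\sum_{j=1}^ng(x_j)\Bigr)\Bigr|.$$ Finally $$\psi_n=\sqrt{\frac{\sigma^2K_n}{n}}+\Bigl(\frac{b^2\sigma^2K_n^3}{n}\Bigr)^{1/4},\qquad \gamma_n(\delta)=\frac1\delta\Bigl(\frac{b^2\sigma^2K_n^3}{n}\Bigr)^{1/4}+\frac1n.$$ *)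

(* Defs.v *)
From HB Require Import structures.
From mathcomp Require Import all_boot all_order all_algebra.
From mathcomp Require Import all_classical all_reals all_analysis.

Set Implicit Arguments.
Unset Strict Implicit.
Unset Printing Implicit Defensive.

Import Order.TTheory GRing.Theory Num.Theory.
Import numFieldNormedType.Exports.

Local Open Scope classical_set_scope.
Local Open Scope ring_scope.

(* The norm of l^oo(T); the value is meaningful when z is bounded. *)
Definition supnorm (R : realType) (T : Type) (z : T -> R) : R :=
  sup (range (fun t => `|z t|)).

Section laws.
Context (R : realType).

Definition has_law d d' (W : measurableType d) (T : measurableType d')
    (P : probability W R) (Y : W -> T) (mu : set T -> \bar R) : Prop :=
  forall A, measurable A -> P (Y @^-1` A) = mu A.

Definition same_law d1 d2 d' (W1 : measurableType d1) (W2 : measurableType d2)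
    (T : measurableType d') (P1 : probability W1 R) (Y1 : W1 -> T)
    (P2 : probability W2 R) (Y2 : W2 -> T) : Prop :=
  has_law P1 Y1 (fun A => P2 (Y2 @^-1` A)).

Definition independent d d1 d2 (W : measurableType d)
    (T1 : measurableType d1) (T2 : measurableType d2)
    (P : probability W R) (Y1 : W -> T1) (Y2 : W -> T2) : Prop :=
  forall A B, measurable A -> measurable B ->
    P (Y1 @^-1` A `&` Y2 @^-1` B) = (P (Y1 @^-1` A) * P (Y2 @^-1` B))%E.

(* Taking some A i := setT gives the product rule for every subfamily. *)
Definition mutually_independent d d' (W : measurableType d)
    (T : measurableType d') (P : probability W R) (n : nat)
    (Y : 'I_n -> W -> T) : Prop :=
  forall A : 'I_n -> set T, (forall i, measurable (A i)) ->
    P (\bigcap_i (Y i @^-1` A i)) = (\prod_(i < n) P (Y i @^-1` A i))%E.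

Definition iid d d' (W : measurableType d) (T : measurableType d')
    (P : probability W R) (n : nat) (Y : 'I_n -> W -> T) : Prop :=
  mutually_independent P Y /\ forall i j, same_law P (Y i) P (Y j).

(* n.-tuple T carries the product sigma-field in mathcomp-analysis. *)
Definition rvec (W T : Type) (n : nat) (Y : 'I_n -> W -> T) (w : W) :
  n.-tuple T := [tuple Y i w | i < n].

(* (W', P') is an enrichment of (W, P): the old random variables Y on W live
   on W' as Y \o p, with the same joint law. *)
Definition enrichment d d' (W : measurableType d) (W' : measurableType d')
    (P : probability W R) (P' : probability W' R) (p : W' -> W) : Prop :=
  measurable_fun [set: W'] p /\ has_law P' p P.

(* The library's [normal_prob m 0] is not the point mass at m, hence the
   case distinction. *)
Definition normal_law (m s : R) (A : set R) : \bar R :=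
  if s == 0 then \d_m A else normal_prob m s A.

Definition gaussian_variable d (W : measurableType d) (P : probability W R)
    (Y : W -> R) : Prop :=
  exists m s : R, has_law P Y (normal_law m s).

Definition gaussian_vector d (W : measurableType d) (P : probability W R)
    (k : nat) (Y : 'I_k -> W -> R) : Prop :=
  forall c : 'I_k -> R, gaussian_variable P (fun w => \sum_(i < k) c i * Y i w).

End laws.

Section gaussian_elements.
Context (R : realType) (T : choiceType).

(* l^oo(T) is viewed inside the space of all functions T -> R with the topology
   of uniform convergence, where it is open and closed. *)
Definition linf : set {uniform T -> R^o} :=
  [set z | exists M : R, forall t, `|z t| <= M].

(* B is a Borel random element of l^oo(T) with tight law. *)
Definition tight_random_element d (W : measurableType d) (P : probability W R)
    (B : W -> {uniform T -> R^o}) : Prop :=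
  [/\ forall w, linf (B w),
      forall U : set {uniform T -> R^o}, open U -> measurable (B @^-1` U)
    & forall e : R, 0 < e -> exists K : set {uniform T -> R^o},
        [/\ K `<=` linf, compact K & ((1 - e)%:E <= P (B @^-1` K))%E]].

Definition centered_tight_gaussian d (W : measurableType d)
    (P : probability W R) (B : W -> {uniform T -> R^o})
    (cov : T -> T -> \bar R) : Prop :=
  [/\ tight_random_element P B,
      forall (k : nat) (t : 'I_k -> T), gaussian_vector P (fun i w => B w (t i)),
      forall t, ('E_P[fun w => (B w t : R)] = 0)%E
    & forall t1 t2, ('E_P[fun w => (B w t1 * B w t2 : R)%R] = cov t1 t2)%E].

End gaussian_elements.

Section vc_type.
Context (R : realType) (d : measure_display) (S : measurableType d).
Implicit Types (G : set (S -> R)) (Q : probability S R).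

Definition finitely_discrete Q : Prop :=
  exists (m : nat) (x : 'I_m -> S) (p : 'I_m -> R),
    (forall i, 0 <= p i) /\
    forall A, measurable A -> Q A = (\sum_(i < m) (p i)%:E * \d_(x i) A)%E.

(* The least number of closed L2(Q)-balls of radius eps, with centres in G,
   that cover G; it is +oo if no finite number suffices. *)
Definition covering_number G Q (eps : R) : \bar R :=
  ereal_inf [set m%:R%:E | m in [set m : nat |
    exists c : 'I_m -> (S -> R), (forall i, G (c i)) /\
      forall g, G g ->
        exists i, ('N[Q]_2%:E[EFin \o (g \- c i)%R] <= eps%:E)%E]].

Definition VC_type G (b a v : R) : Prop :=
  (forall g x, G g -> `|g x| <= b) /\
  forall tau : R, 0 < tau < 1 ->
    (ereal_sup [set covering_number G Q (b * tau) | Q in finitely_discrete]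
       <= ((a / tau) `^ v)%:E)%E.

Definition pointwise_measurable G : Prop :=
  exists H : set (S -> R), [/\ countable H, H `<=` G &
    forall g, G g -> exists h : nat -> S -> R,
      (forall m, H (h m)) /\ forall x, (h m x @[m --> \oo] --> g x)].

End vc_type.

Section quantities.
Context (R : realType).

Definition K_ (A v : R) (n : nat) (a b sigma : R) : R :=
  A * v * Num.max (ln n%:R) (ln (a * b / sigma)).

Definition fourth_root_term (n : nat) (b sigma K : R) : R :=
  (b ^+ 2 * sigma ^+ 2 * K ^+ 3 / n%:R) `^ (1 / 4).

Definition psi_n (n : nat) (b sigma K : R) : R :=
  Num.sqrt (sigma ^+ 2 * K / n%:R) + fourth_root_term n b sigma K.

Definition gamma_n (n : nat) (b sigma K delta : R) : R :=
  1 / delta * fourth_root_term n b sigma K + 1 / n%:R.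

Definition W_tilde (S : Type) (G : set (S -> R)) (n : nat) (x : n.-tuple S)
    (xi : 'I_n -> R) : R :=
  supnorm (fun g : G =>
    1 / Num.sqrt n%:R * \sum_(i < n) xi i *
      (set_val g (tnth x i) - 1 / n%:R * \sum_(j < n) set_val g (tnth x j))).

End quantities.

(* Main.v *)
Require Import Defs.
From HB Require Import structures.
From mathcomp Require Import all_boot all_order all_algebra.
From mathcomp Require Import all_classical all_reals all_analysis.
From mathcomp Require Import measurable_realfun ring lra.

Set Implicit Arguments.
Unset Strict Implicit.
Unset Printing Implicit Defensive.

Import Order.TTheory GRing.Theory Num.Theory.
Import numFieldNormedType.Exports.

Local Open Scope classical_set_scope.
Local Open Scope ring_scope.

(** On an event of probability at least [1 - 3/n], Bernstein's inequality and a
    ghost-sample argument make the empirical covariances and the empirical L2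
    distances close to the true ones on a net of [G] of mesh of order [b / sqrt n],
    whose cardinality is controlled by the entropy.  For a sample in that event
    the multiplier process is Gaussian with the empirical covariance, and up to
    a chaining error of order [b K / sqrt n] the suprema of this process and of
    [B] are maxima over the net of Gaussian vectors with close covariances.  A
    Lindeberg replacement, applied to a smoothing of the log-sum-exp
    approximation of the maximum, bounds the difference of expectations of every
    1-Lipschitz function of the two suprema by a multiple of
    [fourth_root_term n b sigma K].  This bound on the Wasserstein distance
    controls [|V - W0|] for the quantile coupling, because in dimension one the
    quantile coupling attains that distance; Markov's inequality concludes. *)

(** * Expectations, laws and product spaces *)

(** The fourth-root term is the scale [th] at which the errors balance. Smoothing a 1-Lipschitz
    function at scale [th] and taking the inverse temperature K / th each cost a multiple of [th],
    and the second derivatives of the smoothed maximum have total size of order K / th. Covariances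
    that differ by D thus cost D K / th, and D of order b sigma sqrt(K / n) gives th^2 = b sigma
    K^(3/2) / sqrt n. Under b^2 K <= n sigma^2 the chaining error is also below [th]. Bernstein's
    inequality reaches only finitely many functions, whereas the empirical distance to the net must
    be controlled on all of [G]: hence the ghost sample, run over finite lists of pairs from the
    countable subclass and extended by pointwise limits. The Wasserstein bound is used in dual form:
    a potential that realizes the distance for the quantile coupling is written down and fed to the
    comparison. It is bounded and vanishes on a left half-line, which is why the test functions have
    these properties throughout. The coupling needs a law without atoms; an independent normal
    variable removes them and forms the enrichment. *)

Definition Ex (R : realType) d (W : measurableType d) (P : probability W R)
  (f : W -> R) : R := fine (\int[P]_w (f w)%:E).

Definition itg (R : realType) d (W : measurableType d) (P : probability W R)
  (f : W -> R) : Prop := P.-integrable setT (EFin \o f).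

Section expectation.
Context (R : realType) d (W : measurableType d) (P : probability W R).
Implicit Types f g : W -> R.

Lemma itg_le f g : measurable_fun setT f -> (forall w, `|f w| <= g w) ->
  itg P g -> itg P f.
Proof.
move=> mf fg ig; apply: (le_integrable measurableT _ _ ig).
  exact/measurable_EFinP.
by move=> w _ /=; rewrite lee_fin (le_trans (fg w))// ler_norm.
Qed.

Lemma itg_cst (c : R) : itg P (cst c).
Proof. exact: finite_measure_integrable_cst. Qed.

Lemma itg_bnd f M : measurable_fun setT f -> (forall w, `|f w| <= M) -> itg P f.
Proof. by move=> mf fM; exact: (itg_le mf fM (itg_cst M)). Qed.

Lemma itgD f g : itg P f -> itg P g -> itg P (fun w => f w + g w).
Proof.
move=> If Ig; have := integrableD measurableT If Ig.
by apply: eq_integrable => // x _; rewrite /= EFinD.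
Qed.

Lemma itgZ (k : R) f : itg P f -> itg P (fun w => k * f w).
Proof.
move=> If; have := integrableZl measurableT k If.
by apply: eq_integrable => // x _; rewrite /= EFinM.
Qed.

Lemma itgN f : itg P f -> itg P (fun w => - f w).
Proof.
move=> /(itgZ (-1)); congr (itg P _).
by apply/funext => w; rewrite mulN1r.
Qed.

Lemma itgB f g : itg P f -> itg P g -> itg P (fun w => f w - g w).
Proof. by move=> If Ig; exact: itgD If (itgN Ig). Qed.

Lemma itg_abs f : itg P f -> itg P (fun w => `|f w|).
Proof. by move=> If; exact: (integrable_norm If). Qed.

Lemma itg_sum (I : Type) (s : seq I) (Q : pred I) (F : I -> W -> R) :
  (forall i, Q i -> itg P (F i)) ->
  itg P (fun w => \sum_(i <- s | Q i) F i w).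
Proof.
move=> IF; elim: s => [|i s IHs].
  rewrite (_ : (fun _ => _) = cst 0); first exact: itg_cst.
  by apply/funext => w; rewrite big_nil.
rewrite (_ : (fun _ => _) = (fun w => (if Q i then F i w else 0) +
    \sum_(i <- s | Q i) F i w)).
  by apply: itgD => //; have [/IF//|_] := boolP (Q i); exact: itg_cst.
by apply/funext => w; rewrite big_cons; case: ifP => //; rewrite add0r.
Qed.

Lemma ExE f : itg P f -> (Ex P f)%:E = (\int[P]_w (f w)%:E)%E.
Proof. by move=> If; rewrite fineK//; exact: (integrable_fin_num _ If). Qed.

Lemma Ex_cst (c : R) : Ex P (fun=> c) = c.
Proof.
by rewrite /Ex; have := expectation_cst P c; rewrite unlock => ->.
Qed.

Lemma ExD f g : itg P f -> itg P g -> Ex P (fun w => f w + g w) = Ex P f + Ex P g.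
Proof. by move=> If Ig; exact: (RintegralD measurableT If Ig). Qed.

Lemma ExZ (k : R) f : itg P f -> Ex P (fun w => k * f w) = k * Ex P f.
Proof. by move=> If; exact: (RintegralZl k measurableT If). Qed.

Lemma ExN f : itg P f -> Ex P (fun w => - f w) = - Ex P f.
Proof.
move=> If; rewrite -mulN1r -ExZ//; congr (Ex P _).
by apply/funext => w; rewrite mulN1r.
Qed.

Lemma ExB f g : itg P f -> itg P g -> Ex P (fun w => f w - g w) = Ex P f - Ex P g.
Proof. by move=> If Ig; rewrite ExD ?ExN//; exact: itgN. Qed.

Lemma Ex_sum (I : Type) (s : seq I) (Q : pred I) (F : I -> W -> R) :
  (forall i, Q i -> itg P (F i)) ->
  Ex P (fun w => \sum_(i <- s | Q i) F i w) = \sum_(i <- s | Q i) Ex P (F i).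
Proof.
move=> IF; elim: s => [|i s IHs].
  rewrite big_nil -[RHS](Ex_cst 0); congr (Ex P _).
  by apply/funext => w; rewrite big_nil.
rewrite (_ : (fun _ => _) = (fun w => (if Q i then F i w else 0) +
    \sum_(i <- s | Q i) F i w)); last first.
  by apply/funext => w; rewrite big_cons; case: ifP => //; rewrite add0r.
rewrite ExD ?IHs//; last exact: itg_sum.
  rewrite big_cons; have [//|_] := boolP (Q i).
  by rewrite Ex_cst add0r.
by have [/IF//|_] := boolP (Q i); exact: itg_cst.
Qed.

Lemma Ex_le f g : itg P f -> itg P g -> (forall w, f w <= g w) ->
  Ex P f <= Ex P g.
Proof.
by move=> If Ig fg; exact: (@le_Rintegral _ W R P setT f g).
Qed.

Lemma Ex_ge0 f : (forall w, 0 <= f w) -> 0 <= Ex P f.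
Proof. by move=> f0; apply: fine_ge0; apply: integral_ge0 => w _; rewrite lee_fin. Qed.

Lemma Ex_abs f : itg P f -> `|Ex P f| <= Ex P (fun w => `|f w|).
Proof.
move=> If; rewrite ler_norml -ExN; last exact: itg_abs.
apply/andP; split; apply: Ex_le => //; try exact: itg_abs.
- exact/itgN/itg_abs.
- by move=> w; rewrite lerNl -normrN ler_norm.
- by move=> w; rewrite ler_norm.
Qed.

Lemma Ex_abs_le f g : itg P f -> itg P g -> (forall w, `|f w| <= g w) ->
  `|Ex P f| <= Ex P g.
Proof.
move=> If Ig fg; apply: (le_trans (Ex_abs If)).
by apply: Ex_le => //; exact: itg_abs.
Qed.

Lemma Ex_bnd f M : measurable_fun setT f -> (forall w, `|f w| <= M) ->
  `|Ex P f| <= M.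
Proof.
move=> mf fM; rewrite -[leRHS]Ex_cst; apply: Ex_abs_le => //.
  exact: itg_bnd mf fM.
exact: itg_cst.
Qed.

Lemma Ex_indic A : measurable A -> (Ex P (\1_A))%:E = P A.
Proof.
move=> mA; rewrite ExE.
  by rewrite (integral_indic P measurableT mA) setIT.
by apply: (@itg_bnd _ 1) => // w; rewrite indicE; case: (_ \in _); rewrite ?normr1 ?normr0.
Qed.

Lemma Ex_cvg (f_ : nat -> W -> R) f M :
  (forall k, measurable_fun setT (f_ k)) ->
  (forall k w, `|f_ k w| <= M) ->
  (forall w, f_ k w @[k --> \oo] --> f w) ->
  Ex P (f_ k) @[k --> \oo] --> Ex P f.
Proof.
move=> mf fM ff.
have mlim : measurable_fun setT f.
  by apply: (measurable_fun_cvg _ _ ) => //; move=> w _; exact: ff.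
have [] := @dominated_convergence _ W R P setT measurableT
  (fun k => EFin \o f_ k) (EFin \o f) (EFin \o cst M).
- by move=> k; exact/measurable_EFinP.
- exact/measurable_EFinP.
- by apply/aeW => w _; apply: cvg_EFin; [exact: nearW|exact: ff].
- exact: itg_cst.
- by apply/aeW => w k _ /=; rewrite lee_fin.
move=> If _ H; apply: fine_cvg; rewrite ExE//.
Qed.

End expectation.

Lemma measurable_preimT d1 d2 (T1 : measurableType d1) (T2 : measurableType d2)
  (f : T1 -> T2) A : measurable_fun setT f -> measurable A ->
  measurable (f @^-1` A).
Proof. by move=> mf mA; rewrite -[X in measurable X]setTI; exact: mf. Qed.

Section laws_integral.
Context (R : realType) d1 d2 d' (W1 : measurableType d1) (W2 : measurableType d2)
  (T : measurableType d') (P1 : probability W1 R) (P2 : probability W2 R).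

Lemma same_law_ge0_integral (Y1 : W1 -> T) (Y2 : W2 -> T) (g : T -> \bar R) :
  measurable_fun setT Y1 -> measurable_fun setT Y2 -> same_law P1 Y1 P2 Y2 ->
  measurable_fun setT g -> (forall t, 0 <= g t)%E ->
  (\int[P1]_w g (Y1 w) = \int[P2]_w g (Y2 w))%E.
Proof.
move=> m1 m2 Y12 mg g0.
have := @ge0_integral_pushforward _ _ W1 T R Y1 m1 P1 setT g measurableT mg (fun t _ => g0 t).
have := @ge0_integral_pushforward _ _ W2 T R Y2 m2 P2 setT g measurableT mg (fun t _ => g0 t).
rewrite !preimage_setT => <- <-.
by apply: eq_measure_integral => A mA _; rewrite /pushforward; exact: Y12.
Qed.

Lemma same_law_integral (Y1 : W1 -> T) (Y2 : W2 -> T) (g : T -> \bar R) :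
  measurable_fun setT Y1 -> measurable_fun setT Y2 -> same_law P1 Y1 P2 Y2 ->
  measurable_fun setT g ->
  (\int[P1]_w g (Y1 w) = \int[P2]_w g (Y2 w))%E.
Proof.
move=> m1 m2 Y12 mg; rewrite [LHS]integralE [RHS]integralE.
congr (_ - _)%E.
  have -> : (\int[P1]_x (g \o Y1)^\+ x = \int[P1]_x (g^\+)%E (Y1 x))%E.
    by apply: eq_integral => x _; rewrite !funeposE.
  have -> : (\int[P2]_x (g \o Y2)^\+ x = \int[P2]_x (g^\+)%E (Y2 x))%E.
    by apply: eq_integral => x _; rewrite !funeposE.
  apply: same_law_ge0_integral => //; exact: measurable_funepos.
have -> : (\int[P1]_x (g \o Y1)^\- x = \int[P1]_x (g^\-)%E (Y1 x))%E.
  by apply: eq_integral => x _; rewrite !funenegE.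
have -> : (\int[P2]_x (g \o Y2)^\- x = \int[P2]_x (g^\-)%E (Y2 x))%E.
  by apply: eq_integral => x _; rewrite !funenegE.
apply: same_law_ge0_integral => //; exact: measurable_funeneg.
Qed.

Lemma same_law_Ex (Y1 : W1 -> T) (Y2 : W2 -> T) (g : T -> R) :
  measurable_fun setT Y1 -> measurable_fun setT Y2 -> same_law P1 Y1 P2 Y2 ->
  measurable_fun setT g -> Ex P1 (g \o Y1) = Ex P2 (g \o Y2).
Proof.
move=> m1 m2 Y12 mg; rewrite /Ex; congr fine.
apply: (same_law_integral (g := EFin \o g)) => //.
exact/measurable_EFinP.
Qed.

Lemma same_law_itg (Y1 : W1 -> T) (Y2 : W2 -> T) (g : T -> R) :
  measurable_fun setT Y1 -> measurable_fun setT Y2 -> same_law P1 Y1 P2 Y2 ->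
  measurable_fun setT g -> itg P2 (g \o Y2) -> itg P1 (g \o Y1).
Proof.
move=> m1 m2 Y12 mg /integrableP[_ I2]; apply/integrableP; split.
  by apply/measurable_EFinP; exact: measurableT_comp.
move: I2; congr (_ < _)%E; apply/esym.
apply: (same_law_ge0_integral (g := fun t => `|(g t)%:E|%E)) => //.
by apply: measurableT_comp => //; exact/measurable_EFinP.
Qed.

End laws_integral.

Definition prodP (R : realType) d1 d2 (W1 : measurableType d1)
  (W2 : measurableType d2) (P1 : probability W1 R) (P2 : probability W2 R) :
  probability (W1 * W2)%type R := (P1 \x P2)%E.

Section fubini_bounded.
Context (R : realType) d1 d2 (W1 : measurableType d1) (W2 : measurableType d2)
  (P1 : probability W1 R) (P2 : probability W2 R).

Lemma measurable_Ex_section (f : W1 * W2 -> R) (M : R) :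
  measurable_fun setT f -> (forall w, `|f w| <= M) ->
  measurable_fun setT (fun x => Ex P2 (fun y => f (x, y))).
Proof.
move=> mf fM.
have If : itg (prodP P1 P2) f by exact: itg_bnd mf fM.
have := measurable_fubini_F If.
by move=> H; apply: measurableT_comp => //.
Qed.

Lemma Ex_fubini (f : W1 * W2 -> R) (M : R) :
  measurable_fun setT f -> (forall w, `|f w| <= M) ->
  Ex (prodP P1 P2) f = Ex P1 (fun x => Ex P2 (fun y => f (x, y))).
Proof.
move=> mf fM.
have If : itg (prodP P1 P2) f by exact: itg_bnd mf fM.
rewrite /Ex -(integral12_prod_meas1 If); congr fine; apply: eq_integral => x _.
rewrite /fubini_F fineK//.
have := @ExE _ _ _ P2 (fun y => f (x, y)).
move=> <- //; apply: (@itg_bnd _ _ _ _ _ M) => //.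
exact: measurableT_comp.
Qed.

Lemma ge0_fubini (f : W1 * W2 -> \bar R) :
  measurable_fun setT f -> (forall w, 0 <= f w)%E ->
  (\int[prodP P1 P2]_z f z = \int[P1]_x \int[P2]_y f (x, y))%E.
Proof. by move=> mf f0; rewrite fubini_tonelli1. Qed.

Lemma prod_rectangle A1 A2 : measurable A1 -> measurable A2 ->
  (prodP P1 P2) (A1 `*` A2) = (P1 A1 * P2 A2)%E.
Proof. exact: product_measure1E. Qed.

Lemma same_law_fst d' (T : measurableType d') (Y : W1 -> T) :
  measurable_fun setT Y ->
  same_law (prodP P1 P2) (Y \o fst) P1 Y.
Proof.
move=> mY A mA; rewrite (_ : _ @^-1` A = (Y @^-1` A) `*` setT).
  rewrite prod_rectangle//; last exact: measurable_preimT.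
  by rewrite probability_setT mule1.
by apply/seteqP; split => -[x y] //= [].
Qed.

End fubini_bounded.

Import HBNNSimple.

(** The standard passage: simple functions, where the hypothesis on sets applies level by level,
    then monotone convergence along [nnsfun_approx]. *)
Lemma ge0_integral_density (R : realType) d (T : measurableType d)
  (mu : {measure set T -> \bar R}) (nu : {measure set T -> \bar R}) (h : T -> R)
  (f : T -> \bar R) :
  measurable_fun setT h -> (forall x, 0 <= h x) ->
  (forall A, measurable A -> nu A = \int[mu]_(x in A) (h x)%:E)%E ->
  measurable_fun setT f -> (forall x, 0 <= f x)%E ->
  (\int[nu]_x f x = \int[mu]_x (f x * (h x)%:E))%E.
Proof.
move=> mh h0 nuh mf f0.
have mhE : measurable_fun setT (EFin \o h) by exact/measurable_EFinP.
pose f_ := nnsfun_approx measurableT mf.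
have nn (g : {nnsfun T >-> R}) :
    (\int[nu]_x (g x)%:E = \int[mu]_x ((g x)%:E * (h x)%:E))%E.
  rewrite integralT_nnsfun sintegralE.
  under [RHS]eq_integral.
    move=> x xD; rewrite fimfunE -fsumEFin// ge0_mule_fsuml; last first.
      by move=> r; rewrite EFinM nnfun_muleindic_ge0.
    over.
  rewrite ge0_integral_fsum//=; last 2 first.
    move=> r; apply: emeasurable_funM => //; apply/measurable_EFinP.
    exact: measurable_funM.
    move=> r x _; rewrite mule_ge0//; last by rewrite lee_fin.
    by rewrite EFinM nnfun_muleindic_ge0.
  apply: eq_fsbigr => r rg.
  have [r0|r0] := ltP r 0.
    rewrite preimage_nnfun0// measure0 mule0.
    by rewrite integral0_eq// => x _; rewrite indicE in_set0 mulr0 mul0e.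
  under eq_integral do rewrite EFinM -muleA.
  rewrite ge0_integralZl//=.
  - congr (_ * _)%E; rewrite nuh// integral_mkcond; apply: eq_integral => x _.
    by rewrite patchE indicE; case: ifPn; rewrite ?mul1e ?mul0e.
  - by apply: emeasurable_funM => //; apply/measurable_EFinP; exact: measurable_indic.
  - by move=> x _; rewrite -EFinM lee_fin mulr_ge0.
transitivity (lim (\int[nu]_x (f_ n x)%:E @[n --> \oo])%E).
  rewrite -monotone_convergence//=.
  - apply: eq_integral => x _; apply/esym/cvg_lim => //=.
    exact: cvg_nnsfun_approx.
  - by move=> n; exact/measurable_EFinP/measurable_funTS.
  - by move=> n ? _; rewrite lee_fin.
  - by move=> ? _ ? ? mn; rewrite lee_fin; exact/lefP/nd_nnsfun_approx.
transitivity (lim (\int[mu]_x ((f_ n x)%:E * (h x)%:E) @[n --> \oo])%E).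
  by apply: congr_lim; apply/funext => n; exact: nn.
rewrite -monotone_convergence//=.
- apply: eq_integral => x _; apply/cvg_lim => //=.
  apply: cvgeZr => //; exact: cvg_nnsfun_approx.
- by move=> n; apply: emeasurable_funM => //; exact/measurable_EFinP.
- by move=> n ? _; rewrite -EFinM lee_fin mulr_ge0.
- move=> x _ ? ? mn; rewrite lee_wpmul2r ?lee_fin//.
  exact/lefP/nd_nnsfun_approx.
Qed.

(** * Centred normal laws *)

Section real_lemmas.
Context (R : realType).

(** Applied to a Taylor remainder, whose derivative is the remainder of lower order, it raises the
    order by one at the price of a factor |y|. The bound on [f'] is asked only where |t| <= |y|,
    which keeps the factor e^|y| of the Taylor bounds below. *)
Lemma mvt_bound (f f' : R -> R) (M y : R) :
  (forall t : R, is_derive t (1 : R) f (f' t)) ->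
  (forall t, `|t| <= `|y| -> `|f' t| <= M) -> `|f y - f 0| <= M * `|y|.
Proof.
move=> df bf.
have cf (a b : R) : {within `[a, b], continuous f}.
  apply: continuous_subspaceT => t; apply: differentiable_continuous.
  by apply/derivable1_diffP; have [] := df t.
have [y0|y0|->] := ltgtP y 0; last by rewrite subrr normr0 mulr0.
- have [c] := @MVT _ f f' y 0 y0 (fun t _ => df t) (cf _ _).
  rewrite in_itv/= => /andP[yc c0]; rewrite distrC => ->.
  rewrite sub0r normrM normrN ler_wpM2r//; apply: bf.
  by rewrite !ltr0_norm// lerN2 ltW.
- have [c] := @MVT _ f f' 0 y y0 (fun t _ => df t) (cf _ _).
  rewrite in_itv/= => /andP[c0 cy] ->.
  rewrite subr0 normrM ler_wpM2r//; apply: bf.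
  by rewrite !gtr0_norm// ltW.
Qed.

Lemma expR_norm_le (t y : R) : `|t| <= `|y| -> expR t <= expR `|y|.
Proof. by move=> ty; rewrite ler_expR (le_trans (ler_norm t)). Qed.

Lemma expR_taylor1 (y : R) : `|expR y - 1| <= `|y| * expR `|y|.
Proof.
have := @mvt_bound expR expR (expR `|y|) y (fun t => is_derive_expR t).
rewrite expR0 mulrC; apply => t ty.
by rewrite ger0_norm ?expR_ge0// expR_norm_le.
Qed.

Lemma expR_taylor2 (y : R) : `|expR y - 1 - y| <= `|y| ^+ 2 * expR `|y|.
Proof.
have := @mvt_bound (fun t => expR t - t) (fun t => expR t - 1) (`|y| * expR `|y|) y.
rewrite expR0 subr0 expr2 [X in _ -> _ -> _ <= X]mulrAC => H.
rewrite (_ : _ - 1 - y = expR y - y - 1); last by ring.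
apply: H => t ty.
apply: (le_trans (expR_taylor1 t)).
by apply: ler_pM => //; rewrite ler_expR.
Qed.

Lemma expR_taylor3 (y : R) :
  `|expR y - 1 - y - y ^+ 2 / 2| <= `|y| ^+ 3 * expR `|y|.
Proof.
have := @mvt_bound (fun t => expR t - t - t ^+ 2 / 2) (fun t => expR t - 1 - t)
  (`|y| ^+ 2 * expR `|y|) y.
rewrite expR0 expr0n/= mul0r !subr0 => H.
rewrite (_ : _ - _ = expR y - y - y ^+ 2 / 2 - 1); last by ring.
rewrite (_ : `|y| ^+ 3 * _ = `|y| ^+ 2 * expR `|y| * `|y|); last by ring.
apply: H => [t|t ty].
  by apply: is_derive_eq; rewrite /GRing.scale/=; field.
apply: (le_trans (expR_taylor2 t)).
apply: ler_pM => //; last by rewrite ler_expR.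
by rewrite ler_pXn2r// nnegrE.
Qed.

End real_lemmas.

Section normal.
Context (R : realType).
Notation mu := (@lebesgue_measure R).

Lemma ge0_integral_translation (x : R) (f : R -> \bar R) :
  measurable_fun setT f -> (forall y, 0 <= f y)%E ->
  (\int[mu]_y f (x + y)%R = \int[mu]_y f y)%E.
Proof.
move=> mf f0.
have mx : measurable_fun [set: measurableTypeR R] (fun y : measurableTypeR R => x + y : measurableTypeR R).
  exact: measurable_funD.
have E A : measurable A -> mu A = pushforward mu (fun y : measurableTypeR R => x + y : measurableTypeR R) A.
  move=> mA; apply: lebesgue_measure_unique => //= _ [[a b]] _ <-.
  rewrite /pushforward (_ : _ @^-1` _ = `]a - x, b - x]%classic); last first.
    by apply/seteqP; split => y /=; rewrite !in_itv/= ltrBlDl lerBrDl.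
  rewrite !lebesgue_measure_itv/= !lte_fin ltrD2r -!EFinD.
  by case: ifP => // _; congr (_%:E); ring.
rewrite -[LHS](ge0_integral_pushforward mx mu measurableT mf)//.
by apply: eq_measure_integral => A mA _; exact/esym/E.
Qed.

Section nlaw_def.
Variable s : R.
Let N : set R -> \bar R := @normal_law R 0 s.

Let N0 : N set0 = 0%E.
Proof. by rewrite /N /normal_law; case: ifP; rewrite measure0. Qed.

Let N_ge0 A : (0 <= N A)%E.
Proof. by rewrite /N /normal_law; case: ifP. Qed.

Let N_sigma_additive : semi_sigma_additive N.
Proof.
rewrite /N; have [s0|s0] := eqVneq s 0.
  rewrite (_ : normal_law 0 s = \d_(0 : R)); first exact: measure_semi_sigma_additive.
  by apply/funext => A; rewrite /normal_law s0 eqxx.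
rewrite (_ : normal_law 0 s = normal_prob 0 s); last first.
  by apply/funext => A; rewrite /normal_law (negbTE s0).
exact: (@measure_semi_sigma_additive _ _ _ (normal_prob 0 s)).
Qed.

HB.instance Definition _ := isMeasure.Build _ R R N N0 N_ge0 N_sigma_additive.

Let N1 : N setT = 1%E.
Proof.
rewrite /N /normal_law; case: ifP => _; first by rewrite diracT.
exact: (@probability_setT _ _ _ (normal_prob 0 s)).
Qed.

HB.instance Definition _ := Measure_isProbability.Build _ _ _ N N1.

Lemma nlaw_exists : exists P : probability R R, forall A, P A = normal_law 0 s A.
Proof. by exists [the probability _ _ of N]. Qed.

End nlaw_def.

(** The centred normal law as a probability measure for every real [s], with the point mass at 0 for
    s = 0, so that degenerate covariances are not a special case later on. *)
Definition nlaw (s : R) : probability R R := sval (cid (nlaw_exists s)).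

Lemma nlawE s A : nlaw s A = normal_law 0 s A.
Proof. by rewrite /nlaw; case: cid. Qed.

Lemma nlaw_same d (W : measurableType d) (P : probability W R) (Y : W -> R) s :
  has_law P Y (normal_law 0 s) -> same_law P Y (nlaw s) id.
Proof.
by move=> PY A mA; rewrite PY// nlawE.
Qed.

Lemma ge0_integral_nlaw0 (f : R -> \bar R) : measurable_fun setT f ->
  (\int[nlaw 0]_x f x = f 0%R)%E.
Proof.
move=> mf; rewrite (eq_measure_integral (\d_(0 : R))); last first.
  by move=> A mA _; rewrite [LHS]nlawE /normal_law eqxx.
by rewrite integral_dirac// diracT mul1e.
Qed.

Lemma ge0_integral_nlaw (s : R) (f : R -> \bar R) : s != 0 ->
  measurable_fun setT f -> (forall x, 0 <= f x)%E ->
  (\int[nlaw s]_x f x = \int[mu]_x (f x * (normal_pdf 0 s x)%:E))%E.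
Proof.
move=> s0 mf f0; transitivity (\int[normal_prob 0 s]_x f x)%E.
    (* The identity carries [nlaw s] to [measurableTypeR R], the copy of the line on which Lebesgue
       measure lives. *)
    have mid : measurable_fun setT (idfun : R -> measurableTypeR R) by move=> _ A mA; rewrite setTI.
  rewrite -[LHS](ge0_integral_pushforward mid (nlaw s) measurableT mf)//.
  apply: eq_measure_integral => A mA _.
  by rewrite /pushforward [LHS]nlawE /normal_law (negbTE s0).
apply: ge0_integral_density => //.
- exact: measurable_normal_pdf.
- by move=> x; exact: normal_pdf_ge0.
Qed.

(** Completing the square: e^(l x) times the density of N(0, s^2) is e^(l^2 s^2 / 2) times the
    density of N(l s^2, s^2), which integrates to 1. *)
Lemma mgf_nlaw (s l : R) :
  (\int[nlaw s]_x (expR (l * x))%:E = (expR (l ^+ 2 * s ^+ 2 / 2))%:E)%E.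
Proof.
have mf : measurable_fun setT (fun x : R => (expR (l * x))%:E).
  by apply/measurable_EFinP; apply: measurableT_comp => //; exact: measurable_funM.
have [->|s0] := eqVneq s 0.
  by rewrite ge0_integral_nlaw0// mulr0 expr0n/= mulr0 mul0r.
rewrite ge0_integral_nlaw//.
transitivity (\int[mu]_x ((expR (l ^+ 2 * s ^+ 2 / 2))%:E *
    (normal_pdf (l * s ^+ 2) s x)%:E))%E.
  apply: eq_integral => x _; rewrite -!EFinM; congr EFin.
  rewrite !normal_pdfE// mulrCA [RHS]mulrCA; congr (_ * _).
  rewrite /normal_fun -!expRD; congr expR.
  by field.
rewrite ge0_integralZl//.
- by rewrite integral_normal_pdf mule1.
- by apply/measurable_EFinP; exact: measurable_normal_pdf.
- by move=> x _; rewrite lee_fin normal_pdf_ge0.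
Qed.

(** Two factorizations of the joint density of X and X + Y for independent X, Y of standard
    deviations s1, s2: the law of X times the law of the sum given X, and the law of the sum times
    the law of X given the sum. *)
Lemma convolution_normal_pdf (s1 s2 x z : R) : s1 != 0 -> s2 != 0 ->
  normal_pdf 0 s1 x * normal_pdf x s2 z =
  normal_pdf 0 (Num.sqrt (s1 ^+ 2 + s2 ^+ 2)) z *
  normal_pdf (z * s1 ^+ 2 / (s1 ^+ 2 + s2 ^+ 2))
    (Num.sqrt (s1 ^+ 2 * s2 ^+ 2 / (s1 ^+ 2 + s2 ^+ 2))) x.
Proof.
move=> s10 s20.
have p1 : 0 < s1 ^+ 2 by rewrite exprn_even_gt0.
have p2 : 0 < s2 ^+ 2 by rewrite exprn_even_gt0.
have p12 : 0 < s1 ^+ 2 + s2 ^+ 2 by rewrite addr_gt0.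
have pq : 0 < s1 ^+ 2 * s2 ^+ 2 / (s1 ^+ 2 + s2 ^+ 2) by apply: divr_gt0 => //; exact: mulr_gt0.
rewrite !normal_pdfE ?sqrtr_eq0 -?ltNge// /normal_peak /normal_fun.
rewrite !sqr_sqrtr; [|exact: ltW..].
rewrite [LHS]mulrACA [RHS]mulrACA -!expRD -!invfM; congr (_^-1 * expR _).
  have pi2 (t : R) : 0 < t -> 0 <= t * pi *+ 2.
    by move=> t0; rewrite mulrn_wge0// mulr_ge0// ?pi_ge0// ltW.
  rewrite -[LHS]sqrtrM ?pi2// -[RHS]sqrtrM ?pi2//; congr (Num.sqrt _).
  by field; rewrite gt_eqF.
by field; rewrite s10 s20 gt_eqF.
Qed.

Lemma nlaw_norm (s : R) (f : R -> \bar R) :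
  (\int[nlaw `|s|]_x f x = \int[nlaw s]_x f x)%E.
Proof.
apply: eq_measure_integral => A _ _.
rewrite [LHS]nlawE [RHS]nlawE /normal_law normr_eq0.
have [s0|s0] := eqVneq s 0; first by [].
congr (integral _ _ _); apply/funext => x; congr EFin.
by rewrite !normal_pdfE ?normr_eq0// /normal_peak /normal_fun real_normK// num_real.
Qed.

(** Tonelli lets the integral over x be taken first; by [convolution_normal_pdf] it is the integral
    of a density, equal to 1, and the density of the sum remains. A degenerate summand has no
    density and is treated apart. *)
Lemma nlaw_add (s1 s2 : R) (f : R -> \bar R) :
  measurable_fun setT f -> (forall x, 0 <= f x)%E ->
  (\int[nlaw s1]_x \int[nlaw s2]_y f (x + y)%R =
   \int[nlaw (Num.sqrt (s1 ^+ 2 + s2 ^+ 2))]_z f z)%E.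
Proof.
move=> mf f0.
have mfD x : measurable_fun setT (fun y : R => f (x + y)).
  by apply: measurableT_comp => //; exact: measurable_funD.
have [->|s20] := eqVneq s2 0.
  have -> : Num.sqrt (s1 ^+ 2 + 0 ^+ 2) = `|s1| by rewrite expr0n addr0 sqrtr_sqr.
  rewrite [RHS](nlaw_norm s1 f).
  by apply: eq_integral => x _; rewrite ge0_integral_nlaw0 ?addr0.
have [->|s10] := eqVneq s1 0.
  have -> : Num.sqrt (0 ^+ 2 + s2 ^+ 2) = `|s2| by rewrite expr0n add0r sqrtr_sqr.
  rewrite [RHS](nlaw_norm s2 f).
  rewrite [LHS]ge0_integral_nlaw0; last first.
    have mf2 : measurable_fun setT (fun z : R * R => f (z.1 + z.2)).
      by apply: measurableT_comp => //; exact: measurable_funD.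
    exact: (measurable_fun_fubini_tonelli_F _ mf2).
  by apply: eq_integral => x _; rewrite add0r.
have p12 : 0 < s1 ^+ 2 + s2 ^+ 2 by rewrite addr_gt0// exprn_even_gt0.
set s := Num.sqrt _.
have s0 : s != 0 by rewrite sqrtr_eq0 -ltNge.
have mpdf2 : measurable_fun setT (fun z : measurableTypeR R * measurableTypeR R =>
    normal_pdf (z.1 : R) s2 (z.2 : R)).
  rewrite [X in measurable_fun _ X](_ : _ =
      (fun z => normal_peak s2 * expR (- (z.2 - z.1) ^+ 2 / (s2 ^+ 2 *+ 2)))).
    apply: measurable_funM => //; apply: measurableT_comp => //.
    apply: measurable_funM => //; apply: measurableT_comp => //.
    by apply: measurable_funX; apply: measurable_funB.
  by apply/funext => z; rewrite normal_pdfE.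
have mf2 : measurable_fun setT (fun z : R * R => f (z.1 + z.2)).
  by apply: measurableT_comp => //; exact: measurable_funD.
have mpdf (m t : R) : measurable_fun setT (fun x => (normal_pdf m t x)%:E).
  by apply/measurable_EFinP; exact: measurable_normal_pdf.
have inner x : (\int[nlaw s2]_y f (x + y)%R =
    \int[mu]_z (f z * (normal_pdf x s2 z)%:E))%E.
  rewrite (ge0_integral_nlaw s20 (mfD x) (fun y => f0 (x + y))).
  transitivity (\int[mu]_y ((fun z => f z * (normal_pdf x s2 z)%:E) (x + y)%R))%E.
    apply: eq_integral => y _; rewrite !normal_pdfE// /normal_fun subr0.
    by rewrite [(x + y) - x]addrAC subrr add0r.
  apply: ge0_integral_translation.
  - exact: (emeasurable_funM mf (mpdf x s2)).
  - by move=> y; rewrite mule_ge0// lee_fin normal_pdf_ge0.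
rewrite [RHS](ge0_integral_nlaw s0 mf f0).
have mG := measurable_fun_fubini_tonelli_F (m2 := nlaw s2) _ mf2 (fun z => f0 (z.1 + z.2)).
have G0 x : (0 <= \int[nlaw s2]_y f (x + y)%R)%E by apply: integral_ge0 => y _.
rewrite [LHS](ge0_integral_nlaw s10 mG G0).
transitivity (\int[mu]_x \int[mu]_z
    (f z * (normal_pdf 0 s1 x * normal_pdf x s2 z)%:E))%E.
  apply: eq_integral => x _; rewrite {1}/fubini_F inner -ge0_integralZr//.
  - by apply: eq_integral => z _; rewrite -muleA -EFinM [normal_pdf 0 s1 x * _]mulrC.
  - exact: (emeasurable_funM mf (mpdf x s2)).
  - by move=> z _; rewrite mule_ge0// lee_fin normal_pdf_ge0.
  - by rewrite lee_fin normal_pdf_ge0.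
rewrite [LHS](fubini_tonelli (m1 := mu) (m2 := mu) (fun w => (f w.2 *
  (normal_pdf 0 s1 w.1 * normal_pdf w.1 s2 w.2)%:E)%E)); last 2 first.
- apply: emeasurable_funM; first exact: (measurableT_comp mf).
  apply/measurable_EFinP; apply: measurable_funM => //.
  by apply: (measurableT_comp (measurable_normal_pdf 0 s1)).
- by move=> w; rewrite mule_ge0// lee_fin mulr_ge0// normal_pdf_ge0.
apply: eq_integral => z _ /=.
under eq_integral do rewrite convolution_normal_pdf// EFinM muleA.
rewrite ge0_integralZl//.
- by rewrite integral_normal_pdf mule1.
- exact: mpdf.
- by move=> x _; rewrite lee_fin normal_pdf_ge0.
- by rewrite mule_ge0// lee_fin normal_pdf_ge0.
Qed.

Lemma itg_expR_nlaw (s l : R) : itg (nlaw s) (fun x => expR (l * x)).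
Proof.
have mf : measurable_fun setT (fun x : R => expR (l * x)).
  by apply: measurableT_comp => //; exact: measurable_funM.
apply/integrableP; split; first exact/measurable_EFinP.
rewrite [ltLHS](_ : _ = \int[nlaw s]_x (expR (l * x))%:E)%E; last first.
  by apply: eq_integral => x _; rewrite /= ger0_norm ?expR_ge0.
by rewrite mgf_nlaw ltry.
Qed.

Lemma Ex_expR_nlaw (s l : R) :
  Ex (nlaw s) (fun x => expR (l * x)) = expR (l ^+ 2 * s ^+ 2 / 2).
Proof. by rewrite /Ex mgf_nlaw. Qed.

Lemma expR_norm_le_cosh (x : R) : expR `|x| <= expR x + expR (- x).
Proof.
by have [x0|x0] := leP 0 x; [rewrite ger0_norm|rewrite ltr0_norm//];
  rewrite ?lerDl ?lerDr ?expR_ge0.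
Qed.

(** The inequality y <= e^y at y = |x| / k, raised to the power k. All moments of the normal law
    inherit their integrability from exponential moments in this way. *)
Lemma norm_exp_le_expR (k : nat) (x : R) : `|x| ^+ k <= k%:R ^+ k * expR `|x|.
Proof.
case: k => [|k]; first by rewrite !expr0 mul1r -expR0 ler_expR.
rewrite [in expR _](_ : `|x| = k.+1%:R * (`|x| / k.+1%:R)); last first.
  by rewrite mulrCA divff ?mulr1.
rewrite expRM_natl -exprMn ler_pXn2r ?nnegrE// ?mulr_ge0 ?expR_ge0//.
rewrite -ler_pdivrMl//.
by rewrite (le_trans _ (expR_ge1Dx _))// mulrC lerDr.
Qed.

Lemma norm_exp_le (k : nat) (x : R) :
  `|x| ^+ k <= k%:R ^+ k * (expR x + expR (- x)).
Proof.
apply: (le_trans (norm_exp_le_expR k x)).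
by rewrite ler_wpM2l ?exprn_ge0// expR_norm_le_cosh.
Qed.

Lemma itg_norm_exp_nlaw (s : R) (k : nat) : itg (nlaw s) (fun x => `|x| ^+ k).
Proof.
have I : itg (nlaw s) (fun x => k%:R ^+ k * (expR (1 * x) + expR ((-1) * x))).
  by apply: itgZ; apply: itgD; exact: itg_expR_nlaw.
apply: (itg_le _ _ I).
  apply: (@measurable_funX _ _ _ _ (Num.norm : R -> R)); exact: normr_measurable.
by move=> x; rewrite mul1r mulN1r ger0_norm ?exprn_ge0// norm_exp_le.
Qed.

Lemma itg_exp_nlaw (s : R) (k : nat) : itg (nlaw s) (fun x => x ^+ k).
Proof.
apply: (itg_le _ _ (itg_norm_exp_nlaw s k)); first exact: measurable_funX.
by move=> x; rewrite normrX.
Qed.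

(* Letting [l] tend to 0 identifies the first two moments. *)
Lemma mgf_nlaw_taylor (s : R) : exists C : R, 0 <= C /\ forall l : R, `|l| <= 1 ->
  `|l * Ex (nlaw s) id + l ^+ 2 / 2 * (Ex (nlaw s) (fun x => x ^+ 2) - s ^+ 2)|
    <= C * `|l| ^+ 3.
Proof.
have I2 : itg (nlaw s) (fun x => expR (2 * x) + expR ((-2) * x)).
  by apply: itgD; exact: itg_expR_nlaw.
set D := Ex (nlaw s) (fun x => expR (2 * x) + expR ((-2) * x)).
have D0 : 0 <= D by apply: Ex_ge0 => x; rewrite addr_ge0 ?expR_ge0.
(* The cubic remainder |l x|^3 e^|l x| is at most 27 |l|^3 e^(2|x|), with 27 = 3^3 from
   [norm_exp_le_expR], and [D] bounds the expectation of e^(2|x|). The other summand bounds the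
   remainder of the moment generating function itself. *)
exists (27 * D + s ^+ 4 * expR (s ^+ 2)); split.
  by rewrite addr_ge0// mulr_ge0 ?expR_ge0// exprn_even_ge0.
move=> l l1.
have I1 : itg (nlaw s) id by exact: (itg_exp_nlaw s 1).
have Isq : itg (nlaw s) (fun x => x ^+ 2) by exact: itg_exp_nlaw.
have Ie := itg_expR_nlaw s l.
pose r x := expR (l * x) - 1 - l * x - (l * x) ^+ 2 / 2.
have rE : r = (fun x => expR (l * x) - (1 + (l * x + (l ^+ 2 / 2) * x ^+ 2))).
  by apply/funext => x; rewrite /r; field.
have Ip : itg (nlaw s) (fun x => 1 + (l * x + (l ^+ 2 / 2) * x ^+ 2)).
  by apply: itgD; [exact: itg_cst|apply: itgD; apply: itgZ].
have Ir : itg (nlaw s) r by rewrite rE; exact: itgB.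
have Er : Ex (nlaw s) r = expR (l ^+ 2 * s ^+ 2 / 2) - 1 - l * Ex (nlaw s) id -
    l ^+ 2 / 2 * Ex (nlaw s) (fun x => x ^+ 2).
  rewrite rE ExB// Ex_expR_nlaw ExD ?Ex_cst ?ExD ?ExZ//; first by ring.
  - exact: itgZ.
  - exact: itgZ.
  - exact: itg_cst.
  - by apply: itgD; apply: itgZ.
have rb : `|Ex (nlaw s) r| <= 27 * D * `|l| ^+ 3.
  rewrite -[leRHS](_ : `|l| ^+ 3 * 27 * D = _); last by ring.
  rewrite -ExZ//; apply: Ex_abs_le => //; first exact: itgZ.
  move=> x; apply: (le_trans (expR_taylor3 _)).
  rewrite normrM exprMn -[leLHS]mulrA -[leRHS]mulrA ler_wpM2l ?exprn_ge0//.
  have lx : `|l| * `|x| <= `|x| by rewrite ler_piMl.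
  apply: (@le_trans _ _ (`|x| ^+ 3 * expR `|x|)).
    by rewrite ler_wpM2l ?exprn_ge0// ler_expR.
  apply: (@le_trans _ _ (27 * (expR `|x| * expR `|x|))).
    rewrite mulrA ler_wpM2r ?expR_ge0//.
    by have := norm_exp_le_expR 3 x; rewrite (_ : 3 ^+ 3 = 27)//; ring.
  rewrite ler_wpM2l// -expRD.
  have := expR_norm_le_cosh (2 * x); rewrite normrM ger0_norm// mulNr.
  by rewrite (_ : 2 * `|x| = `|x| + `|x|) //; ring.
have sb : `|expR (l ^+ 2 * s ^+ 2 / 2) - 1 - l ^+ 2 * s ^+ 2 / 2| <=
    s ^+ 4 * expR (s ^+ 2) * `|l| ^+ 3.
  apply: (le_trans (expR_taylor2 _)).
  have y0 : 0 <= l ^+ 2 * s ^+ 2 / 2 by rewrite divr_ge0// mulr_ge0// sqr_ge0.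
  have l3 : l ^+ 4 <= `|l| ^+ 3.
    have -> : l ^+ 4 = `|l| ^+ 4 by rewrite -normrX ger0_norm// exprn_even_ge0.
    by rewrite exprSr ler_piMr ?exprn_ge0.
  have l2 : l ^+ 2 <= 1 by rewrite -real_normK ?num_real// expr_le1.
  rewrite ger0_norm// -[leRHS]mulrA [leRHS]mulrCA [leRHS]mulrC -[leRHS]mulrA.
  rewrite [leRHS](_ : _ = (s ^+ 4 * `|l| ^+ 3) * expR (s ^+ 2)); last by ring.
  apply: ler_pM; rewrite ?exprn_ge0 ?expR_ge0//.
    rewrite [leLHS](_ : _ = s ^+ 4 * (l ^+ 4 / 4)); last by field.
    have l4 := exprn_even_ge0 l (isT : ~~ odd 4).
    by rewrite ler_wpM2l ?exprn_even_ge0//; lra.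
  rewrite ler_expR; have := sqr_ge0 s; nra.
rewrite [X in `|X|](_ : _ = (expR (l ^+ 2 * s ^+ 2 / 2) - 1 - l ^+ 2 * s ^+ 2 / 2) -
   Ex (nlaw s) r); last by rewrite Er; field.
by rewrite (le_trans (ler_normB _ _))// addrC mulrDl lerD.
Qed.

Lemma Ex_nlaw (s : R) : Ex (nlaw s) id = 0 /\ Ex (nlaw s) (fun x => x ^+ 2) = s ^+ 2.
Proof.
have [C [C0 H]] := mgf_nlaw_taylor s.
set m := Ex _ id in H *; set q := Ex _ _ in H *.
have key (x : R) : (forall l, 0 < l <= 1 -> `|x| <= (2 * C) * l) -> x = 0.
  move=> Hx; apply/eqP; rewrite -normr_le0; apply/ler_addgt0Pl => e e0.
  rewrite addr0; have C1 : 0 < 2 * C + 1 by rewrite ltr_wpDl// mulr_ge0.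
  have [e1|e1] := leP (e / (2 * C + 1)) 1.
    apply: (le_trans (Hx (e / (2 * C + 1)) _)).
      by rewrite divr_gt0.
    by rewrite mulrCA ger_pMr// ler_pdivrMr// mul1r lerDl.
  apply: (le_trans (Hx 1 _)); first by rewrite ltr01 lexx.
  rewrite mulr1; move: e1; rewrite ltr_pdivlMr// mul1r => /ltW; apply: le_trans.
  by rewrite lerDl.
(* Having the estimate at both l and -l separates the odd term, which carries the mean, from the
   even one, which carries the variance. *)
have HH l : 0 < l <= 1 -> `|l * m + l ^+ 2 / 2 * (q - s ^+ 2)| <= C * l ^+ 3 /\
    `|- l * m + l ^+ 2 / 2 * (q - s ^+ 2)| <= C * l ^+ 3.
  move=> /andP[l0 l1]; have := H l; have := H (- l).
  by rewrite normrN (ger0_norm (ltW l0)) sqrrN => /(_ l1) ? /(_ l1).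
split.
  apply: key => l l01; have [/ler_normlP[a1 a2] /ler_normlP[b1 b2]] := HH l l01.
  case/andP: l01 => l0 l1.
  have : `|l * m| <= C * l ^+ 3 by apply/ler_normlP; split; lra.
  rewrite normrM (gtr0_norm l0) -ler_pdivlMl// => /le_trans; apply.
  rewrite mulrCA (_ : l^-1 * l ^+ 3 = l * l); last by field; rewrite gt_eqF.
  rewrite mulrA; apply: ler_wpM2r; first exact: ltW.
  have : C * l <= C by rewrite ler_piMr.
  by lra.
apply/eqP; rewrite -subr_eq0; apply/eqP.
apply: key => l l01; have [/ler_normlP[a1 a2] /ler_normlP[b1 b2]] := HH l l01.
case/andP: l01 => l0 l1.
have : `|l ^+ 2 / 2 * (q - s ^+ 2)| <= C * l ^+ 3 by apply/ler_normlP; split; lra.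
have l20 : 0 < l ^+ 2 / 2 by rewrite divr_gt0// exprn_gt0.
rewrite normrM (gtr0_norm l20) -ler_pdivlMl// => /le_trans; apply.
by rewrite (_ : _ * (C * _) = 2 * C * l)//; field; rewrite gt_eqF.
Qed.

End normal.

(** * Uniqueness of Gaussian laws *)

Section trigonometric_closure.
Context (R : realType).

(* The iterates of this polynomial converge to the sign function on [-1, 1]. *)
Definition sgstep (x : R) : R := (3 * x - x * x * x) / 2.

Lemma sgstep_bounds (x : R) : 0 < x <= 1 ->
  [/\ x <= sgstep x, sgstep x <= 1 & 1 - sgstep x <= (1 - x) * (1 - x / 2)].
Proof.
move=> /andP[x0 x1]; have x1' : 0 <= 1 - x by rewrite subr_ge0.
have x0' := ltW x0; rewrite /sgstep; split; rewrite -subr_ge0.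
- rewrite (_ : _ - _ = x * (1 - x) * (1 + x) / 2); last by field.
  by rewrite divr_ge0// !mulr_ge0// addr_ge0.
- rewrite (_ : _ - _ = (1 - x) * (1 - x) * (2 + x) / 2); last by field.
  by rewrite divr_ge0// !mulr_ge0// addr_ge0.
- rewrite (_ : _ - _ = (1 - x) * (x * x) / 2); last by field.
  by rewrite divr_ge0// !mulr_ge0.
Qed.

Lemma sgstepN (x : R) : sgstep (- x) = - sgstep x.
Proof. by rewrite /sgstep; field. Qed.

Lemma iter_sgstep0 k : iter k sgstep 0 = 0 :> R.
Proof. by elim: k => //= k ->; rewrite /sgstep; field. Qed.

Lemma iter_sgstepN k (x : R) : iter k sgstep (- x) = - iter k sgstep x.
Proof. by elim: k => //= k ->; rewrite sgstepN. Qed.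

(** The iterates never fall below x, so the contraction factor 1 - y / 2 of [sgstep_bounds] at the
    current iterate y is at most 1 - x / 2, and the gap to 1 shrinks geometrically. *)
Lemma iter_sgstep_gt0 k (x : R) : 0 < x <= 1 ->
  x <= iter k sgstep x <= 1 /\ 1 - iter k sgstep x <= (1 - x / 2) ^+ k.
Proof.
move=> /andP[x0 x1]; elim: k => [|k [/andP[IH1 IH2] IH3]] /=.
  by rewrite lexx x1 expr0; split=> //; lra.
have [h1 h2 h3] := @sgstep_bounds (iter k sgstep x) (introT andP (conj (lt_le_trans x0 IH1) IH2)).
rewrite h2 (le_trans IH1 h1); split=> //; rewrite exprSr.
apply: (le_trans h3); apply: ler_pM => //; try lra.
Qed.

Lemma iter_sgstep_norm k (x : R) : `|x| <= 1 -> `|iter k sgstep x| <= 1.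
Proof.
have pos y : 0 < y -> y <= 1 -> `|iter k sgstep y| <= 1.
  move=> y0 y1; have [/andP[h1 h2] _] := @iter_sgstep_gt0 k y (introT andP (conj y0 y1)).
  by rewrite ger0_norm// (le_trans (ltW y0)).
have [x0|x0|->] := ltgtP x 0; last by rewrite iter_sgstep0 normr0.
- by rewrite ltr0_norm// => x1; rewrite -[x]opprK iter_sgstepN normrN pos ?oppr_gt0.
- by rewrite gtr0_norm// => x1; exact: pos.
Qed.

Lemma iter_sgstep_cvg (x : R) : `|x| <= 1 -> iter k sgstep x @[k --> \oo] --> Num.sg x.
Proof.
have pos y : 0 < y -> y <= 1 -> iter k sgstep y @[k --> \oo] --> (1 : R).
  move=> y0 y1.
  have g0 : 1 - (1 - y / 2) ^+ k @[k --> \oo] --> (1 : R).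
    rewrite -[X in _ --> X]subr0; apply: cvgB; first exact: cvg_cst.
    by apply: cvg_expr; rewrite ger0_norm; lra.
  apply: squeeze_cvgr; [|exact: g0|exact: (cvg_cst (1 : R))].
  near=> k; have [/andP[_ ->] h] := @iter_sgstep_gt0 k y (introT andP (conj y0 y1)).
  by rewrite andbT lerBlDr -lerBlDl.
have [x0|x0|->] := ltgtP x 0.
- rewrite ltr0_norm// ltr0_sg// => x1.
  rewrite (_ : (fun k => _) = (fun k => - iter k sgstep (- x))); last first.
    by apply/funext => k; rewrite iter_sgstepN opprK.
  by apply: cvgN; apply: pos => //; rewrite oppr_gt0.
- by rewrite gtr0_norm// gtr0_sg//; exact: pos.
- move=> _; rewrite sgr0 (_ : (fun k => _) = cst 0); first exact: cvg_cst.
  by apply/funext => k; rewrite iter_sgstep0.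
Unshelve. all: by end_near. Qed.

Variable p : nat.

(** The closure rules are those under which equality of two expectations persists: linear
    combinations, and bounded pointwise limits by dominated convergence. For the generators,
    equality of expectations depends only on the laws of linear forms. The phase [t] makes sines
    available and lets products of generators be expanded. *)
Inductive trigcl : (p.-tuple R -> R) -> Prop :=
| tc_cos (c : 'I_p -> R) (t : R) :
    trigcl (fun y => cos (\sum_i c i * tnth y i + t))
| tc_lin (a b : R) f g : trigcl f -> trigcl g ->
    trigcl (fun y => a * f y + b * g y)
| tc_lim (f_ : nat -> p.-tuple R -> R) (f : p.-tuple R -> R) (M : R) :
    (forall k, trigcl (f_ k)) ->
    (forall k y, `|f_ k y| <= M) ->
    (forall y, f_ k y @[k --> \oo] --> f y) -> trigcl f.

Lemma tc_ext f g : trigcl f -> f =1 g -> trigcl g.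
Proof. by move=> tf fg; rewrite (_ : g = f)//; apply/funext => y. Qed.

Lemma lim_bnd (u : nat -> R) (l M : R) :
  (forall k, `|u k| <= M) -> u k @[k --> \oo] --> l -> `|l| <= M.
Proof.
move=> uM ul; have nl : `|u k| @[k --> \oo] --> `|l| by exact: cvg_norm.
rewrite -(cvg_lim (@Rhausdorff R) nl); apply: limr_le; last exact: nearW.
by apply/cvg_ex; exists `|l|.
Qed.

Lemma tc_bnd f : trigcl f -> exists M, forall y, `|f y| <= M.
Proof.
elim=> [c t|a b {}f g _ [M fM] _ [N gN]|f_ {}f M _ _ fM ff].
- by exists 1 => y; exact: cos_max.
- exists (`|a| * M + `|b| * N) => y.
  by rewrite (le_trans (ler_normD _ _))// !normrM lerD// ler_wpM2l.
- by exists M => y; exact: lim_bnd (ff y).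
Qed.

Lemma tc_meas f : trigcl f -> measurable_fun setT f.
Proof.
elim=> [c t|a b {}f g _ mf _ mg|f_ {}f M _ mf _ ff].
- apply: measurableT_comp.
    by apply: continuous_measurable_fun; exact: continuous_cos.
  apply: measurable_funD => //; apply: measurable_sum => i.
  by apply: measurable_funM => //; exact: measurable_tnth.
- by apply: measurable_funD; exact: measurable_funM.
- by apply: (measurable_fun_cvg mf) => y _; exact: ff.
Qed.

(** The generators multiply by cos A cos B = (cos(A + B) + cos(A - B)) / 2; an induction on each
    factor extends this to the class, boundedness of the other factor keeping the limit rule
    applicable. *)
Lemma tc_mul f g : trigcl f -> trigcl g -> trigcl (fun y => f y * g y).
Proof.
move=> tf tg; have [N gN] := tc_bnd tg.
have cosg c t : forall g, trigcl g ->
    trigcl (fun y => cos (\sum_i c i * tnth y i + t) * g y).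
  move=> {tg gN N}{}g; elim=> [c' t'|a b f1 f2 _ t1 _ t2|f_ f1 M _ tf_ fM ff].
  - have t1 := tc_cos (fun i => c i + c' i) (t + t').
    have t2 := tc_cos (fun i => c i - c' i) (t - t').
    apply: (tc_ext (tc_lin (1/2) (1/2) t1 t2)) => y.
    set A := \sum_i c i * tnth y i; set B := \sum_i c' i * tnth y i.
    rewrite (_ : \sum_i (c i + c' i) * _ = A + B); last first.
      by rewrite -big_split/=; apply: eq_bigr => i _; rewrite mulrDl.
    rewrite (_ : \sum_i (c i - c' i) * _ = A - B); last first.
      by rewrite -sumrB/=; apply: eq_bigr => i _; rewrite mulrBl.
    rewrite (_ : A + B + (t + t') = (A + t) + (B + t')); last by ring.
    rewrite (_ : A - B + (t - t') = (A + t) - (B + t')); last by ring.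
    by rewrite cosD cosB; field.
  - by apply: (tc_ext (tc_lin a b t1 t2)) => y; ring.
  - apply: (tc_lim (M := M) tf_) => [k y|y].
      rewrite normrM -[leRHS]mul1r; apply: ler_pM => //; exact: cos_max.
    by apply: cvgM; [exact: cvg_cst|exact: ff].
elim: tf => [c t|a b f1 f2 _ t1 _ t2|f_ f1 M _ tf_ fM ff].
- exact: cosg.
- by apply: (tc_ext (tc_lin a b t1 t2)) => y; ring.
- apply: (tc_lim (M := M * N) tf_) => [k y|y].
    by rewrite normrM ler_pM.
  by apply: cvgM; [exact: ff|exact: cvg_cst].
Qed.

Lemma tc_cst (c : R) : trigcl (fun=> c).
Proof.
have t := tc_cos (fun=> 0) 0.
apply: (tc_ext (tc_lin c 0 t t)) => y.
by rewrite big1 ?addr0 ?cos0 ?mulr1 ?mul0r ?addr0// => i _; rewrite mul0r.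
Qed.

Lemma tc_sub1 f : trigcl f -> trigcl (fun y => 1 - f y).
Proof. by move=> tf; apply: (tc_ext (tc_lin 1 (-1) (tc_cst 1) tf)) => y; ring. Qed.

(** Since [sgstep] is a polynomial, its iterates stay in the class by [tc_mul], and their bounded
    pointwise limit is the sign. *)
Lemma tc_sg f : trigcl f -> (forall y, `|f y| <= 1) -> trigcl (fun y => Num.sg (f y)).
Proof.
move=> tf f1; have tk k : trigcl (fun y => iter k sgstep (f y)).
  elim: k => //= k tk; have t3 := tc_mul (tc_mul tk tk) tk.
  by apply: (tc_ext (tc_lin (3/2) (-1/2) tk t3)) => y; rewrite /sgstep; field.
apply: (tc_lim (M := 1) tk) => [k y|y].
  exact: iter_sgstep_norm.
exact: iter_sgstep_cvg.
Qed.

(** The sine of (y_i - a) / (k + 1) has the sign of y_i - a once k + 1 exceeds |y_i - a|, because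
    its argument then lies in (-pi, pi). For a sign s, the number (s + s^2) / 2 is 1 if s = 1 and 0
    otherwise, which makes the half-space open. *)
Lemma tc_halfspace (i : 'I_p) (a : R) : trigcl (\1_[set y | a < tnth y i]).
Proof.
pose s (k : nat) y := sin ((tnth y i - a) / k.+1%:R).
have ts k : trigcl (s k).
  apply: (tc_ext (tc_cos (fun j => (j == i)%:R / k.+1%:R) (- a / k.+1%:R - pi / 2))) => y.
  rewrite /s addrA cosBpihalf (bigD1 i)//= eqxx big1 ?addr0 => [|j ji].
    by congr sin; rewrite mulr1n; field.
  by rewrite (negbTE ji) !mul0r.
have tsg k := tc_sg (ts k) (fun y => sin_max _).
have tk k := tc_lin (1/2) (1/2) (tsg k) (tc_mul (tsg k) (tsg k)).
apply: (tc_lim (M := 1) tk) => [k y|y].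
  by rewrite ler_norml; case: sgrP => _; lra.
apply: cvg_near_cst.
near=> k.
have kb : `|tnth y i - a| < k.+1%:R.
  rewrite (@lt_trans _ _ k%:R)// ?ltr_nat//.
  near: k; exact: nbhs_infty_gtr.
have z1 : `|(tnth y i - a) / k.+1%:R| < pi.
  rewrite (@lt_le_trans _ _ 1)//; last by rewrite (le_trans _ (pi_ge2 R))// ler1n.
  by rewrite normrM normfV [X in _ / X]ger0_norm// ltr_pdivrMr// mul1r.
rewrite indicE /s; have [ay|ya|->] := ltgtP a (tnth y i).
- have z0 : 0 < (tnth y i - a) / k.+1%:R by rewrite divr_gt0// subr_gt0.
  rewrite gtr0_sg; last by rewrite sin_gt0_pi// z0 -(gtr0_norm z0).
  by rewrite mem_set//=; lra.
- have z0 : 0 < - ((tnth y i - a) / k.+1%:R).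
    by rewrite oppr_gt0 pmulr_llt0// subr_lt0.
  rewrite -[X in sin X]opprK sinN sgrN gtr0_sg; last first.
    by rewrite sin_gt0_pi// z0 -(gtr0_norm z0) normrN.
  rewrite memNset/=; first lra.
  by apply/negP; rewrite -leNgt ltW.
- rewrite subrr mul0r sin0 sgr0 memNset/=; first lra.
  by rewrite ltxx.
Unshelve. all: by end_near. Qed.

(** For a countable union, the finite products of the functions 1 - 1_(F j) stay in [0, 1] and
    converge to the indicator of the complement, so the limit rule applies. *)
Lemma tc_sigma_algebra : sigma_algebra setT [set A | trigcl (\1_A)].
Proof.
split.
- by apply: (tc_ext (tc_cst 0)) => y; rewrite indicE in_set0.
- move=> B tB; apply: (tc_ext (tc_sub1 tB)) => y.
  by rewrite setTD !indicE in_setC; case: (y \in B); rewrite ?subrr ?subr0.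
- move=> F tF; pose g k y := \prod_(j < k) (1 - \1_(F j) y : R).
  have g01 k y : 0 <= g k y <= 1.
    apply/andP; split; first by apply: prodr_ge0 => j _; rewrite subr_ge0 indicE lern1 leq_b1.
    by apply: prodr_ile1 => j _; rewrite subr_ge0 lerBlDr lerDl indicE ler0n lern1 leq_b1.
  have tg k : trigcl (g k).
    elim: k => [|k tk].
      by apply: (tc_ext (tc_cst 1)) => y; rewrite /g big_ord0.
    apply: (tc_ext (tc_mul tk (tc_sub1 (tF k)))) => y.
    by rewrite /g big_ord_recr.
  suff tl : trigcl (fun y => 1 - \1_(\bigcup_k F k) y).
    by apply: (tc_ext (tc_sub1 tl)) => y; ring.
  apply: (tc_lim (M := 1) tg) => [k y|y].
    by have /andP[h1 h2] := g01 k y; rewrite ger0_norm.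
  apply: cvg_near_cst; have [[k _ Fky]|nF] := pselect ((\bigcup_k F k) y).
    exists k.+1 => // m /= km.
    rewrite /g (bigD1 (Ordinal km))//= !indicE !mem_set//; last by exists k.
    by rewrite subrr mul0r.
  apply: nearW => k; rewrite /g big1 => [|j _].
    by rewrite indicE memNset// subr0.
  by rewrite indicE memNset ?subr0// => Fj; apply: nF; exists j.
Qed.

Lemma tc_measurable (A : set (p.-tuple R)) : measurable A -> trigcl (\1_A).
Proof.
move: A; apply: smallest_sub; first exact: tc_sigma_algebra.
move=> C; rewrite -bigcup_seq => -[i _ [A mA <-]] /=; rewrite setTI.
have [s0 sC sU] := tc_sigma_algebra.
suff : @measurable _ R `<=` [set A | trigcl (\1_((fun y : p.-tuple R => tnth y i) @^-1` A))].
  by move/(_ _ mA).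
rewrite (_ : measurable = <<s @RGenOInfty.G R >>); last exact: (@RGenOInfty.measurableE R).
apply: smallest_sub.
  split => //.
  - by move=> B tB; have := sC _ tB; rewrite !setTD preimage_setC.
  - by move=> F tF; exact: (sU (fun k => (fun y : p.-tuple R => tnth y i) @^-1` F k) tF).
move=> B [a ->] /=.
by rewrite (_ : _ @^-1` _ = [set y | a < tnth y i]);
  [exact: tc_halfspace|apply/seteqP; split => y /=; rewrite in_itv/= andbT].
Qed.

End trigonometric_closure.

Lemma rvec_measurable d d' (W : measurableType d) (T : measurableType d') n
  (Y : 'I_n -> W -> T) :
  (forall i, measurable_fun setT (Y i)) -> measurable_fun setT (rvec Y).
Proof.
move=> mY; apply/measurable_fun_tnthP => i.
by rewrite (_ : _ \o _ = Y i)//; apply/funext => w /=; rewrite tnth_mktuple.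
Qed.

(* The Cramer-Wold device; [trigcl] contains the indicators of all measurable
   sets, which replaces the inversion of characteristic functions. *)
Lemma same_law_projections (R : realType) d1 d2 (W1 : measurableType d1)
  (W2 : measurableType d2) (P1 : probability W1 R) (P2 : probability W2 R) p
  (Y1 : 'I_p -> W1 -> R) (Y2 : 'I_p -> W2 -> R) :
  (forall i, measurable_fun setT (Y1 i)) -> (forall i, measurable_fun setT (Y2 i)) ->
  (forall c : 'I_p -> R, same_law P1 (fun w => \sum_i c i * Y1 i w)
                                  P2 (fun w => \sum_i c i * Y2 i w)) ->
  same_law P1 (rvec Y1) P2 (rvec Y2).
Proof.
move=> m1 m2 H.
have mr1 := rvec_measurable m1; have mr2 := rvec_measurable m2.
have E f : trigcl f -> Ex P1 (f \o rvec Y1) = Ex P2 (f \o rvec Y2).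
  elim=> [c t|a b {}f g tf Ef tg Eg|f_ {}f M tf Ef fM ff].
  - have sum_meas d (W : measurableType d) (Y : 'I_p -> W -> R) :
        (forall i, measurable_fun setT (Y i)) ->
        measurable_fun setT (fun w => \sum_i c i * Y i w).
      by move=> mY; apply: measurable_sum => i; exact: measurable_funM.
    have mc : measurable_fun setT (fun x : R => cos (x + t)).
      apply: measurableT_comp; last exact: measurable_funD.
      by apply: continuous_measurable_fun; exact: continuous_cos.
    have := same_law_Ex (sum_meas _ _ _ m1) (sum_meas _ _ _ m2) (H c) mc.
    have cE W (Y : 'I_p -> W -> R) : (fun y : p.-tuple R => cos (\sum_i c i * tnth y i + t)) \o rvec Y =
        (fun x : R => cos (x + t)) \o (fun w => \sum_i c i * Y i w).
      apply/funext => w /=; congr (cos (_ + _)).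
      by apply: eq_bigr => i _; rewrite tnth_mktuple.
    by rewrite !cE.
  - have I d (W : measurableType d) (P : probability W R) (Y : W -> p.-tuple R) h :
        measurable_fun setT Y -> trigcl h -> itg P (h \o Y).
      move=> mY th; have [M hM] := tc_bnd th.
      apply: (@itg_bnd _ _ _ _ _ M) => [|w]; last exact: hM.
      by apply: measurableT_comp => //; exact: tc_meas.
    have := I _ _ P1 _ _ mr1 tf; have := I _ _ P1 _ _ mr1 tg.
    have := I _ _ P2 _ _ mr2 tf; have := I _ _ P2 _ _ mr2 tg => I1 I2 I3 I4.
    have L d (W : measurableType d) (P : probability W R) (Y : W -> p.-tuple R) :
        itg P (f \o Y) -> itg P (g \o Y) ->
        Ex P ((fun y => a * f y + b * g y) \o Y) = a * Ex P (f \o Y) + b * Ex P (g \o Y).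
      by move=> J1 J2; rewrite -!ExZ// -ExD//; exact: itgZ.
    by rewrite !L// Ef Eg.
  - have C d (W : measurableType d) (P : probability W R) (Y : W -> p.-tuple R) :
        measurable_fun setT Y -> Ex P (f_ k \o Y) @[k --> \oo] --> Ex P (f \o Y).
      move=> mY; apply: (@Ex_cvg _ _ _ P (fun k => f_ k \o Y) _ M) => [k|k w|w].
      - by apply: measurableT_comp => //; exact: tc_meas.
      - exact: fM.
      - exact: ff.
    have C1 := C _ _ P1 _ mr1; have C2 := C _ _ P2 _ mr2.
    apply: (cvg_unique (@Rhausdorff R) C1).
    have EE : (fun k => Ex P1 (f_ k \o rvec Y1)) = (fun k => Ex P2 (f_ k \o rvec Y2)) by exact/funext.
    by rewrite /= EE.
move=> A mA.
have ind d (W : measurableType d) (P : probability W R) (Y : W -> p.-tuple R) :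
    measurable_fun setT Y -> (Ex P (\1_A \o Y))%:E = P (Y @^-1` A).
  move=> mY; rewrite -Ex_indic; first by [].
  exact: measurable_preimT.
by rewrite -!ind// (E _ (tc_measurable mA)).
Qed.

(** * Centred Gaussian vectors with possibly singular covariance *)

Section gaussian_vectors.
Context (R : realType).

Definition qform p (Sg : 'I_p -> 'I_p -> R) (c : 'I_p -> R) : R :=
  \sum_i \sum_j c i * c j * Sg i j.

(** A centred Gaussian vector with covariance [Sg], given through its linear forms, so that a
    singular [Sg] needs no density. *)
Definition gvec d (W : measurableType d) (P : probability W R) p
    (Y : 'I_p -> W -> R) (Sg : 'I_p -> 'I_p -> R) : Prop :=
  [/\ forall i, measurable_fun setT (Y i),
      forall i j, Sg i j = Sg j i,
      forall c, 0 <= qform Sg c &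
      forall c, same_law P (fun w => \sum_i c i * Y i w)
        (nlaw (Num.sqrt (qform Sg c))) id].

Lemma qformZ p (Sg : 'I_p -> 'I_p -> R) a c :
  qform Sg (fun i => a * c i) = a ^+ 2 * qform Sg c.
Proof.
rewrite /qform mulr_sumr; apply: eq_bigr => i _; rewrite mulr_sumr.
by apply: eq_bigr => j _; ring.
Qed.

Lemma qform_lin p (S1 S2 : 'I_p -> 'I_p -> R) a b c :
  qform (fun i j => a * S1 i j + b * S2 i j) c = a * qform S1 c + b * qform S2 c.
Proof.
rewrite /qform !mulr_sumr -big_split/=; apply: eq_bigr => i _.
by rewrite !mulr_sumr -big_split/=; apply: eq_bigr => j _; ring.
Qed.

Lemma sum_delta p (i : 'I_p) (F : 'I_p -> R) : \sum_j (j == i)%:R * F j = F i.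
Proof.
rewrite (bigD1 i)//= eqxx mul1r big1 ?addr0// => j ji.
by rewrite (negbTE ji) mul0r.
Qed.

Lemma qform_delta2 p (Sg : 'I_p -> 'I_p -> R) a b i j :
  (forall i j, Sg i j = Sg j i) ->
  qform Sg (fun k => a * (k == i)%:R + b * (k == j)%:R) =
  a ^+ 2 * Sg i i + 2 * a * b * Sg i j + b ^+ 2 * Sg j j.
Proof.
move=> sS; rewrite /qform.
transitivity (\sum_k (a * (k == i)%:R + b * (k == j)%:R) * (a * Sg k i + b * Sg k j)).
  apply: eq_bigr => k _; rewrite -(sum_delta i (Sg k)) -(sum_delta j (Sg k)).
  rewrite !mulr_sumr -big_split/= mulr_sumr; apply: eq_bigr => l _; ring.
under eq_bigr do rewrite mulrDl -!mulrA.
rewrite big_split/= -!mulr_sumr !sum_delta (sS j i); ring.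
Qed.

Lemma sum_delta2 p a b i j (F : 'I_p -> R) :
  \sum_k (a * (k == i)%:R + b * (k == j)%:R) * F k = a * F i + b * F j.
Proof.
under eq_bigr do rewrite mulrDl -!mulrA.
by rewrite big_split/= -!mulr_sumr !sum_delta.
Qed.

Lemma same_law_nlaw_add d1 d2 (W1 : measurableType d1) (W2 : measurableType d2)
  (P1 : probability W1 R) (P2 : probability W2 R) (U : W1 -> R) (V : W2 -> R) s1 s2 :
  measurable_fun setT U -> measurable_fun setT V ->
  same_law P1 U (nlaw s1) id -> same_law P2 V (nlaw s2) id ->
  same_law (prodP P1 P2) (fun w => U w.1 + V w.2)
    (nlaw (Num.sqrt (s1 ^+ 2 + s2 ^+ 2))) id.
Proof.
move=> mU mV lU lV A mA.
have mid : measurable_fun [set: R] (id : R -> R) by exact: measurable_id.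
have mUV : measurable_fun setT (fun w : W1 * W2 => U w.1 + V w.2).
  by apply: measurable_funD; exact: measurableT_comp.
have mI : measurable_fun setT (fun x : R => (\1_A x)%:E : \bar R).
  by apply/measurable_EFinP; exact: measurable_indic.
have I0 x : (0 <= (\1_A x)%:E :> \bar R)%E by rewrite lee_fin.
have mI2 : measurable_fun setT (fun z : R * R => (\1_A (z.1 + z.2))%:E : \bar R).
  by apply: (measurableT_comp mI); exact: measurable_funD.
transitivity (\int[prodP P1 P2]_w (\1_A (U w.1 + V w.2))%:E)%E.
  have := integral_indic (prodP P1 P2) measurableT (measurable_preimT mUV mA).
  by rewrite setIT => <-.
rewrite ge0_fubini//; last exact: (measurableT_comp mI).
transitivity (\int[P1]_x \int[nlaw s2]_y (\1_A (U x + y))%:E)%E.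
  apply: eq_integral => x _.
  apply: (same_law_ge0_integral (g := fun y => (\1_A (U x + y))%:E) mV mid lV) => //.
  by apply: (measurableT_comp mI); exact: measurable_funD.
transitivity (\int[nlaw s1]_x \int[nlaw s2]_y (\1_A (x + y))%:E)%E.
  have mG := measurable_fun_fubini_tonelli_F (m2 := nlaw s2) _ mI2 (fun z => I0 (z.1 + z.2)).
  have G0 x : (0 <= fubini_F (nlaw s2) (fun z : R * R => (\1_A (z.1 + z.2))%:E) x)%E.
    by apply: integral_ge0 => y _; exact: I0.
  exact: (same_law_ge0_integral mU mid lU mG G0).
rewrite (nlaw_add s1 s2 mI I0) preimage_id.
by rewrite integral_indic// setIT.
Qed.

Section one_vector.
Context d (W : measurableType d) (P : probability W R) p (Y : 'I_p -> W -> R)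
  (Sg : 'I_p -> 'I_p -> R).
Hypothesis gY : gvec P Y Sg.

Let mY i : measurable_fun setT (Y i). Proof. by case: gY. Qed.

Let mlin c : measurable_fun setT (fun w => \sum_i c i * Y i w).
Proof. by apply: measurable_sum => i; exact: measurable_funM. Qed.

Lemma gvec_mgf c l :
  (\int[P]_w (expR (l * \sum_i c i * Y i w))%:E =
   (expR (l ^+ 2 * qform Sg c / 2))%:E)%E.
Proof.
have [_ _ q0 lY] := gY.
have := same_law_ge0_integral (g := fun x : R => (expR (l * x))%:E) (mlin c)
  (@measurable_id _ R setT) (lY c).
rewrite mgf_nlaw sqr_sqrtr// => -> //.
by apply/measurable_EFinP; apply: measurableT_comp => //; exact: measurable_funM.
Qed.

Let itg_lin c k : itg P (fun w => (\sum_i c i * Y i w) ^+ k).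
Proof.
have [_ _ q0 lY] := gY.
exact: (same_law_itg (g := fun x : R => x ^+ k) (mlin c) (@measurable_id _ R setT) (lY c)
  (measurable_funX _ (@measurable_id _ R setT)) (itg_exp_nlaw _ k)).
Qed.

Let linE i w : \sum_k (1 * (k == i)%:R + 0 * (k == i)%:R) * Y k w = Y i w.
Proof. by rewrite sum_delta2 mul1r mul0r addr0. Qed.

Lemma gvec_itg i : itg P (Y i).
Proof.
have := itg_lin (fun k => 1 * (k == i)%:R + 0 * (k == i)%:R) 1%N.
by congr (itg P _); apply/funext => w; rewrite expr1 linE.
Qed.

Lemma gvec_itg3 i : itg P (fun w => `|Y i w| ^+ 3).
Proof.
have [_ _ q0 lY] := gY; pose c (k : 'I_p) : R := 1 * (k == i)%:R + 0 * (k == i)%:R.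
have := same_law_itg (g := fun x : R => `|x| ^+ 3) (mlin c) (@measurable_id _ R setT) (lY c).
rewrite (_ : _ \o _ = fun w => `|Y i w| ^+ 3); last by apply/funext => w; rewrite /= linE.
apply; last exact: itg_norm_exp_nlaw.
by apply: (@measurable_funX _ _ _ _ (Num.norm : R -> R)); exact: normr_measurable.
Qed.

Lemma gvec_mean i : Ex P (Y i) = 0.
Proof.
have [_ _ q0 lY] := gY; pose c (k : 'I_p) : R := 1 * (k == i)%:R + 0 * (k == i)%:R.
have := same_law_Ex (g := @id R) (mlin c) (@measurable_id _ R setT) (lY c).
rewrite (_ : _ \o _ = Y i); last by apply/funext => w; rewrite /= linE.
by move=> -> //; have [] := Ex_nlaw (Num.sqrt (qform Sg c)).
Qed.

Let sq_lin c : Ex P (fun w => (\sum_i c i * Y i w) ^+ 2) = qform Sg c.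
Proof.
have [_ _ q0 lY] := gY.
have := same_law_Ex (g := fun x : R => x ^+ 2) (mlin c) (@measurable_id _ R setT) (lY c).
move=> /(_ (measurable_funX _ (@measurable_id _ R setT))) ->.
by have [_] := Ex_nlaw (Num.sqrt (qform Sg c)); rewrite sqr_sqrtr.
Qed.

(** Polarization: the product is a quarter of the difference of the squares of Y i + Y j and Y i - Y
    j, which are linear forms. *)
Lemma gvec_cov i j : itg P (fun w => Y i w * Y j w) /\
  Ex P (fun w => Y i w * Y j w) = Sg i j.
Proof.
have [_ sS q0 lY] := gY.
pose c a b (k : 'I_p) : R := a * (k == i)%:R + b * (k == j)%:R.
have E : (fun w => Y i w * Y j w) = (fun w => 1/4 * (\sum_k c 1 1 k * Y k w) ^+ 2
    - 1/4 * (\sum_k c 1 (-1) k * Y k w) ^+ 2).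
  by apply/funext => w; rewrite /c !sum_delta2; field.
rewrite E; have I1 := itg_lin (c 1 1) 2; have I2 := itg_lin (c 1 (-1)) 2.
split; first by apply: itgB; exact: itgZ.
rewrite ExB; [|exact: itgZ..].
by rewrite !ExZ// !sq_lin /c !qform_delta2//; field.
Qed.

End one_vector.

Lemma gvec_ext d (W : measurableType d) (P : probability W R) p
  (Y Y' : 'I_p -> W -> R) (Sg Sg' : 'I_p -> 'I_p -> R) :
  gvec P Y Sg -> (forall i w, Y i w = Y' i w) -> (forall i j, Sg i j = Sg' i j) ->
  gvec P Y' Sg'.
Proof.
move=> gY YY SS.
have <- : Y = Y' by apply/funext => i; apply/funext => w; exact: YY.
have <- : Sg = Sg' by apply/funext => i; apply/funext => j; exact: SS.
exact: gY.
Qed.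

(** Independence is realized by the product space. The weights give both the interpolation a X + b Y
    between two vectors and the addition of one small independent increment. *)
Lemma gvec_add d1 d2 (W1 : measurableType d1) (W2 : measurableType d2)
  (P1 : probability W1 R) (P2 : probability W2 R) p (X : 'I_p -> W1 -> R)
  (Y : 'I_p -> W2 -> R) SX SY a b :
  gvec P1 X SX -> gvec P2 Y SY ->
  gvec (prodP P1 P2) (fun i w => a * X i w.1 + b * Y i w.2)
    (fun i j => a ^+ 2 * SX i j + b ^+ 2 * SY i j).
Proof.
move=> [mX sX qX lX] [mY sY qY lY].
have mlin d (W : measurableType d) (Z : 'I_p -> W -> R) (c : 'I_p -> R) :
    (forall i, measurable_fun setT (Z i)) ->
    measurable_fun setT (fun w => \sum_i c i * Z i w).
  by move=> mZ; apply: measurable_sum => i; exact: measurable_funM.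
split.
- by move=> i; apply: measurable_funD; apply: measurable_funM => //;
    exact: measurableT_comp.
- by move=> i j; rewrite sX sY.
- by move=> c; rewrite qform_lin addr_ge0// mulr_ge0 ?sqr_ge0.
- move=> c.
  have := same_law_nlaw_add (mlin _ _ X (fun i => a * c i) mX)
    (mlin _ _ Y (fun i => b * c i) mY) (lX _) (lY _).
  rewrite (sqr_sqrtr (qX _)) (sqr_sqrtr (qY _)) (qformZ SX a c) (qformZ SY b c).
  rewrite -(qform_lin SX SY (a ^+ 2) (b ^+ 2) c).
  rewrite (_ : (fun w : W1 * W2 => \sum_i c i * _) =
    (fun w : W1 * W2 => \sum_i a * c i * X i w.1 + \sum_i b * c i * Y i w.2)) //.
  apply/funext => w; rewrite -big_split/=; apply: eq_bigr => i _; ring.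
Qed.

Lemma gvec_same_law d1 d2 (W1 : measurableType d1) (W2 : measurableType d2)
  (P1 : probability W1 R) (P2 : probability W2 R) p (X : 'I_p -> W1 -> R)
  (Y : 'I_p -> W2 -> R) Sg :
  gvec P1 X Sg -> gvec P2 Y Sg -> same_law P1 (rvec X) P2 (rvec Y).
Proof.
move=> [mX _ _ lX] [mY _ _ lY]; apply: same_law_projections => // c A mA.
by rewrite lX// lY.
Qed.

End gaussian_vectors.

(** * Gaussian comparison of maxima *)

Section smoothing.
Context (R : realType).
Notation mu := (@lebesgue_measure R).

Lemma is_derive_affine (F f : R -> R) (a b t : R) :
  (forall x : R, is_derive x (1 : R) F (f x)) ->
  is_derive t (1 : R) (fun t => F (a + b * t)) (b * f (a + b * t)).
Proof.
move=> dF; have d1 : is_derive t (1 : R) (fun t : R => a + b * t) b.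
  by apply: is_derive_eq; rewrite /GRing.scale/=; ring.
have dFa := dF (a + b * t).
have := @is_derive1_comp R F (fun t => a + b * t) t (f (a + b * t)) b dFa d1.
by rewrite mulrC.
Qed.

(** Vanishing on a left half-line makes the integral from -oo converge and gives one antiderivative
    with the same property, so that the construction can be repeated. *)
Lemma antiderivative_left (f : R -> R) (m : R) :
  continuous f -> (forall x, x <= m -> f x = 0) ->
  exists F : R -> R, (forall x : R, is_derive x (1 : R) F (f x)) /\
    (forall x, x <= m -> F x = 0).
Proof.
move=> cf f0; exists (fun x => \int[mu]_(t in `]-oo, x]) f t); split; last first.
  move=> x xm; rewrite (@eq_Rintegral _ _ _ _ _ (cst 0)).
    by rewrite Rintegral_cst//= mul0r.
  by move=> t; rewrite inE/= in_itv/= => tx; rewrite f0// (le_trans tx).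
move=> x.
have mf : measurable_fun setT f by exact: continuous_measurable_fun.
have If : mu.-integrable `]-oo, x + 1] (EFin \o f).
  apply/integrable_mkcond => //.
  have Ic : mu.-integrable `[m, x + 1] (EFin \o f).
    apply: continuous_compact_integrable; first exact: segment_compact.
    exact: continuous_subspaceT.
  move/integrable_mkcond : Ic => /(_ (measurable_itv _)).
  apply: eq_integrable => // t _; rewrite !patchE !mem_setE !in_itv/=.
  have [tm|mt] := leP m t => //=.
  by case: ifP => // _; rewrite f0// ltW.
have x1 : x < x + 1 by rewrite ltrDl.
have [dF <-] := @continuous_FTC1 R f -oo%O x (x + 1) x1 If (ltNyr _) (cf x).
by rewrite derive1E; exact: (DeriveDef dF erefl).
Qed.

Lemma lipschitz_continuous (f : R -> R) (L : R) :
  (forall x y, `|f x - f y| <= L * `|x - y|) -> continuous f.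
Proof.
move=> fL x; apply/cvgrPdist_lt => e e0.
have L0 : 0 < `|L| + 1 by rewrite ltr_wpDl.
near=> y; apply: (le_lt_trans (fL x y)).
apply: (@le_lt_trans _ _ ((`|L| + 1) * `|x - y|)).
  by rewrite ler_wpM2r// (le_trans (ler_norm L))// lerDl.
rewrite -ltr_pdivlMl// mulrC; near: y.
by apply: cvgr_dist_lt; [exact: cvg_id|rewrite divr_gt0].
Unshelve. all: by end_near. Qed.

(* Two convolutions with a window of half-width h give a C^2 approximation. *)
Lemma smooth_lipschitz (f : R -> R) (m h : R) : 0 < h ->
  (forall x y, `|f x - f y| <= `|x - y|) -> (forall x, x <= m -> f x = 0) ->
  exists g g1 g2 : R -> R,
  [/\ (forall x : R, is_derive x (1 : R) g (g1 x)) /\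
      (forall x : R, is_derive x (1 : R) g1 (g2 x)),
      forall x, `|g x - f x| <= 4 * h,
      forall x, `|g1 x| <= 2,
      forall x, `|g2 x| <= h^-1 &
      forall x y, `|g2 x - g2 y| <= h^-1 ^+ 2 * `|x - y|].
Proof.
move=> h0 fL f0.
have cf : continuous f by apply: (@lipschitz_continuous f 1) => x y; rewrite mul1r.
have [F [dF F0]] := antiderivative_left cf f0.
have cF : continuous F.
  move=> x; apply: differentiable_continuous; apply/derivable1_diffP.
  by have [] := dF x.
have [H [dH _]] := antiderivative_left cF F0.
(* For a second antiderivative [H] of [f], the divided second difference [D H] is the convolution of
   [f] with the triangular kernel (k - |t|) / k^2 on [-k, k]. As [D] commutes with derivation, the
   derivatives of [D H] are [D F] and [D f]. The bounds come out as 2 k = 4 h, then 2, 2 / k = 1 / h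
   and 4 / k^2 = 1 / h^2. *)
pose k := 2 * h; have k0 : 0 < k by rewrite mulr_gt0.
have kN0 : k != 0 by rewrite gt_eqF.
pose D (u : R -> R) s := k ^- 2 * (u (s + k) - 2 * u s + u (s - k)).
have dD (u u' : R -> R) : (forall x : R, is_derive x (1 : R) u (u' x)) ->
    forall x : R, is_derive x (1 : R) (D u) (D u' x).
  move=> du x; rewrite /D.
  have d1 := @is_derive_affine u u' k 1 x du.
  have d2 := @is_derive_affine u u' (- k) 1 x du.
  have E1 : (fun t : R => u (k + 1 * t)) = (fun t => u (t + k)).
    by apply/funext => t; rewrite mul1r addrC.
  have E2 : (fun t : R => u (- k + 1 * t)) = (fun t => u (t - k)).
    by apply/funext => t; rewrite mul1r addrC.
  rewrite E1 in d1; rewrite E2 in d2.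
  apply: is_derive_eq; rewrite /GRing.scale/= !mul1r.
  by rewrite [k + x]addrC [- k + x]addrC; ring.
pose S (u : R -> R) s t := u (s + 1 * t) - 2 * u s + u (s + (-1) * t).
have bF s : `|F (s + k) - 2 * F s + F (s - k)| <= 2 * k * k.
  have := @mvt_bound R (S F s) (fun t => f (s + 1 * t) - f (s + (-1) * t)) (2 * k) k.
  rewrite /S !mulr0 !addr0 !mul1r !mulN1r (gtr0_norm k0).
  rewrite (_ : F s - 2 * F s + F s = 0) ?subr0; last by ring.
  apply => [t|t tk].
    have d1 := @is_derive_affine F f s 1 t dF.
    have d2 := @is_derive_affine F f s (-1) t dF.
    by apply: is_derive_eq; rewrite /GRing.scale/=; ring.
  apply: (le_trans (fL _ _)).
  rewrite (_ : _ - _ = 2 * t); last by ring.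
  by rewrite normrM ger0_norm// ler_wpM2l.
have bH s : `|H (s + k) - 2 * H s + H (s - k) - k ^+ 2 * f s| <= 2 * k * k * k.
  have := @mvt_bound R (fun t => S H s t - t ^+ 2 * f s)
    (fun t => F (s + 1 * t) - F (s + (-1) * t) - 2 * t * f s) (2 * k * k) k.
  rewrite /S !mulr0 !addr0 !mul1r !mulN1r (gtr0_norm k0) expr0n/= mul0r subr0.
  rewrite (_ : H s - 2 * H s + H s = 0) ?subr0; last by ring.
  apply => [t|t tk].
    have d1 := @is_derive_affine H F s 1 t dH.
    have d2 := @is_derive_affine H F s (-1) t dH.
    by apply: is_derive_eq; rewrite /GRing.scale/=; ring.
  have := @mvt_bound R (fun t => F (s + 1 * t) - F (s + (-1) * t) - 2 * t * f s)
    (fun t => f (s + 1 * t) + f (s + (-1) * t) - 2 * f s) (2 * k) t.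
  rewrite !mulr0 !addr0 !mul0r !subrr !subr0 => HH.
  apply: (@le_trans _ _ (2 * k * `|t|)); last first.
    by rewrite ler_wpM2l// mulr_ge0// ltW.
  apply: HH => [r|r rt].
    have d1 := @is_derive_affine F f s 1 r dF.
    have d2 := @is_derive_affine F f s (-1) r dF.
    by apply: is_derive_eq; rewrite /GRing.scale/=; ring.
  rewrite (_ : _ - _ = (f (s + 1 * r) - f s) + (f (s + (-1) * r) - f s)); last by ring.
  apply: (le_trans (ler_normD _ _)).
  apply: (@le_trans _ _ (`|r| + `|r|)).
    apply: lerD; apply: (le_trans (fL _ _)).
      by rewrite mul1r addrAC subrr add0r.
    by rewrite mulN1r addrAC subrr add0r normrN.
  have rk : `|r| <= k := le_trans rt tk.
  by rewrite mulr_natl mulr2n lerD.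
have kk0 : 0 <= k ^- 2 by rewrite invr_ge0 sqr_ge0.
exists (D H), (D F), (D f); split.
- by split; exact: dD.
- move=> x; rewrite /D (_ : _ - f x =
    k ^- 2 * (H (x + k) - 2 * H x + H (x - k) - k ^+ 2 * f x)); last by field.
  rewrite normrM (ger0_norm kk0); apply: (le_trans (ler_wpM2l kk0 (bH x))).
  by rewrite le_eqVlt; apply/orP; left; apply/eqP; rewrite /k; field; rewrite gt_eqF.
- move=> x; rewrite /D normrM (ger0_norm kk0).
  apply: (le_trans (ler_wpM2l kk0 (bF x))).
  by rewrite le_eqVlt; apply/orP; left; apply/eqP; field.
- move=> x; rewrite /D normrM (ger0_norm kk0).
  have b : `|f (x + k) - 2 * f x + f (x - k)| <= 2 * k.
    rewrite (_ : _ + _ = (f (x + k) - f x) + (f (x - k) - f x)); last by ring.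
    apply: (le_trans (ler_normD _ _)).
    rewrite (_ : 2 * k = `|x + k - x| + `|x - k - x|); first by apply: lerD.
    by rewrite ![x + _ - x]addrAC subrr !add0r normrN gtr0_norm//; ring.
  apply: (le_trans (ler_wpM2l kk0 b)).
  by rewrite le_eqVlt; apply/orP; left; apply/eqP; rewrite /k; field; rewrite gt_eqF.
- move=> x y; rewrite /D -mulrBr normrM (ger0_norm kk0).
  have b : `|f (x + k) - 2 * f x + f (x - k) - (f (y + k) - 2 * f y + f (y - k))|
      <= 4 * `|x - y|.
    rewrite (_ : _ - _ = (f (x + k) - f (y + k)) + 2 * (f y - f x) +
      (f (x - k) - f (y - k))); last by ring.
    have e1 : `|f (x + k) - f (y + k)| <= `|x - y|.
      by apply: (le_trans (fL _ _)); rewrite (_ : _ - (y + k) = x - y)//; ring.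
    have e2 : `|f (x - k) - f (y - k)| <= `|x - y|.
      by apply: (le_trans (fL _ _)); rewrite (_ : _ - (y - k) = x - y)//; ring.
    have e3 : `|2 * (f y - f x)| <= 2 * `|x - y|.
      by rewrite normrM ger0_norm// ler_wpM2l// distrC.
    have := ler_normD (f (x + k) - f (y + k) + 2 * (f y - f x)) (f (x - k) - f (y - k)).
    have := ler_normD (f (x + k) - f (y + k)) (2 * (f y - f x)).
    by lra.
  apply: (le_trans (ler_wpM2l kk0 b)).
  by rewrite le_eqVlt; apply/orP; left; apply/eqP; rewrite /k; field; rewrite gt_eqF.
Qed.

End smoothing.

(** * The smooth maximum and its Taylor expansion *)

Section softmax.
Context (R : realType) (J : finType) (j0 : J).
Variable beta : R.
Hypothesis beta0 : 0 < beta.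

Definition lse (u : J -> R) : R := beta^-1 * ln (\sum_j expR (beta * u j)).

Definition softp (u : J -> R) j : R := expR (beta * u j) / \sum_i expR (beta * u i).

(** The Hessian of g o lse when c1 and c2 are the first two derivatives of g at [lse u]: the
    gradient of [lse] is p = [softp u] and its Hessian is beta (diag p - p p^T). *)
Definition softq (c1 c2 : R) (u : J -> R) j k : R :=
  (c2 - beta * c1) * (softp u j * softp u k) + (j == k)%:R * (beta * c1 * softp u j).

Section line.
Variables (u w : J -> R) (W : R).
Hypothesis wW : forall j, `|w j| <= W.

(** [M k s] is the k-th moment of w under the softmax weights at u + s w; derivatives along the line
    are polynomials in these moments, each bounded by W^k. *)
Let S k s := \sum_j w j ^+ k * expR (beta * (u j + s * w j)).
Let M k s := S k s / S 0 s.

Let W0 : 0 <= W. Proof. exact: (le_trans _ (wW j0)). Qed.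

Let S0_gt0 s : 0 < S 0 s.
Proof.
rewrite /S (bigD1 j0)//= expr0 mul1r ltr_pwDl ?expR_gt0//.
by apply: sumr_ge0 => j _; rewrite expr0 mul1r expR_ge0.
Qed.

Let dS k (s : R) : is_derive s (1 : R) (S k) (beta * S k.+1 s).
Proof.
rewrite /S big_enum_val/=.
rewrite (_ : (fun s => _) = \sum_(i < #|J|) (fun s : R => w (enum_val i) ^+ k *
    expR (beta * (u (enum_val i) + s * w (enum_val i))))); last first.
  by apply/funext => t; rewrite fct_sumE big_enum_val.
rewrite mulr_sumr; apply: is_derive_sum => i.
set j := enum_val i.
have d1 : is_derive s (1 : R) (fun s : R => beta * (u j + s * w j)) (beta * w j).
  by apply: is_derive_eq; rewrite /GRing.scale/=; ring.
have d2 := @is_derive1_comp R expR (fun s : R => beta * (u j + s * w j)) s _ _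
  (is_derive_expR _) d1.
by apply: is_derive_eq; rewrite /GRing.scale/= exprS; ring.
Qed.

Let dM k (s : R) : is_derive s (1 : R) (M k) (beta * (M k.+1 s - M k s * M 1 s)).
Proof.
have n0 : S 0 s != 0 by rewrite gt_eqF.
have dV := @is_deriveV R (S 0) s (beta * S 1 s) 1 n0 (dS 0 s).
have dk := dS k s.
rewrite /M; apply: is_derive_eq; rewrite /GRing.scale/=.
by field.
Qed.

Let dL (s : R) : is_derive s (1 : R) (fun s => lse (fun j => u j + s * w j)) (M 1 s).
Proof.
have E : (fun s => lse (fun j => u j + s * w j)) = (fun s => beta^-1 * (@ln R \o S 0) s).
  apply/funext => t; rewrite /lse /S /=; congr (_ * ln _).
  by apply: eq_bigr => j _; rewrite expr0 mul1r.
have dln := @is_derive1_comp R (@ln R) (S 0) s _ _ (is_derive1_ln (S0_gt0 s)) (dS 0 s).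
rewrite E; apply: is_derive_eq; rewrite /GRing.scale/= /M.
by field; rewrite !gt_eqF.
Qed.

Let M_bnd k s : `|M k s| <= W ^+ k.
Proof.
rewrite /M normrM normfV (gtr0_norm (S0_gt0 s)) ler_pdivrMr//.
rewrite /S (le_trans (ler_norm_sum _ _ _))// mulr_sumr ler_sum// => j _.
rewrite expr0 mul1r normrM normrX (ger0_norm (expR_ge0 _)) ler_wpM2r ?expR_ge0//.
by rewrite lerXn2r// nnegrE.
Qed.

Let M_lip k s : `|M k s - M k 0| <= 2 * beta * W ^+ k.+1 * `|s|.
Proof.
apply: (mvt_bound (f' := fun t => beta * (M k.+1 t - M k t * M 1 t))) => [t|t _].
  exact: dM.
rewrite normrM (gtr0_norm beta0) -mulrA [leRHS]mulrCA ler_wpM2l ?(ltW beta0)//.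
apply: (le_trans (ler_normB _ _)); rewrite mulr_natl mulr2n lerD//.
by rewrite normrM exprSr ler_pM// (le_trans (M_bnd _ _))// expr1.
Qed.

Variables (g g1 g2 : R -> R) (A1 A2 A3 : R).
Hypothesis dg : forall x : R, is_derive x (1 : R) g (g1 x).
Hypothesis dg1 : forall x : R, is_derive x (1 : R) g1 (g2 x).
Hypothesis bg1 : forall x, `|g1 x| <= A1.
Hypothesis bg2 : forall x, `|g2 x| <= A2.
Hypothesis lg2 : forall x y, `|g2 x - g2 y| <= A3 * `|x - y|.

Let L s := lse (fun j => u j + s * w j).
Let psi1 s := g1 (L s) * M 1 s.
Let psi2 s := g2 (L s) * M 1 s ^+ 2 + g1 (L s) * (beta * (M 2 s - M 1 s ^+ 2)).

Let dpsi (s : R) : is_derive s (1 : R) (fun s => g (L s)) (psi1 s).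
Proof. exact: (@is_derive1_comp R g L s _ _ (dg _) (dL s)). Qed.

Let dpsi1 (s : R) : is_derive s (1 : R) psi1 (psi2 s).
Proof.
have d1 := @is_derive1_comp R g1 L s _ _ (dg1 _) (dL s).
have d2 := dM 1 s.
rewrite /psi1; apply: is_derive_eq; rewrite /GRing.scale/= /psi2; ring.
Qed.

Let L_lip s : `|L s - L 0| <= W * `|s|.
Proof.
apply: (mvt_bound (f' := M 1)) => [t|t _]; first exact: dL.
by rewrite (le_trans (M_bnd _ _))// expr1.
Qed.

Let C := A3 + 6 * beta * A2 + 6 * beta ^+ 2 * A1.

Let A10 : 0 <= A1. Proof. exact: (le_trans _ (bg1 0)). Qed.
Let A20 : 0 <= A2. Proof. exact: (le_trans _ (bg2 0)). Qed.
Let A30 : 0 <= A3.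
Proof. by have := lg2 1 0; rewrite subr0 normr1 mulr1; exact: le_trans. Qed.

(** The function [g] is only C^2 with Lipschitz second derivative, so [C * W ^+ 3] bounds the
    variation of the second derivative instead of a third derivative. In [C], the coefficient of
    beta A2 is 4 + 2 and that of beta^2 A1 is 2 + 4, from the four increments below. *)
Let psi2_lip s : `|s| <= 1 -> `|psi2 s - psi2 0| <= C * W ^+ 3.
Proof.
move=> s1; have b0 := ltW beta0.
have m1 := M_bnd 1 s; have m1' := M_bnd 1 0; have m2 := M_bnd 2 s; have m2' := M_bnd 2 0.
rewrite !expr1 in m1 m1'.
have le1 (a x : R) : 0 <= a -> x <= a * `|s| -> x <= a.
  by move=> a0 h; rewrite (le_trans h)// ler_piMr.
have l1 : `|M 1 s - M 1 0| <= 2 * beta * W ^+ 2.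
  by apply: le1 (M_lip 1 s); rewrite !mulr_ge0// exprn_ge0.
have l2 : `|M 2 s - M 2 0| <= 2 * beta * W ^+ 3.
  by apply: le1 (M_lip 2 s); rewrite !mulr_ge0// exprn_ge0.
have lL : `|L s - L 0| <= W by apply: le1 (L_lip s).
have sq (x : R) : `|x| <= W -> `|x ^+ 2| <= W ^+ 2.
  by move=> h; rewrite normrX lerXn2r// nnegrE.
have lsq : `|M 1 s ^+ 2 - M 1 0 ^+ 2| <= 4 * beta * W ^+ 3.
  rewrite (_ : _ - _ = (M 1 s - M 1 0) * (M 1 s + M 1 0)); last by ring.
  rewrite normrM (_ : 4 * beta * W ^+ 3 = (2 * beta * W ^+ 2) * (W + W)); last by ring.
  by rewrite ler_pM// (le_trans (ler_normD _ _))// lerD.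
have lg2L : `|g2 (L s) - g2 (L 0)| <= A3 * W.
  by rewrite (le_trans (lg2 _ _))// ler_wpM2l.
have lg1L : `|g1 (L s) - g1 (L 0)| <= A2 * W.
  have := @mvt_bound R (fun t => g1 (L 0 + t)) (fun t => g2 (L 0 + t)) A2 (L s - L 0).
  rewrite addr0 addrCA subrr addr0 => h.
  apply: (le_trans (h _ _)) => //.
    move=> t; have := @is_derive_affine R g1 g2 (L 0) 1 t dg1.
    by rewrite (_ : (fun t => _) = (fun t => g1 (L 0 + t))) ?mul1r//;
      apply/funext => r; rewrite mul1r.
  by rewrite ler_wpM2l.
have bv s' : `|M 2 s' - M 1 s' ^+ 2| <= 2 * W ^+ 2.
  have e1 : `|M 1 s' ^+ 2| <= W ^+ 2 by apply: sq; rewrite -[leRHS]expr1; exact: M_bnd.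
  apply: (le_trans (ler_normB _ _)); rewrite mulr_natl mulr2n.
  exact: lerD (M_bnd 2 s') e1.
have p3 : W ^+ 3 = W * W ^+ 2 by rewrite exprS.
rewrite (_ : psi2 s - psi2 0 =
  ((g2 (L s) - g2 (L 0)) * M 1 s ^+ 2 + g2 (L 0) * (M 1 s ^+ 2 - M 1 0 ^+ 2)) +
  ((g1 (L s) - g1 (L 0)) * (beta * (M 2 s - M 1 s ^+ 2)) +
   g1 (L 0) * (beta * ((M 2 s - M 2 0) - (M 1 s ^+ 2 - M 1 0 ^+ 2))))); last first.
  by rewrite /psi2; ring.
rewrite (_ : C * W ^+ 3 =
  (A3 * W * W ^+ 2 + A2 * (4 * beta * W ^+ 3)) +
  (A2 * W * (beta * (2 * W ^+ 2)) + A1 * (beta * (2 * beta * W ^+ 3 + 4 * beta * W ^+ 3)))); last first.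
  by rewrite /C; ring.
apply: (le_trans (ler_normD _ _)); apply: lerD;
  apply: (le_trans (ler_normD _ _)); apply: lerD; rewrite normrM; apply: ler_pM => //.
- exact: sq.
- by rewrite normrM (ger0_norm b0) ler_wpM2l.
- rewrite normrM (ger0_norm b0) ler_wpM2l//.
  by apply: (le_trans (ler_normB _ _)); exact: lerD.
Qed.

Let taylor : `|g (L 1) - g (L 0) - psi1 0 - psi2 0 / 2| <= C * W ^+ 3.
Proof.
have C0 : 0 <= C * W ^+ 3.
  by rewrite mulr_ge0 ?exprn_ge0// /C !addr_ge0// !mulr_ge0 ?exprn_ge0 ?(ltW beta0).
have h1 t : `|t| <= 1 -> `|psi1 t - psi1 0 - t * psi2 0| <= C * W ^+ 3.
  move=> t1; have := @mvt_bound R (fun t => psi1 t - t * psi2 0)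
    (fun t => psi2 t - psi2 0) (C * W ^+ 3) t.
  rewrite mul0r subr0 => h.
  rewrite (_ : _ - _ = psi1 t - t * psi2 0 - psi1 0); last by ring.
  apply: (le_trans (h _ _)).
  - move=> r; have d := dpsi1 r.
    by apply: is_derive_eq; rewrite /GRing.scale/=; ring.
  - by move=> r rt; apply: psi2_lip; rewrite (le_trans rt).
  - by rewrite ler_piMr.
have := @mvt_bound R (fun t => g (L t) - t * psi1 0 - t ^+ 2 * (psi2 0 / 2))
  (fun t => psi1 t - psi1 0 - t * psi2 0) (C * W ^+ 3) 1.
rewrite normr1 mulr1 !mul0r expr0n/= mul0r !subr0 !mul1r expr1n mul1r => h.
rewrite (_ : _ - _ = g (L 1) - psi1 0 - psi2 0 / 2 - g (L 0)); last by ring.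
apply: h => [t|t]; last exact: h1.
have d := dpsi t.
by apply: is_derive_eq; rewrite /GRing.scale/=; field.
Qed.

(** The remainder sees w only through its sup-norm and has no factor #|J|, because the softmax
    weights sum to one. The number of coordinates enters only through the logarithm in
    [lse_bounds]. *)
Lemma softmax_taylor_line : 
  `|g (lse (fun j => u j + w j)) - g (lse u) - \sum_j g1 (lse u) * softp u j * w j
     - (\sum_j \sum_k softq (g1 (lse u)) (g2 (lse u)) u j k * (w j * w k)) / 2|
  <= (A3 + 6 * beta * A2 + 6 * beta ^+ 2 * A1) * W ^+ 3.
Proof.
pose p := softp u; pose q := softq (g1 (lse u)) (g2 (lse u)) u.
rewrite -/q -/p -/C; have := taylor.
have L0 : L 0 = lse u by rewrite /L; congr lse; apply/funext => j; rewrite mul0r addr0.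
have L1 : L 1 = lse (fun j => u j + w j).
  by rewrite /L; congr lse; apply/funext => j; rewrite mul1r.
have SE k : S k 0 = \sum_j w j ^+ k * expR (beta * u j).
  by apply: eq_bigr => j _; rewrite mul0r addr0.
have S00 : S 0 0 = \sum_i expR (beta * u i).
  by rewrite SE; apply: eq_bigr => j _; rewrite expr0 mul1r.
have ME k : M k 0 = \sum_j p j * w j ^+ k.
  rewrite /M S00 SE mulr_suml; apply: eq_bigr => j _; rewrite /p /softp.
  by rewrite [RHS]mulrC mulrA.
rewrite L1 L0; congr (`|_ - _ - _ / 2| <= _).
  rewrite /psi1 L0 ME mulr_sumr; apply: eq_bigr => j _.
  by rewrite expr1 mulrA.
rewrite /psi2 L0 !ME.
transitivity (\sum_j \sum_k (g2 (lse u) - beta * g1 (lse u)) * ((p j * w j) * (p k * w k))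
  + \sum_j beta * g1 (lse u) * (p j * w j ^+ 2)).
  have DS c : \sum_j \sum_k c * ((p j * w j) * (p k * w k)) = c * (\sum_j p j * w j ^+ 1) ^+ 2.
    rewrite expr2 mulr_suml mulr_sumr; apply: eq_bigr => j _.
    rewrite !mulr_sumr; apply: eq_bigr => k _.
    by rewrite !expr1.
  by rewrite DS -mulr_sumr; ring.
rewrite -big_split/=; apply: eq_bigr => j _; rewrite /q /softq -/p.
under [RHS]eq_bigr do rewrite mulrDl.
rewrite big_split/=; congr (_ + _).
  by apply: eq_bigr => k _; ring.
rewrite (bigD1 j)//= eqxx mul1r big1 ?addr0 => [|k kj]; last by rewrite eq_sym (negbTE kj) !mul0r.
by rewrite expr2; ring.
Qed.

End line.

Lemma sum_softp u : \sum_j softp u j = 1.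
Proof.
rewrite -mulr_suml divff// gt_eqF// (bigD1 j0)//= ltr_pwDl ?expR_gt0//.
by apply: sumr_ge0 => j _; exact: expR_ge0.
Qed.

Lemma softp_ge0 u j : 0 <= softp u j.
Proof. by rewrite divr_ge0 ?expR_ge0// sumr_ge0// => i _; exact: expR_ge0. Qed.

(** The entrywise l^1 norm of the Hessian is free of the dimension, so an entrywise covariance error
    is merely multiplied by it. *)
Lemma sum_softq c1 c2 u :
  \sum_j \sum_k `|softq c1 c2 u j k| <= `|c2| + 2 * beta * `|c1|.
Proof.
have p0 := softp_ge0 u; have b0 := ltW beta0.
apply: (@le_trans _ _ (\sum_j \sum_k (`|c2 - beta * c1| * (softp u j * softp u k)
    + (j == k)%:R * (beta * `|c1| * softp u j)))).
  apply: ler_sum => j _; apply: ler_sum => k _; rewrite /softq.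
  apply: (le_trans (ler_normD _ _)); move: (softp u) p0 => q q0.
  by rewrite !normrM (ger0_norm (q0 j)) (ger0_norm (q0 k)) (ger0_norm b0) normr_nat.
have E j : \sum_k (`|c2 - beta * c1| * (softp u j * softp u k)
    + (j == k)%:R * (beta * `|c1| * softp u j)) =
    (`|c2 - beta * c1| + beta * `|c1|) * softp u j.
  rewrite big_split/= -!mulr_sumr sum_softp mulr1 mulrDl; congr (_ + _).
  rewrite (bigD1 j)//= eqxx mul1r big1 ?addr0// => k kj.
  by rewrite eq_sym (negbTE kj) mul0r.
under eq_bigr do rewrite E.
rewrite -mulr_sumr sum_softp mulr1.
have := ler_normB c2 (beta * c1); rewrite normrM (ger0_norm b0); lra.
Qed.

Lemma lse_bounds (u : J -> R) (m : R) : (forall j, u j <= m) -> (exists j, u j = m) ->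
  m <= lse u <= m + ln #|J|%:R / beta.
Proof.
move=> um [j uj]; rewrite /lse.
have bN : beta != 0 by rewrite gt_eqF.
have S0 : 0 < \sum_j expR (beta * u j).
  rewrite (bigD1 j0)//= ltr_pwDl ?expR_gt0//.
  by apply: sumr_ge0 => i _; exact: expR_ge0.
have J0 : 0 < #|J|%:R :> R by rewrite ltr0n; apply/card_gt0P; exists j0.
apply/andP; split.
  rewrite ler_pdivlMl// -[leLHS]expRK ler_ln ?posrE ?expR_gt0//.
  rewrite (bigD1 j)//= uj lerDl; apply: sumr_ge0 => i _; exact: expR_ge0.
rewrite ler_pdivrMl// mulrDr [beta * (_ / _)]mulrC divfK//.
rewrite -[beta * m]expRK -lnM ?posrE ?expR_gt0// ler_ln ?posrE ?mulr_gt0 ?expR_gt0//.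
rewrite mulr_natr -[#|J|]/#|[pred i : J | true]| -sumr_const; apply: ler_sum => i _.
by rewrite ler_expR ler_wpM2l// ltW.
Qed.

End softmax.

(** * Gaussian comparison by successive replacement *)

Section lindeberg.
Context (R : realType) (p : nat) (i0 : 'I_p).
Let J : finType := ('I_p * bool)%type.
Let j0 : J := (i0, true).

Definition sgb (b : bool) : R := if b then -1 else 1.
(** The maximum of the |y i| is the maximum of the 2 p numbers y i and - y i, so [lse] applies
    without a non-smooth absolute value. This is the origin of ln(2 p). *)
Definition symv (y : 'I_p -> R) : J -> R := fun j => sgb j.2 * y j.1.
Definition maxabs (y : 'I_p -> R) : R := \big[Num.max/0]_i `|y i|.

Lemma normr_sgb b : `|sgb b| = 1.
Proof. by case: b; rewrite /sgb ?normrN normr1. Qed.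

Lemma maxabs_ge (y : 'I_p -> R) i : `|y i| <= maxabs y.
Proof. exact: (le_bigmax _ (fun i => `|y i|)). Qed.

Lemma maxabs_attained (y : 'I_p -> R) : exists i, maxabs y = `|y i|.
Proof.
exists [arg max_(i > i0) `|y i|]%O.
by rewrite /maxabs (bigmax_eq_arg _ i0).
Qed.

Lemma lse_symv beta (y : 'I_p -> R) : 0 < beta ->
  `|lse beta (symv y) - maxabs y| <= ln (2 * p%:R) / beta.
Proof.
move=> b0.
have cJ : (#|J| = 2 * p)%N by rewrite card_prod card_ord card_bool mulnC.
have /andP[h1 h2] : maxabs y <= lse beta (symv y) <= maxabs y + ln #|J|%:R / beta.
  apply: (lse_bounds j0 b0) => [[i b]|].
    rewrite (le_trans _ (maxabs_ge y i))// /symv/= (le_trans (ler_norm _))//.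
    by rewrite normrM normr_sgb mul1r.
  have [i ->] := maxabs_attained y.
  have [yi|yi] := leP 0 (y i).
    by exists (i, false); rewrite /symv/= mul1r ger0_norm.
  by exists (i, true); rewrite /symv/= mulN1r ltr0_norm.
move: h2; rewrite cJ natrM => h2.
by rewrite ger0_norm ?subr_ge0// lerBlDl.
Qed.

Variables (beta : R) (g g1 g2 : R -> R) (A1 A2 A3 B : R).
Hypothesis beta0 : 0 < beta.
Hypothesis dg : forall x : R, is_derive x (1 : R) g (g1 x).
Hypothesis dg1 : forall x : R, is_derive x (1 : R) g1 (g2 x).
Hypothesis bg : forall x, `|g x| <= B.
Hypothesis bg1 : forall x, `|g1 x| <= A1.
Hypothesis bg2 : forall x, `|g2 x| <= A2.
Hypothesis lg2 : forall x y, `|g2 x - g2 y| <= A3 * `|x - y|.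

Let C := A3 + 6 * beta * A2 + 6 * beta ^+ 2 * A1.
Let G (u : J -> R) := g (lse beta u).

Let A10 : 0 <= A1. Proof. exact: (le_trans _ (bg1 0)). Qed.
Let A20 : 0 <= A2. Proof. exact: (le_trans _ (bg2 0)). Qed.
Let A30 : 0 <= A3.
Proof. by have := lg2 1 0; rewrite subr0 normr1 mulr1; exact: le_trans. Qed.
Let C0 : 0 <= C.
Proof. by rewrite /C !addr_ge0// !mulr_ge0 ?exprn_ge0 ?(ltW beta0). Qed.

Let measurable_G d (W : measurableType d) (u : J -> W -> R) :
  (forall j, measurable_fun setT (u j)) ->
  measurable_fun setT (fun w => G (u ^~ w)).
Proof.
move=> mu; apply: (measurableT_comp (f := g)).
  apply: continuous_measurable_fun => x; apply: differentiable_continuous.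
  by apply/derivable1_diffP; have [] := dg x.
apply: measurable_funM => //; apply: measurableT_comp; first exact: measurable_ln.
apply: measurable_sum => j; apply: measurableT_comp => //.
exact: measurable_funM.
Qed.

(** A crude majorant of the cube of the largest coordinate. Its dependence on p is harmless, since
    it is multiplied by a step size that tends to 0. *)
Definition sum3 d (W : measurableType d) (X : 'I_p -> W -> R) (w : W) : R :=
  \sum_i `|X i w| ^+ 3.

(** In the expectation of the Taylor expansion at [u] the linear term vanishes because X is centred,
    and the quadratic one sees X only through its covariance. *)
Lemma gaussian_taylor d (W : measurableType d) (P : probability W R)
    (X : 'I_p -> W -> R) Sg (u : J -> R) (e : R) :
  gvec P X Sg -> 0 <= e ->
  `|Ex P (fun w => G (fun j => u j + symv (fun i => e * X i w) j)) - G u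
    - e ^+ 2 / 2 * (\sum_j \sum_k
        softq beta (g1 (lse beta u)) (g2 (lse beta u)) u j k *
        (sgb j.2 * sgb k.2 * Sg j.1 k.1))| <= C * e ^+ 3 * Ex P (sum3 X).
Proof.
move=> gX e0; have [mX _ _ _] := gX.
set q := softq _ _ _ _.
pose a j := g1 (lse beta u) * softp beta u j.
pose wv (w : W) := symv (fun i => e * X i w).
have Iw j : itg P (fun w => wv w j).
  rewrite (_ : (fun w => _) = (fun w => (sgb j.2 * e) * X j.1 w)).
    exact/itgZ/(gvec_itg gX).
  by apply/funext => w; rewrite /wv /symv mulrA.
have Ew j : Ex P (fun w => wv w j) = 0.
  rewrite (_ : (fun w => _) = (fun w => (sgb j.2 * e) * X j.1 w)).
    by rewrite ExZ ?(gvec_mean gX) ?mulr0//; exact: (gvec_itg gX).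
  by apply/funext => w; rewrite /wv /symv mulrA.
have wwE j k : (fun w => wv w j * wv w k) =
    (fun w => (e ^+ 2 * (sgb j.2 * sgb k.2)) * (X j.1 w * X k.1 w)).
  by apply/funext => w; rewrite /wv /symv; ring.
have Iww j k : itg P (fun w => wv w j * wv w k).
  by rewrite wwE; apply: itgZ; have [] := gvec_cov gX j.1 k.1.
have Eww j k : Ex P (fun w => wv w j * wv w k) = e ^+ 2 * (sgb j.2 * sgb k.2 * Sg j.1 k.1).
  by have [I E] := gvec_cov gX j.1 k.1; rewrite wwE ExZ// E; ring.
have IG : itg P (fun w => G (fun j => u j + wv w j)).
  apply: (@itg_bnd _ _ _ _ _ B) => [|w]; last exact: bg.
  apply: measurable_G => j; apply: measurable_funD => //.
  by apply: measurable_funM => //; exact: measurable_funM.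
have Ilin : itg P (fun w => \sum_j a j * wv w j).
  by apply: itg_sum => j _; exact: itgZ.
have Iq j : itg P (fun w => \sum_k q j k * (wv w j * wv w k)).
  by apply: itg_sum => k _; exact: itgZ.
have Iquad : itg P (fun w => (\sum_j \sum_k q j k * (wv w j * wv w k)) / 2).
  rewrite (_ : (fun _ => _) = (fun w => 2^-1 * (\sum_j \sum_k q j k * (wv w j * wv w k)))).
    by apply: itgZ; apply: itg_sum => j _; exact: Iq.
  by apply/funext => w; rewrite mulrC.
have I3 : itg P (sum3 X) by apply: itg_sum => i _; exact: (gvec_itg3 gX).
pose r w := G (fun j => u j + wv w j) - G u - \sum_j a j * wv w j
   - (\sum_j \sum_k q j k * (wv w j * wv w k)) / 2.
have Ir : itg P r by apply: itgB => //; apply: itgB => //; apply: itgB => //; exact: itg_cst.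
have Er : Ex P r = Ex P (fun w => G (fun j => u j + wv w j)) - G u
    - e ^+ 2 / 2 * (\sum_j \sum_k q j k * (sgb j.2 * sgb k.2 * Sg j.1 k.1)).
  rewrite /r ExB//; last by apply: itgB => //; apply: itgB => //; exact: itg_cst.
  rewrite ExB//; last by apply: itgB => //; exact: itg_cst.
  rewrite ExB//; last exact: itg_cst.
  rewrite Ex_cst Ex_sum; last by move=> j _; exact: itgZ.
  rewrite big1 ?subr0; last by move=> j _; rewrite ExZ ?Ew ?mulr0.
  congr (_ - _ - _).
  rewrite (_ : (fun _ => _) = (fun w => 2^-1 * (\sum_j \sum_k q j k * (wv w j * wv w k)))); last first.
    by apply/funext => w; rewrite mulrC.
  rewrite ExZ; last by apply: itg_sum => j _; exact: Iq.
  rewrite Ex_sum; last by move=> j _; exact: Iq.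
  rewrite !mulr_sumr; apply: eq_bigr => j _.
  rewrite Ex_sum; last by move=> k _; exact: itgZ.
  rewrite !mulr_sumr; apply: eq_bigr => k _.
  by rewrite ExZ// Eww; ring.
rewrite -Er -ExZ//; apply: Ex_abs_le => //; first exact: itgZ.
move=> w; pose V := e * maxabs (X ^~ w).
have wV j : `|wv w j| <= V.
  by rewrite /wv /symv !normrM normr_sgb mul1r (ger0_norm e0) ler_wpM2l// (maxabs_ge (X ^~ w)).
have := softmax_taylor_line j0 beta0 u wV dg dg1 bg1 bg2 lg2.
move=> /le_trans; apply.
rewrite -/C -mulrA ler_wpM2l// /V exprMn ler_wpM2l ?exprn_ge0//.
have [i ->] := maxabs_attained (X ^~ w).
rewrite /sum3 (bigD1 i)//= lerDl; apply: sumr_ge0 => k _; exact: exprn_ge0.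
Qed.

Section compare.
Context d1 d2 (W1 : measurableType d1) (W2 : measurableType d2)
  (P1 : probability W1 R) (P2 : probability W2 R)
  (X : 'I_p -> W1 -> R) (Y : 'I_p -> W2 -> R) (SX SY : 'I_p -> 'I_p -> R) (D : R).
Hypothesis gX : gvec P1 X SX.
Hypothesis gY : gvec P2 Y SY.
Hypothesis SD : forall i j, `|SX i j - SY i j| <= D.

Let M3 := Ex P1 (sum3 X) + Ex P2 (sum3 Y).
Let A := A2 + 2 * beta * A1.

Let D0 : 0 <= D. Proof. exact: (le_trans _ (SD i0 i0)). Qed.
Let A0 : 0 <= A. Proof. by rewrite /A addr_ge0// !mulr_ge0// ltW. Qed.

Let swap_local (u : J -> R) (e : R) : 0 <= e ->
  `|Ex P1 (fun w => G (fun j => u j + symv (fun i => e * X i w) j)) -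
    Ex P2 (fun w => G (fun j => u j + symv (fun i => e * Y i w) j))| <=
  e ^+ 2 / 2 * (D * A) + C * e ^+ 3 * M3.
Proof.
move=> e0; have := gaussian_taylor u gX e0; have := gaussian_taylor u gY e0.
set q := softq _ _ _ _; set EX := Ex P1 _; set EY := Ex P2 (fun w => G _).
set QX := \sum_j \sum_k q j k * (_ * SX _ _).
set QY := \sum_j \sum_k q j k * (_ * SY _ _).
move=> hY hX.
have hQ : `|QX - QY| <= D * A.
  rewrite /QX /QY -sumrB.
  under eq_bigr do rewrite -sumrB.
  apply: (le_trans (ler_norm_sum _ _ _)).
  apply: (@le_trans _ _ (\sum_j \sum_k D * `|q j k|)).
    apply: ler_sum => j _; apply: (le_trans (ler_norm_sum _ _ _)).
    apply: ler_sum => k _; rewrite -mulrBr -mulrBr normrM mulrC ler_wpM2r//.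
    by rewrite !normrM !normr_sgb !mul1r.
  under eq_bigr do rewrite -mulr_sumr.
  rewrite -mulr_sumr ler_wpM2l//.
  apply: (le_trans (sum_softq j0 beta0 _ _ _)).
  by rewrite /A lerD// ler_wpM2l// mulr_ge0// ltW.
rewrite (_ : EX - EY = (EX - G u - e ^+ 2 / 2 * QX) - (EY - G u - e ^+ 2 / 2 * QY)
    + e ^+ 2 / 2 * (QX - QY)); last by ring.
apply: (le_trans (ler_normD _ _)); rewrite addrC; apply: lerD.
  have e2 : 0 <= e ^+ 2 / 2 by rewrite divr_ge0// exprn_ge0.
  by rewrite normrM (ger0_norm e2) ler_wpM2l.
by apply: (le_trans (ler_normB _ _)); rewrite /M3 mulrDr lerD.
Qed.

Let H (y : p.-tuple R) : R := G (symv (tnth y)).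

Let mH : measurable_fun setT H.
Proof.
apply: measurable_G => j; apply: measurable_funM => //; exact: measurable_tnth.
Qed.

Let Z (a b : R) (i : 'I_p) (w : W1 * W2) : R := a * X i w.1 + b * Y i w.2.

Let gZ a b := gvec_add a b gX gY.

Let E a b := Ex (prodP P1 P2) (H \o rvec (Z a b)).

(** A Gaussian vector splits in law into independent parts whose covariances add up, so a' X + b' Y
    has the law of a X + b Y plus an independent e X'. Fubini then freezes the first part, which
    plays the role of [u] in [gaussian_taylor]. *)
Let E_split d (W : measurableType d) (Q : probability W R) (X' : 'I_p -> W -> R) S' a b a' b' e :
  gvec Q X' S' -> 
  (forall i j, a' ^+ 2 * SX i j + b' ^+ 2 * SY i j =
     1 ^+ 2 * (a ^+ 2 * SX i j + b ^+ 2 * SY i j) + e ^+ 2 * S' i j) ->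
  E a' b' = Ex (prodP P1 P2) (fun v => Ex Q (fun w =>
     G (fun j => symv (Z a b ^~ v) j + symv (fun i => e * X' i w) j))).
Proof.
move=> gX' SS.
have gg := gvec_add 1 e (gZ a b) gX'.
have gg' := gvec_ext gg (fun i w => erefl) (fun i j => esym (SS i j)).
have [m1 _ _ _] := gZ a' b'; have [m2 _ _ _] := gg'.
rewrite /E (same_law_Ex (rvec_measurable m1) (rvec_measurable m2)
  (gvec_same_law (gZ a' b') gg') mH).
have HB y : `|H y| <= B by exact: bg.
rewrite (@Ex_fubini _ _ _ _ _ _ _ _ B) => [||w]; last exact: HB; last first.
  exact: (measurableT_comp mH (rvec_measurable m2)).
apply: (congr1 (Ex (prodP P1 P2))); apply/funext => v.
apply: (congr1 (Ex Q)); apply/funext => w.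
rewrite /= /H; congr G; apply/funext => j.
by rewrite /symv tnth_mktuple/= mul1r mulrDr.
Qed.

(** Both expectations contain the common part a X + b Y; one adds an independent e X, the other an
    independent e Y. *)
Let E_step a b a' b' e : 0 <= e -> a' ^+ 2 = a ^+ 2 + e ^+ 2 -> b' ^+ 2 = b ^+ 2 + e ^+ 2 ->
  `|E a' b - E a b'| <= e ^+ 2 / 2 * (D * A) + C * e ^+ 3 * M3.
Proof.
move=> e0 aa bb.
rewrite (@E_split _ _ P1 X SX a b a' b e gX); last by move=> i j; rewrite aa; ring.
rewrite (@E_split _ _ P2 Y SY a b a b' e gY); last by move=> i j; rewrite bb; ring.
have [mX _ _ _] := gX; have [mY _ _ _] := gY; have [mZ _ _ _] := gZ a b.
have mJ d (W : measurableType d) (X' : 'I_p -> W -> R) : (forall i, measurable_fun setT (X' i)) ->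
    measurable_fun setT (fun z : (W1 * W2) * W =>
     G (fun j => symv (Z a b ^~ z.1) j + symv (fun i => e * X' i z.2) j)).
  move=> mX'; apply: measurable_G => j; apply: measurable_funD.
    apply: measurable_funM => //; apply: (measurableT_comp (f := Z a b j.1)) => //.
    exact: mZ.
  apply: measurable_funM => //; apply: measurable_funM => //.
  exact: (measurableT_comp (mX' j.1)).
have I d (W : measurableType d) (Q : probability W R) (X' : 'I_p -> W -> R) :
    (forall i, measurable_fun setT (X' i)) ->
    itg (prodP P1 P2) (fun v => Ex Q (fun w =>
     G (fun j => symv (Z a b ^~ v) j + symv (fun i => e * X' i w) j))).
  move=> mX'; apply: (@itg_bnd _ _ _ _ _ B) => [|v].
    exact: (measurable_Ex_section (prodP P1 P2) Q (mJ _ _ _ mX') (fun z => bg _)).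
  apply: Ex_bnd => [|w]; last exact: bg.
  apply: measurable_G => j; apply: measurable_funD => //.
  by apply: measurable_funM => //; exact: measurable_funM.
rewrite -ExB; [|exact: I..].
rewrite -[leRHS](Ex_cst (prodP P1 P2)); apply: Ex_abs_le.
- by apply: itgB; exact: I.
- exact: itg_cst.
- by move=> v; apply: swap_local.
Qed.

(* Each of the [m ^ 2] steps exchanges a fraction [m ^ -2] of the covariance of
   [X] for the same fraction of that of [Y]. *)
Let E_telescope (m : nat) (k : nat) : (0 < m)%N -> (k <= m ^ 2)%N ->
  `|E 1 0 - E (Num.sqrt ((m ^ 2 - k)%:R / m%:R ^+ 2)) (Num.sqrt (k%:R / m%:R ^+ 2))| <=
  k%:R * (m%:R^-1 ^+ 2 / 2 * (D * A) + C * m%:R^-1 ^+ 3 * M3).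
Proof.
move=> m0; have mR : 0 < m%:R :> R by rewrite ltr0n.
elim: k => [|k IH] km.
  rewrite subn0 natrX divff ?expf_neq0 ?gt_eqF// mul0r sqrtr1 sqrtr0 subrr normr0.
  by rewrite mul0r.
set e := m%:R^-1 in IH *; set T := _ / 2 * _ + _ in IH *.
set a' := Num.sqrt ((m ^ 2 - k)%:R / _) in IH.
set b := Num.sqrt (k%:R / _) in IH.
set a := Num.sqrt ((m ^ 2 - k.+1)%:R / _).
set b' := Num.sqrt (k.+1%:R / _).
have e0 : 0 <= e by rewrite invr_ge0.
have sq (l : nat) : Num.sqrt (l%:R / m%:R ^+ 2) ^+ 2 = l%:R * e ^+ 2.
  by rewrite sqr_sqrtr ?divr_ge0// exprVn.
apply: (le_trans (ler_distD (E a' b) _ _)).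
rewrite -[k.+1]addn1 natrD mulrDl mul1r.
apply: (lerD (IH (ltnW km))).
apply: E_step => //.
  by rewrite /a' /a !sq -[X in (X - k)%N](subnK km) addnS subSn ?leq_addl// addnK -natr1; ring.
by rewrite /b' /b !sq -natr1; ring.
Qed.

Lemma gaussian_comparison_smooth :
  `|Ex P1 (H \o rvec X) - Ex P2 (H \o rvec Y)| <= D * A / 2.
Proof.
have [mX _ _ _] := gX; have [mY _ _ _] := gY; have [mZ1 _ _ _] := gZ 1 0.
have [mZ2 _ _ _] := gZ 0 1.
have E1 : Ex P1 (H \o rvec X) = E 1 0.
  apply/esym; apply: same_law_Ex => //; [exact: rvec_measurable..|].
  apply: gvec_same_law gX; apply: (gvec_ext (gZ 1 0)) => // i j; ring.
have E2 : Ex P2 (H \o rvec Y) = E 0 1.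
  apply/esym; apply: same_law_Ex => //; [exact: rvec_measurable..|].
  apply: gvec_same_law gY; apply: (gvec_ext (gZ 0 1)) => // i j; ring.
rewrite E1 E2; apply/ler_addgt0Pl => t t0.
have M30 : 0 <= M3.
  rewrite /M3 addr_ge0//; apply: Ex_ge0 => w; apply: sumr_ge0 => i _; exact: exprn_ge0.
have CM : 0 <= C * M3 by rewrite mulr_ge0.
(* Over m^2 steps of size 1 / m the quadratic errors add up to D A / 2 whatever m is, while the
   cubic ones add up to C M3 / m, which this choice brings below t. *)
pose m := (Num.truncn (C * M3 / t)).+1.
have m0 : (0 < m)%N by [].
have mR : 0 < m%:R :> R by rewrite ltr0n.
have mt : C * M3 / t < m%:R by exact: truncnS_gt.
have := E_telescope m0 (leqnn (m ^ 2)).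
rewrite subnn mul0r sqrtr0 natrX divff ?expf_neq0 ?gt_eqF// sqrtr1 => /le_trans; apply.
rewrite mulrDr addrC; apply: lerD; last first.
  by rewrite le_eqVlt; apply/orP; left; apply/eqP; field; rewrite gt_eqF.
rewrite (_ : m%:R ^+ 2 * (C * m%:R^-1 ^+ 3 * M3) = C * M3 / m%:R); last first.
  by move: (m%:R : R) mR => r r0; field; rewrite gt_eqF.
rewrite (ler_pdivrMr _ _ mR) [t * _]mulrC -(ler_pdivrMr _ _ t0).
exact: ltW.
Qed.

End compare.
End lindeberg.

Lemma measurable_bigmaxr (R : realType) d (W : measurableType d) (I : Type) (s : seq I)
  (f : I -> W -> R) : (forall i, measurable_fun setT (f i)) ->
  measurable_fun setT (fun w => \big[Num.max/0]_(i <- s) f i w).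
Proof.
move=> mf; elim: s => [|i s IH].
  by under eq_fun do rewrite big_nil; exact: measurable_cst.
by under eq_fun do rewrite big_cons; exact: measurable_maxr.
Qed.

Lemma measurable_maxabs (R : realType) d (W : measurableType d) p (X : 'I_p -> W -> R) :
  (forall i, measurable_fun setT (X i)) ->
  measurable_fun setT (fun w => maxabs (X ^~ w)).
Proof. by move=> mX; apply: measurable_bigmaxr => i; exact: measurableT_comp. Qed.

(** Smoothing at scale [th] costs 4 th, and beta = K / th makes the softmax bias at most th: 5 th
    for each vector. With A1 = 2 and A2 = 1 / th the smooth comparison costs (D + 4 D K) / (2 th),
    at most 60 th, whence 70 = 5 + 5 + 60. *)
Lemma gaussian_comparison (R : realType) p d1 d2 (W1 : measurableType d1) (W2 : measurableType d2)
    (P1 : probability W1 R) (P2 : probability W2 R)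
    (X : 'I_p -> W1 -> R) (Y : 'I_p -> W2 -> R) (SX SY : 'I_p -> 'I_p -> R)
    (f : R -> R) (m B th K D : R) : (0 < p)%N ->
  gvec P1 X SX -> gvec P2 Y SY -> (forall i j, `|SX i j - SY i j| <= D) ->
  (forall x y, `|f x - f y| <= `|x - y|) -> (forall x, `|f x| <= B) ->
  (forall x, x <= m -> f x = 0) ->
  0 < th -> 1 <= K -> ln (2 * p%:R) <= K -> D * K <= 24 * th ^+ 2 ->
  `|Ex P1 (fun w => f (maxabs (X ^~ w))) - Ex P2 (fun w => f (maxabs (Y ^~ w)))| <= 70 * th.
Proof.
move=> p0 gX gY SD fL fB f0 th0 K1 lnK DK; have i0 := Ordinal p0.
have [g [g1 [g2 [[dg dg1] gf bg1 bg2 lg2]]]] := smooth_lipschitz th0 fL f0.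
have K0 : 0 < K by rewrite (lt_le_trans _ K1).
pose beta := K / th; have beta0 : 0 < beta by rewrite divr_gt0.
have bg x : `|g x| <= 4 * th + B.
  by have := ler_normD (g x - f x) (f x); rewrite subrK; have := gf x; have := fB x; lra.
have mf : measurable_fun setT f.
  by apply: continuous_measurable_fun; apply: (@lipschitz_continuous R f 1) => x y; rewrite mul1r.
have mg : measurable_fun setT g.
  apply: continuous_measurable_fun => x; apply: differentiable_continuous.
  by apply/derivable1_diffP; have [] := dg x.
have E d (W : measurableType d) (P : probability W R) (Z : 'I_p -> W -> R) Sg : gvec P Z Sg ->
    `|Ex P (fun w => f (maxabs (Z ^~ w))) -
      Ex P ((fun y : p.-tuple R => g (lse beta (symv (tnth y)))) \o rvec Z)| <= 5 * th.
  move=> [mZ _ _ _].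
  have mm := measurable_maxabs mZ.
  have ml : measurable_fun setT (fun w => g (lse beta (symv (tnth (rvec Z w))))).
    apply: (measurableT_comp mg); apply: measurable_funM => //.
    apply: measurableT_comp; first exact: measurable_ln.
    apply: measurable_sum => j; apply: measurableT_comp => //.
    apply: measurable_funM => //; apply: measurable_funM => //.
    by apply: (measurableT_comp (measurable_tnth _)); exact: rvec_measurable.
  rewrite -ExB.
  - rewrite -[leRHS](Ex_cst P); apply: Ex_abs_le; last 2 first.
    + exact: itg_cst.
    + move=> w /=.
      have -> : tnth (rvec Z w) = Z ^~ w by apply/funext => i; rewrite tnth_mktuple.
      have l1 := lse_symv i0 (Z ^~ w) beta0.
      have l2 : ln (2 * p%:R) / beta <= th.
        by rewrite /beta ler_pdivrMr ?divr_gt0// mulrCA divff ?gt_eqF// mulr1.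
      have l3 := fL (maxabs (Z ^~ w)) (lse beta (symv (Z ^~ w))).
      have l4 := gf (lse beta (symv (Z ^~ w))).
      rewrite distrC in l3; rewrite distrC in l3.
      rewrite distrC in l4; rewrite [X in _ <= X]distrC in l3.
      have := ler_distD (f (lse beta (symv (Z ^~ w)))) (f (maxabs (Z ^~ w))) (g (lse beta (symv (Z ^~ w)))).
      lra.
    + apply: itgB; [apply: (@itg_bnd _ _ _ _ _ B)|apply: (@itg_bnd _ _ _ _ _ (4 * th + B))] => //.
      * exact: (measurableT_comp mf).
      * by move=> w; exact: bg.
  - by apply: (@itg_bnd _ _ _ _ _ B) => //; exact: (measurableT_comp mf).
  - by apply: (@itg_bnd _ _ _ _ _ (4 * th + B)) => // w; exact: bg.
have eX := E _ _ _ _ _ gX; have eY := E _ _ _ _ _ gY.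
have := gaussian_comparison_smooth i0 beta0 dg dg1 bg bg1 bg2 lg2 gX gY SD.
set EX := Ex P1 (_ \o _) in eX *; set EY := Ex P2 (_ \o _) in eY *.
set FX := Ex P1 _ in eX *; set FY := Ex P2 _ in eY *.
move=> eXY.
have : D * (th^-1 + 2 * beta * 2) / 2 <= 60 * th.
  have D0 : 0 <= D by exact: (le_trans _ (SD i0 i0)).
  rewrite (_ : D * _ / 2 = (D + 4 * (D * K)) / (2 * th)); last first.
    by rewrite /beta; field; rewrite gt_eqF.
  rewrite ler_pdivrMr ?mulr_gt0//.
  have : D <= D * K by rewrite ler_peMr.
  by rewrite (_ : 60 * th * (2 * th) = 120 * th ^+ 2); [lra|ring].
have := ler_distD EX FX FY; have := ler_distD EY EX FY.
rewrite (distrC EY FY); lra.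
Qed.

(** * Chaining *)

Section seqmax.
Context (R : realType) (I : eqType).
Implicit Types (F : seq I) (u : I -> R).

Definition seqmax F u : R := \big[Num.max/0]_(g <- F) u g.

Lemma seqmax_ge0 F u : 0 <= seqmax F u.
Proof. exact: bigmax_ge_id. Qed.

Lemma seqmax_ge F u i : i \in F -> u i <= seqmax F u.
Proof. by move=> iF; exact: le_bigmax_seq. Qed.

Lemma seqmax_lub F u M : 0 <= M -> (forall i, i \in F -> u i <= M) -> seqmax F u <= M.
Proof.
by move=> M0 uM; rewrite /seqmax big_seq; apply: bigmax_le => // i /andP[].
Qed.

Lemma seqmax_attained F u : (forall i, 0 <= u i) ->
  F = [::] \/ exists2 i, i \in F & seqmax F u = u i.
Proof.
move=> u0; elim: F => [|i F IH]; [by left|right].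
rewrite /seqmax big_cons -/(seqmax F u).
have [Fu|uF] := leP (seqmax F u) (u i).
  by exists i; rewrite ?mem_head.
case: IH => [F0|[j jF ->]].
  by move: uF; rewrite F0 /seqmax big_nil ltNge u0.
by exists j => //; rewrite inE jF orbT.
Qed.

Lemma sum_ge_term F u i : (forall i, 0 <= u i) -> i \in F -> u i <= \sum_(j <- F) u j.
Proof. by move=> u0 iF; rewrite (big_rem i)//= lerDl sumr_ge0. Qed.

Lemma measurable_seqmax d (W : measurableType d) F (u : I -> W -> R) :
  (forall i, measurable_fun setT (u i)) ->
  measurable_fun setT (fun w => seqmax F (u ^~ w)).
Proof.
move=> mf; elim: F => [|i s IH]; rewrite /seqmax.
  by under eq_fun do rewrite big_nil; exact: measurable_cst.
by under eq_fun do rewrite big_cons; exact: measurable_maxr.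
Qed.

End seqmax.

Section maximal.
Context (R : realType) d (W : measurableType d) (P : probability W R) (I : choiceType)
  (Z : I -> W -> R) (D : I -> I -> R).
Hypothesis mZ : forall i, measurable_fun setT (Z i).
Hypothesis subgauss : forall s t l, itg P (fun w => expR (l * (Z s w - Z t w))) /\
  Ex P (fun w => expR (l * (Z s w - Z t w))) <= expR (l ^+ 2 * D s t / 2).

Let dZ s t w := Z s w - Z t w.
Let mdZ s t : measurable_fun setT (dZ s t). Proof. exact: measurable_funB. Qed.

Let itg_dZ s t : itg P (fun w => `|dZ s t w|).
Proof.
apply: (itg_le (g := fun w => expR (1 * dZ s t w) + expR (-1 * dZ s t w))).
- exact: measurableT_comp.
- move=> w; rewrite normr_id mul1r mulN1r; apply: le_trans (expR_norm_le_cosh _).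
  by apply: le_trans (expR_ge1Dx _); rewrite lerDr.
- by apply: itgD; have [] := subgauss s t 1; have [] := subgauss s t (-1).
Qed.

(** One link of a chain: the largest increment between the projections [f] and [h]. Only the
    distinct pairs (f g, h g) count, not the size of [F]. *)
Definition incmax (F : seq I) (f h : I -> I) (w : W) : R :=
  seqmax F (fun g => `|Z (f g) w - Z (h g) w|).

Lemma itg_incmax F f h : itg P (incmax F f h).
Proof.
apply: (itg_le (g := fun w => \sum_(g <- F) `|dZ (f g) (h g) w|)).
- apply: (@measurable_seqmax R I _ W F (fun g w => `|dZ (f g) (h g) w|)) => i.
  exact: measurableT_comp.
- move=> w; rewrite ger0_norm ?seqmax_ge0//; apply: seqmax_lub => [|i iF].
    by apply: sumr_ge0.
  exact: (@sum_ge_term R I F (fun g => `|dZ (f g) (h g) w|)).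
- by apply: itg_sum => i _; exact: itg_dZ.
Qed.

Lemma Ex_incmax_triangle F f h k :
  Ex P (incmax F f h) <= Ex P (incmax F f k) + Ex P (incmax F k h).
Proof.
rewrite -ExD; [|exact: itg_incmax..].
apply: Ex_le; [exact: itg_incmax|by apply: itgD; exact: itg_incmax|move=> w].
apply: seqmax_lub => [|g gF]; first by rewrite addr_ge0// seqmax_ge0.
apply: le_trans (ler_distD (Z (k g) w) _ _) _.
apply: lerD.
  exact: (seqmax_ge (fun g => `|Z (f g) w - Z (k g) w|)).
exact: (seqmax_ge (fun g => `|Z (k g) w - Z (h g) w|)).
Qed.

(** The exponential of l times the maximum is at most the sum of the exponentials over distinct
    pairs and both signs, whose expectation is at most M = 2 N e^c. The tangent to the logarithm at
    M, that is y - ln M <= e^y / M - 1, replaces Jensen's inequality. The parameter [l] is left to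
    the caller. *)
Lemma Ex_incmax_le F f h (l r N : R) : 0 < l -> 0 <= r -> 1 <= N ->
  (size (undup (map f F)))%:R * (size (undup (map h F)))%:R <= N ->
  (forall g, g \in F -> D (f g) (h g) <= r) ->
  Ex P (incmax F f h) <= (ln (2 * N) + l ^+ 2 * r / 2) / l.
Proof.
move=> l0 r0 N1 sN Dr.
have N0 : 0 < N by rewrite (lt_le_trans _ N1).
pose c := l ^+ 2 * r / 2; pose M := 2 * N * expR c.
have c0 : 0 <= c by rewrite divr_ge0// mulr_ge0// exprn_ge0// ltW.
have M0 : 0 < M by rewrite !mulr_gt0// expR_gt0.
have lM : ln M = ln (2 * N) + c.
  by rewrite /M [LHS]lnM ?expRK// posrE ?expR_gt0// mulr_gt0.
pose s := undup [seq (f g, h g) | g <- F].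
have ss : (size s)%:R <= N.
  apply: le_trans sN; rewrite -natrM ler_nat -(size_allpairs pair).
  apply: uniq_leq_size; first exact: undup_uniq.
  move=> q; rewrite mem_undup => /mapP[g gF ->].
  by apply: allpairs_f; rewrite mem_undup; apply: map_f.
pose T (q : I * I) w := expR (l * dZ q.1 q.2 w) + expR (- l * dZ q.1 q.2 w).
have IT q : itg P (T q).
  by apply: itgD; [exact: (subgauss q.1 q.2 l).1|exact: (subgauss q.1 q.2 (- l)).1].
have T0 w q : 0 <= T q w by rewrite addr_ge0// expR_ge0.
have ET q : q \in s -> Ex P (T q) <= 2 * expR c.
  rewrite mem_undup => /mapP[g gF ->]; rewrite /T/=.
  rewrite ExD; [|exact: (subgauss _ _ l).1|exact: (subgauss _ _ (- l)).1].
  have E : expR (l ^+ 2 * D (f g) (h g) / 2) <= expR c.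
    rewrite ler_expR /c ler_wpM2r// ler_wpM2l ?exprn_ge0 ?Dr//; exact: ltW.
  have := (subgauss (f g) (h g) l).2; have := (subgauss (f g) (h g) (- l)).2.
  rewrite sqrrN -/(dZ _ _); move: E; rewrite /dZ.
  by move: (Ex P _) (Ex P _) (expR _) (expR _) => *; lra.
have Ib : itg P (fun w => l^-1 * (ln M - 1 + M^-1 * \sum_(q <- s) T q w)).
  apply: itgZ; apply: itgD; first exact: itg_cst.
  by apply: itgZ; apply: itg_sum => q _; exact: IT.
have lnN0 : 0 <= ln (2 * N) by rewrite ln_ge0//; lra.
case: (eqVneq F [::]) => [F0|FN].
  rewrite F0 (_ : incmax _ _ _ = cst 0); last by apply/funext => w; rewrite /incmax /seqmax big_nil.
  by rewrite Ex_cst divr_ge0 ?addr_ge0// ltW.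
apply: (@le_trans _ _ (Ex P (fun w => l^-1 * (ln M - 1 + M^-1 * \sum_(q <- s) T q w)))).
  apply: Ex_le => // [|w]; first exact: itg_incmax.
  rewrite -ler_pdivrMl ?invr_gt0// invrK.
  have [F0|[g gF]] := seqmax_attained F (fun g => normr_ge0 (dZ (f g) (h g) w)).
    by rewrite F0 eqxx in FN.
  rewrite -/(incmax F f h w) => Eg.
  have h1 : expR (l * incmax F f h w) <= \sum_(q <- s) T q w.
    apply: (@le_trans _ _ (T (f g, h g) w)).
      rewrite Eg /T/= mulNr -(ger0_norm (ltW l0)) -normrM (ger0_norm (ltW l0)).
      exact: expR_norm_le_cosh.
    apply: (@sum_ge_term R (I * I)%type s (fun q => T q w)) => //.
    by rewrite mem_undup; apply: map_f.
  have h2 : l * incmax F f h w - ln M <= expR (l * incmax F f h w) / M - 1.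
    have := expR_ge1Dx (l * incmax F f h w - ln M).
    by rewrite expRB lnK ?posrE//; move: (_ / M) => *; lra.
  have h3 : expR (l * incmax F f h w) / M <= M^-1 * \sum_(q <- s) T q w.
    by rewrite mulrC ler_wpM2l// invr_ge0 ltW.
  by move: h2 h3; move: (_ / M) (M^-1 * _) => *; lra.
rewrite ExZ; last first.
  by apply: itgD; [exact: itg_cst|apply: itgZ; apply: itg_sum => q _; exact: IT].
rewrite mulrC ler_pM2r ?invr_gt0//.
rewrite ExD; [|exact: itg_cst|by apply: itgZ; apply: itg_sum => q _; exact: IT].
rewrite Ex_cst ExZ; last by apply: itg_sum => q _; exact: IT.
rewrite Ex_sum// lM.
suff : M^-1 * (\sum_(q <- s) Ex P (T q)) <= 1.
  by rewrite -/c; move: (M^-1 * _) => *; lra.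
rewrite ler_pdivrMl// mulr1.
apply: (@le_trans _ _ (\sum_(q <- s) (2 * expR c))).
  by rewrite big_seq [leRHS]big_seq; apply: ler_sum.
rewrite big_const_seq count_predT iter_addr_0 -(mulr_natr (2 * expR c)) /M (mulrAC 2 N).
by rewrite ler_wpM2l// mulr_ge0// expR_ge0.
Qed.

Hypothesis Dsym : forall s t, D s t = D t s.
Hypothesis Dtri : forall s t q, D s q <= 2 * D s t + 2 * D t q.

(** At level j squared distances are of order u^2 / 4^j; with the parameter 2^j / u a link costs u /
    2^j times an entropy of order K (1 + j), which is summable. The link from level 0 to the coarse
    projection [pi] has squared distance of order u^2 K and, with the parameter 1 / u, costs a
    multiple of u K. The total is at most 326 + 2 times u K. *)
Lemma chaining_levels (F : seq I) (pi : I -> I) (pis : nat -> I -> I) (u K : R)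
    (N : nat -> R) (p : R) : 0 < u -> 128 <= K ->
  (forall g, g \in F -> D g (pi g) <= 320 * u ^+ 2 * K) ->
  1 <= p -> (size (undup (map pi F)))%:R <= p -> ln p <= K / 8 ->
  (forall j g, g \in F -> D g (pis j g) <= 8 * u ^+ 2 / 4 ^+ j) ->
  (forall j, 1 <= N j) -> (forall j, (size (undup (map (pis j) F)))%:R <= N j) ->
  (forall j, ln (N j) <= K * (3 + j%:R) / 128) ->
  Ex P (incmax F id pi) <= 400 * (u * K).
Proof.
move=> u0 K128 Dpi p1 sp lp Dpis N1 sN lN.
have K0 : 0 < K by rewrite (lt_le_trans _ K128).
have u20 : 0 < u ^+ 2 by rewrite exprn_gt0.
have ln2 : ln 2 <= 1 :> R.
  by rewrite -ler_expR lnK ?posrE//; have := expR_ge1Dx (1 : R); lra.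
have N0 j : 0 < N j by rewrite (lt_le_trans _ (N1 j)).
have p0 : 0 < p by rewrite (lt_le_trans _ p1).
have pw0 j : 0 < 2 ^+ j :> R by rewrite exprn_gt0.
have pw4 j : 4 ^+ j = 2 ^+ j * 2 ^+ j :> R by rewrite -exprMn -natrM.
have first : Ex P (incmax F (pis 0%N) pi) <= 322 * (u * K).
  have := @Ex_incmax_le F (pis 0%N) pi u^-1 (2 * (8 * u ^+ 2) + 2 * (320 * u ^+ 2 * K)) (N 0%N * p).
  move=> /(_ _ _ _ _ _)/le_trans; apply.
  - by rewrite invr_gt0.
  - by move: (mulr_gt0 u20 K0); rewrite -!mulrA; move: (u ^+ 2) (u ^+ 2 * K) u20 => *; lra.
  - by rewrite -[leLHS]mulr1 ler_pM.
  - by rewrite ler_pM// ?sN.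
  - move=> g gF; apply: (le_trans (Dtri _ g _)); apply: lerD; rewrite ler_pM2l//.
      by rewrite Dsym; have := Dpis 0%N g gF; rewrite expr0 divr1.
    exact: Dpi.
  - rewrite invrK [leRHS]mulrCA [leRHS]mulrC ler_pM2r//.
    rewrite !lnM ?posrE ?mulr_gt0//.
    rewrite (_ : u^-1 ^+ 2 * _ / 2 = 8 + 320 * K); last by field; rewrite gt_eqF.
    by have := lN 0%N; lra.
have level j : Ex P (incmax F (pis j.+1) (pis j)) <= u * K * ((2 ^+ j)^-1 * (j%:R + 1)).
  have := @Ex_incmax_le F (pis j.+1) (pis j) (2 ^+ j / u) (20 * u ^+ 2 / 4 ^+ j) (N j.+1 * N j).
  move=> /(_ _ _ _ _ _)/le_trans; apply.
  - by rewrite divr_gt0.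
  - by rewrite divr_ge0 ?exprn_ge0// mulr_ge0// ltW.
  - by rewrite -[leLHS]mulr1 ler_pM.
  - by rewrite ler_pM// ?sN.
  - move=> g gF; apply: (le_trans (Dtri _ g _)).
    rewrite [D (pis j.+1 g) g]Dsym.
    have := Dpis j g gF; have := Dpis j.+1 g gF; rewrite [4 ^+ j.+1]exprS invfM.
    rewrite (_ : 8 * u ^+ 2 * (4^-1 * (4 ^+ j)^-1) = 2 * (u ^+ 2 / 4 ^+ j)); last by field; rewrite expf_neq0.
    by rewrite -!mulrA; move: (u ^+ 2 / 4 ^+ j) => *; lra.
  - rewrite invf_div (_ : u * K * _ = (K * (j%:R + 1)) * (u / 2 ^+ j)); last first.
      by move: (2 ^+ j : R) (pw0 j) => q q0; field; rewrite gt_eqF.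
    rewrite ler_pM2r ?divr_gt0//.
    rewrite !lnM ?posrE ?mulr_gt0// pw4.
    rewrite (_ : (2 ^+ j / u) ^+ 2 * _ / 2 = 10); last first.
      by move: (2 ^+ j : R) (pw0 j) => q q0; field; rewrite !gt_eqF.
    have := lN j; have := lN j.+1; rewrite -[j.+1%:R]natr1 !mulrDr mulr1.
    have j0 : 0 <= K * j%:R by rewrite mulr_ge0// ltW.
    by move: (K * j%:R) j0 => q q0; lra.
(* Closed form of 322 plus the sum of (i + 1) / 2^i over i < j, which equals 4 - 2 (j + 2) / 2^j. *)
have partial j : Ex P (incmax F (pis j) pi) <=
    u * K * (326 - 2 * (2 ^+ j)^-1 * (j%:R + 2)).
  elim: j => [|j IH].
    by apply: (le_trans first); rewrite expr0 invr1 mulr1 add0r mulrC; lra.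
  apply: (le_trans (Ex_incmax_triangle _ _ _ (pis j))).
  apply: (le_trans (lerD (level j) IH)); rewrite -mulrDr ler_pM2l ?mulr_gt0//.
  rewrite [2 ^+ j.+1]exprS invfM -[j.+1%:R]natr1 le_eqVlt; apply/orP; left; apply/eqP.
  by move: (2 ^+ j : R) (pw0 j) => q q0; field; rewrite gt_eqF.
(* The depth J is taken so large that 2^J exceeds the logarithm of the cardinality of [F]: the link
   from level J to the identity then costs no more than a multiple of u K, and the bound is uniform
   in [F]. *)
pose L := ln (2 * (size F).+1%:R) + 4 : R.
pose J := (Num.truncn L).+1.
have LJ : L <= 2 ^+ J.
  by apply: (le_trans (ltW (truncnS_gt L))); rewrite -natrX ler_nat ltnW// ltn_expl.
clearbody J.
have J2 : 3 + J%:R <= 3 * 2 ^+ J :> R.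
  have h1 : J.+1%:R <= 2 ^+ J :> R by rewrite -natrX ler_nat ltn_expl.
  have h2 : 1 <= 2 ^+ J :> R by rewrite exprn_ege1// ler1n.
  have aux (x y : R) : x + 1 <= y -> 1 <= y -> 3 + x <= 3 * y by move=> *; lra.
  by apply: aux => //; rewrite natr1.
have last : Ex P (incmax F id (pis J)) <= 2 * (u * K).
  have := @Ex_incmax_le F id (pis J) (2 ^+ J / u) (8 * u ^+ 2 / 4 ^+ J) ((size F).+1%:R * N J).
  move=> /(_ _ _ _ _ _)/le_trans; apply.
  - by rewrite divr_gt0.
  - by rewrite divr_ge0 ?exprn_ge0// mulr_ge0// ltW.
  - by rewrite -[leLHS]mulr1 ler_pM// ler1n.
  - rewrite ler_pM// ?sN// ler_nat map_id; exact: (leq_trans (size_undup _)).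
  - by move=> g gF; exact: Dpis.
  - rewrite invf_div (_ : 2 * (u * K) = (2 * K * 2 ^+ J) * (u / 2 ^+ J)); last first.
      by move: (2 ^+ J : R) (pw0 J) => q q0; field; rewrite gt_eqF.
    rewrite ler_pM2r ?divr_gt0// pw4.
    rewrite (_ : (2 ^+ J / u) ^+ 2 * _ / 2 = 4); last first.
      by move: (2 ^+ J : R) (pw0 J) => q q0; field; rewrite !gt_eqF.
    rewrite mulrA lnM ?posrE ?mulr_gt0//.
    have h1 : ln (N J) <= K * 2 ^+ J.
      apply: (le_trans (lN J)); rewrite -mulrA ler_pM2l//.
      have aux (x y : R) : 3 + x <= 3 * y -> 0 < y -> (3 + x) / 128 <= y by move=> *; lra.
      exact: aux.
    have h2 : L <= K * 2 ^+ J by rewrite (le_trans LJ)// ler_peMl ?(ltW (pw0 J))//; apply: le_trans K128; rewrite ler1n.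
    have aux (x y z q : R) : y <= q -> x + 4 <= q -> x + y + 4 <= 2 * q by move=> *; lra.
    by rewrite -(mulrA 2 K); exact: aux h1 h2.
apply: (le_trans (Ex_incmax_triangle _ _ _ (pis J))).
apply: (le_trans (lerD last (partial J))).
have q0 : 0 <= u * K * (2 * (2 ^+ J)^-1 * (J%:R + 2)).
  apply: mulr_ge0; first by rewrite mulr_ge0 ?ltW.
  apply: mulr_ge0; last by rewrite addr_ge0.
  by rewrite mulr_ge0// invr_ge0 ltW.
have uK : 0 < u * K by rewrite mulr_gt0.
have aux (x y : R) : 0 < x -> 0 <= y -> 2 * x + (x * 326 - y) <= 400 * x by move=> *; lra.
by rewrite mulrBr; exact: aux.
Qed.

(** Here u = b / sqrt n, and level j is the scale tau = 1 / (2^j sqrt n), whose log-entropy is of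
    order v (ln a + ln n + j) and so at most a small multiple of K (3 + j). The bound does not
    depend on [F]. *)
Lemma chaining (F : seq I) (pi : I -> I) (a b v K p : R) (n : nat) :
  (4 <= n)%N -> 0 < b -> expR 1 <= a -> 1 <= v ->
  128 * (v * ln a) <= K -> 128 * (v * ln n%:R) <= K ->
  (forall tau, 0 < tau < 1 -> exists pit : I -> I,
    (forall g, g \in F -> D g (pit g) <= 8 * b ^+ 2 * tau ^+ 2) /\
    (size (undup (map pit F)))%:R <= 2 * (a / tau) `^ v) ->
  (forall g, g \in F -> D g (pi g) <= 320 * b ^+ 2 * K / n%:R) ->
  1 <= p -> (size (undup (map pi F)))%:R <= p -> ln p <= K / 8 ->
  Ex P (incmax F id pi) <= 400 * (b * K / Num.sqrt n%:R).
Proof.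
move=> n4 b0 ea v1 Ka Kn ent Dpi p1 sp lp.
have n0 : 0 < n%:R :> R by rewrite ltr0n (leq_trans _ n4).
have sn0 : 0 < Num.sqrt n%:R :> R by rewrite sqrtr_gt0.
have snn : Num.sqrt n%:R ^+ 2 = n%:R :> R by rewrite sqr_sqrtr// ltW.
have sn2 : 2 <= Num.sqrt n%:R :> R.
  by rewrite -(@ler_pXn2r _ 2) ?nnegrE ?(ltW sn0)// snn -natrX ler_nat.
have a0 : 0 < a by rewrite (lt_le_trans (expR_gt0 1)).
have lna : 1 <= ln a by rewrite -(expRK 1) ler_ln ?posrE ?expR_gt0.
have vln : v <= v * ln a by rewrite ler_peMr// (le_trans _ v1).
have v0 : 0 < v by rewrite (lt_le_trans _ v1).
have ln2 : 0 <= ln (2 : R) <= 1.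
  rewrite ln_ge0 ?ler1n//= -ler_expR lnK ?posrE//.
  by have := expR_ge1Dx (1 : R); lra.
have a1 : 1 <= a by apply: le_trans ea; have := expR_ge1Dx (1 : R); lra.
pose tau j : R := (2 ^+ j * Num.sqrt n%:R)^-1.
have pw1 j : 1 <= 2 ^+ j :> R by rewrite exprn_ege1// ler1n.
have t0 j : 0 < tau j by rewrite invr_gt0 mulr_gt0// exprn_gt0.
have t1 j : tau j < 1.
  rewrite invf_lt1 ?mulr_gt0 ?exprn_gt0//.
  apply: (lt_le_trans _ (ler_pM _ _ (pw1 j) sn2)) => //; lra.
have [pis pisP] := choice (fun j => ent (tau j) (introT andP (conj (t0 j) (t1 j)))).
apply: le_trans (@chaining_levels F pi pis (b / Num.sqrt n%:R) K (fun j => 2 * (a / tau j) `^ v) p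
  _ _ _ p1 sp lp _ _ _ _) _.
- by rewrite divr_gt0.
- lra.
- move=> g gF; apply: (le_trans (Dpi g gF)); rewrite expr_div_n snn.
  by rewrite le_eqVlt; apply/orP; left; apply/eqP; field; rewrite gt_eqF.
- move=> j g gF; apply: (le_trans ((pisP j).1 g gF)).
  rewrite /tau expr_div_n snn exprVn exprMn snn (_ : 4 ^+ j = 2 ^+ j * 2 ^+ j); last by rewrite -exprMn -natrM.
  rewrite le_eqVlt; apply/orP; left; apply/eqP.
  have : 0 < 2 ^+ j :> R by rewrite exprn_gt0.
  by move: (2 ^+ j) => q q0; field; rewrite !gt_eqF.
- move=> j; have : 1 <= (a / tau j) `^ v.
    rewrite -(powRr0 (a / tau j)) ler_powR ?(ltW v0)//.
    have t1' : 1 <= (tau j)^-1 by rewrite invf_ge1// ltW.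
    by rewrite -[leLHS]mulr1; apply: ler_pM.
  by move=> h; rewrite -[leLHS]mul1r ler_pM// ler1n.
- by move=> j; have [] := pisP j.
- move=> j; have q0 : 0 < a / tau j by rewrite divr_gt0.
  rewrite lnM ?posrE ?powR_gt0// ln_powR /tau invrK.
  rewrite lnM ?posrE ?mulr_gt0 ?exprn_gt0// lnM ?posrE ?exprn_gt0//.
  rewrite lnXn//.
  have -> : ln (Num.sqrt n%:R) = ln n%:R / 2 :> R.
    by rewrite -{2}snn lnXn// -[_ *+ 2]mulr_natr mulfK.
  have /andP[_ l2] := ln2.
  have vl2 : v * ln 2 <= K / 128.
    have : v * ln 2 <= v by rewrite ler_piMr// ltW.
    by move: (v * ln 2) (v * ln a) vln Ka => *; lra.
  have q1 : v * (ln 2 * j%:R) <= K / 128 * j%:R by rewrite mulrA ler_wpM2r.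
  have aux (l x y z k t : R) : l <= 1 -> 128 * x <= k -> 128 * y <= k -> z <= k / 128 * t ->
      1 <= x -> l + (x + (z + y / 2)) <= (k * 3 + k * t) / 128.
    by rewrite (_ : k / 128 * t = k * t / 128); [move: (k * t) => *; lra|rewrite mulrAC].
  have va1 : 1 <= v * ln a by exact: (le_trans v1).
  by rewrite -(mulr_natr (ln 2)) !(mulrDr v) (mulrDr K) (mulrA v (ln n%:R)); exact: aux.
- by rewrite mulrAC.
Qed.

End maximal.

(** * Sums of independent variables *)

Lemma measurable_gt_set (R : realType) d (W : measurableType d) (f : W -> R) (c : R) :
  measurable_fun setT f -> measurable [set w | c < f w].
Proof.
move=> mf; have := measurable_preimT mf (measurable_itv `]c, +oo[).
by congr measurable; apply/seteqP; split => w /=; rewrite in_itv/= andbT.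
Qed.

Section tuple_laws.
Context (R : realType) d (T : measurableType d) (C : set (set T)).
Hypothesis gC : d.-measurable = <<s C >>.
Hypothesis CI : setI_closed C.
Hypothesis CT : C setT.

Let cyl n : set (set (n.-tuple T)) :=
  [set \bigcap_i ((@tnth n T)^~ i @^-1` A i) | A in [set A : 'I_n -> set T | forall i, C (A i)]].

Let mC A : C A -> measurable A.
Proof. by move=> CA; rewrite gC; exact: sub_gen_smallest. Qed.

Let measurable_cyl n : @measurable _ (n.-tuple T) = <<s @cyl n >>.
Proof.
apply/seteqP; split.
  apply: smallest_sub; first exact: smallest_sigma_algebra.
  apply: (big_ind (fun S : set (set (n.-tuple T)) => S `<=` <<s @cyl n >>)).
  - exact: sub0set.
  - by move=> S1 S2; rewrite subUset.
  - move=> i _ _ [A mA <-]; rewrite setTI.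
    pose S := [set A : set T | <<s @cyl n >> ((@tnth n T)^~ i @^-1` A)].
    have sS : sigma_algebra setT S.
      have [s0 sC sU] := smallest_sigma_algebra setT (@cyl n).
      split; first by rewrite /S/= preimage_set0.
      - by move=> B SB; rewrite /S/= setTD preimage_setC -setTD; exact: sC.
      - by move=> F SF; rewrite /S/= preimage_bigcup; exact: sU.
    suff : measurable `<=` S by apply.
    rewrite gC; apply: smallest_sub => // B CB.
    apply: sub_gen_smallest; exists (fun j => if j == i then B else setT).
      by move=> j /=; case: ifP.
    apply/seteqP; split => [x /(_ i I)|x Bx j _] /=; first by rewrite eqxx.
    by case: eqP => // ->.
apply: smallest_sub; first exact: sigma_algebra_measurable.
move=> _ [A CA <-]; apply: fin_bigcap_measurable => // i _.
by rewrite -[X in measurable X]setTI; apply: measurable_tnth => //; exact: mC.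
Qed.

(** Cylinders with sides in the generator [C] form a pi-system that generates the product
    sigma-field. The generator is kept general because for pairs the useful one consists of
    rectangles. *)
Lemma same_law_tuple d1 d2 (W1 : measurableType d1) (W2 : measurableType d2)
    (P1 : probability W1 R) (P2 : probability W2 R) n
    (Y1 : 'I_n -> W1 -> T) (Y2 : 'I_n -> W2 -> T) :
  (forall i, measurable_fun setT (Y1 i)) -> (forall i, measurable_fun setT (Y2 i)) ->
  (forall A : 'I_n -> set T, (forall i, C (A i)) ->
     P1 (\bigcap_i (Y1 i @^-1` A i)) = P2 (\bigcap_i (Y2 i @^-1` A i))) ->
  same_law P1 (rvec Y1) P2 (rvec Y2).
Proof.
move=> mY1 mY2 E A mA.
have m1 := rvec_measurable mY1; have m2 := rvec_measurable mY2.
pose mu1 : {measure set (n.-tuple T) -> \bar R} := pushforward P1 (rvec Y1).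
pose mu2 : {measure set (n.-tuple T) -> \bar R} := pushforward P2 (rvec Y2).
apply: (@measure_unique _ R _ (@cyl n) (fun=> setT) (measurable_cyl n) _ _ _ (mu1 m1) (mu2 m2)) => //.
- move=> _ _ [A1 C1 <-] [A2 C2 <-]; exists (fun i => A1 i `&` A2 i).
    by move=> i; exact: CI.
  by rewrite -bigcapI; apply: eq_bigcapr => i _; rewrite preimage_setI.
- move=> _; exists (fun=> setT) => //; apply/seteqP; split => // x _ i _ //.
- by rewrite bigcup_const.
- move=> _ [B CB <-]; rewrite /mu1 /mu2 /pushforward.
  have P d' (W : measurableType d') (Y : 'I_n -> W -> T) :
    rvec Y @^-1` (\bigcap_i ((@tnth n T)^~ i @^-1` B i)) = \bigcap_i (Y i @^-1` B i).
    by rewrite preimage_bigcap; apply: eq_bigcapr => i _; apply/seteqP; split => w /=; rewrite tnth_mktuple.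
  by rewrite [LHS](congr1 P1 (P _ _ Y1)) [RHS](congr1 P2 (P _ _ Y2)); exact: E.
- by move=> _; change (P1 (rvec Y1 @^-1` [set: n.-tuple T]) < +oo)%E; rewrite preimage_setT probability_setT ltry.
Qed.

End tuple_laws.

Section scaling.
Context (R : realType).
Notation mu := (@lebesgue_measure R).

Lemma ge0_integral_scale (a : R) (f : R -> \bar R) : a != 0 ->
  measurable_fun setT f -> (forall y, 0 <= f y)%E ->
  (\int[mu]_y f y = `|a|%:E * \int[mu]_y f (a * y)%R)%E.
Proof.
move=> a0 mf f0.
have na : 0 < `|a| by rewrite normr_gt0.
have mx : measurable_fun [set: measurableTypeR R] (fun y : measurableTypeR R => a * y : measurableTypeR R).
  exact: measurable_funM.
pose k : {nonneg R} := NngNum (normr_ge0 a).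
have E A : measurable A -> mu A = pushforward (mscale k mu) (fun y : measurableTypeR R => a * y : measurableTypeR R) A.
  move=> mA; apply: lebesgue_measure_unique => //= _ [[c e]] _ <-.
  rewrite /pushforward /mscale/=.
  have [a_gt0|a_lt0|a_eq0] := ltgtP 0 a; last by rewrite a_eq0 eqxx in a0.
    rewrite (_ : _ @^-1` _ = `]c / a, e / a]%classic); last first.
      by apply/seteqP; split => y /=; rewrite !in_itv/= ltr_pdivrMr// ler_pdivlMr// mulrC.
    rewrite !lebesgue_measure_itv/= !lte_fin ltr_pM2r ?invr_gt0// -!EFinD.
    case: ifP => _; last by rewrite mule0.
    by rewrite -EFinM gtr0_norm//; congr (_%:E); field.
  rewrite (_ : _ @^-1` _ = `[e / a, c / a[%classic); last first.
    by apply/seteqP; split => y /=; rewrite !in_itv/= ltr_ndivlMr// ler_ndivrMr// mulrC andbC.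
  rewrite !lebesgue_measure_itv/= !lte_fin ltr_nM2r ?invr_lt0// -!EFinD.
  case: ifP => _; last by rewrite mule0.
  by rewrite -EFinM ltr0_norm//; congr (_%:E); field.
pose phi (y : measurableTypeR R) : measurableTypeR R := a * y.
transitivity (\int[pushforward (mscale k mu) phi]_y f y)%E.
  by apply: eq_measure_integral => A mA _; exact: E.
rewrite (ge0_integral_pushforward mx (mscale k mu) measurableT mf)// preimage_setT.
have mfp : measurable_fun setT (f \o phi) by apply: (measurableT_comp mf mx).
rewrite [LHS](ge0_integral_mscale mu measurableT k mfp (fun x _ => f0 _)).
by [].
Qed.

Lemma same_law_nlaw_scale d (W : measurableType d) (P : probability W R) (Y : W -> R) (a : R) :
  measurable_fun setT Y -> same_law P Y (nlaw 1) id ->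
  same_law P (fun w => a * Y w) (nlaw a) id.
Proof.
move=> mY NY A mA.
have mA' : measurable ((fun x : R => a * x) @^-1` A).
  by apply: measurable_preimT => //; exact: measurable_funM.
transitivity (nlaw 1 ((fun x : R => a * x) @^-1` A)); first exact: (NY _ mA').
rewrite preimage_id.
have [->|a0] := eqVneq a 0.
  rewrite [RHS]nlawE /normal_law eqxx diracE.
  have [A0|A0] := pselect (A 0).
    rewrite [X in nlaw 1 X](_ : _ = setT) ?probability_setT ?mem_set//.
    by apply/seteqP; split => // w _ /=; rewrite mul0r.
  rewrite [X in nlaw 1 X](_ : _ = set0) ?measure0 ?memNset//.
  by apply/seteqP; split => // w /=; rewrite mul0r.
have I (s : R) (B : set R) : measurable B -> nlaw s B = (\int[nlaw s]_x (\1_B x : R)%:E)%E.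
  by move=> mB; rewrite (integral_indic _ measurableT mB) setIT.
have mI (B : set R) : measurable B -> measurable_fun setT (fun x : R => (\1_B x : R)%:E).
  by move=> mB; apply/measurable_EFinP; exact: measurable_indic.
have I0 (B : set R) x : (0 <= (\1_B x : R)%:E)%E by rewrite lee_fin.
rewrite (I _ _ mA') (I _ _ mA).
rewrite (ge0_integral_nlaw (oner_neq0 R) (mI _ mA') (I0 _)) (ge0_integral_nlaw a0 (mI _ mA) (I0 _)).
have mp s : measurable_fun setT (fun x : R => (normal_pdf 0 s x)%:E).
  by apply/measurable_EFinP; exact: measurable_normal_pdf.
have aux (y : R) : - y ^+ 2 / 2 = - (a * y) ^+ 2 / (a ^+ 2 *+ 2).
  by rewrite exprMn -mulr_natr; field.
rewrite [RHS](ge0_integral_scale a0); last 2 first.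
- by apply: emeasurable_funM; [exact: mI|exact: mp].
- by move=> y; apply: mule_ge0; rewrite lee_fin// normal_pdf_ge0.
rewrite -ge0_integralZl//; last 2 first.
- apply: (measurableT_comp (f := fun x : R => ((\1_A x : R)%:E * (normal_pdf 0 a x)%:E)%E)) => //.
  by apply: emeasurable_funM; [exact: mI|exact: mp].
- by move=> y _; apply: mule_ge0; rewrite lee_fin// normal_pdf_ge0.
apply: eq_integral => x _.
rewrite muleCA; congr (_ * _)%E.
rewrite -EFinM; congr (_%:E).
rewrite !normal_pdfE ?oner_eq0// /normal_peak /normal_fun !subr0 expr1n mul1r.
rewrite mulrA; congr (_ * expR _).
  by rewrite -mulrnAr sqrtrM ?sqr_ge0// sqrtr_sqr invfM mulrA divff ?mul1r// gt_eqF// normr_gt0.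
exact: aux.
Qed.
End scaling.

(** * Sums of independent variables and Bernstein's inequality *)

Section sums.
Context (R : realType) d (W : measurableType d) (P : probability W R) (n : nat)
  (Y : 'I_n -> W -> R).
Hypothesis mY : forall i, measurable_fun setT (Y i).
Hypothesis iY : mutually_independent P Y.

Let indep_cond (D : {pred 'I_n}) (A : 'I_n -> set R) : (forall i, measurable (A i)) ->
  P (\bigcap_(i in [set i | i \in D]) (Y i @^-1` A i)) = (\prod_(i in D) P (Y i @^-1` A i))%E.
Proof.
move=> mA; pose A' i := if i \in D then A i else setT.
rewrite (_ : \bigcap_(i in _) _ = \bigcap_i (Y i @^-1` A' i)); last first.
  apply/seteqP; split => [x Dx i _|x Dx i /= iD]; rewrite /A'/=.
    by case: ifPn => // iD; exact: Dx.
  by have := Dx i I; rewrite /A' iD.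
rewrite iY; last by move=> i; rewrite /A'; case: ifP.
rewrite [RHS]big_mkcond/=; apply: eq_bigr => i _; rewrite /A'; case: ifPn => // _.
by rewrite preimage_setT probability_setT.
Qed.

(** One independent variable is moved to its own copy of the space. Fubini on the product then
    gives, by induction on [s], the law and the exponential moments of the sum. *)
Lemma same_law_sum_cons (s : seq 'I_n) (i : 'I_n) (al : 'I_n -> R) : uniq (i :: s) ->
  same_law P (fun w => \sum_(j <- i :: s) al j * Y j w)
    (prodP P P) (fun z => al i * Y i z.1 + \sum_(j <- s) al j * Y j z.2).
Proof.
move=> us; move: (us) => /= /andP[is0 us'].
(* Coordinates outside i :: s are set to 0, so that both families are indexed by all of 'I_n and
   [same_law_tuple] applies. *)
pose U j w := if (j == i) || (j \in s) then Y j w else 0.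
pose V j (z : W * W) := if j == i then Y j z.1 else if j \in s then Y j z.2 else 0.
have mU j : measurable_fun setT (U j).
  by rewrite /U; case: (_ || _) => //; exact: measurable_cst.
have mV j : measurable_fun setT (V j).
  rewrite /V; case: (j == i); first exact: measurableT_comp.
  by case: (j \in s); [exact: measurableT_comp|exact: measurable_cst].
have UV : same_law P (rvec U) (prodP P P) (rvec V).
  apply: (@same_law_tuple R _ R measurable) => //.
  - by apply/seteqP; split; [exact: sub_gen_smallest|apply: smallest_sub => //; exact: sigma_algebra_measurable].
  - by move=> A B; exact: measurableI.
  - move=> A mA.
    (* If the side of the cylinder at some coordinate outside the list misses 0, both events are
       empty; otherwise these coordinates impose no constraint. *)
    pose Z := forall j, j \notin i :: s -> A j 0.
    have [z|nz] := pselect Z; last first.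
      have [j jn Aj] : exists2 j, j \notin i :: s & ~ A j 0.
        by apply: contrapT => H; apply: nz => j jn; apply: contrapT => Aj; apply: H; exists j.
      move: jn; rewrite inE negb_or => /andP[ji js].
      rewrite [X in P X](_ : _ = set0); last first.
        apply/seteqP; split => // w /(_ j Logic.I); rewrite /U/= (negbTE ji) (negbTE js) => //.
      rewrite [X in prodP _ _ X](_ : _ = set0) ?measure0//.
      apply/seteqP; split => // w /(_ j Logic.I); rewrite /V/= (negbTE ji) (negbTE js) => //.
    rewrite [X in P X](_ : _ = \bigcap_(j in [set j | j \in i :: s]) (Y j @^-1` A j)); last first.
      apply/seteqP; split => w Hw j.
        by move=> js; have := Hw j Logic.I; rewrite /U /= -in_cons js.
      move=> _; rewrite /U/= -in_cons; case: ifPn => js; first exact: (Hw j).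
      exact: z.
    rewrite [X in prodP _ _ X](_ : _ = (Y i @^-1` A i) `*`
       (\bigcap_(j in [set j | j \in s]) (Y j @^-1` A j))); last first.
      apply/seteqP; split => -[w1 w2] Hw.
        split => [|j js]; first by have := Hw i Logic.I; rewrite /V/= eqxx.
        have := Hw j Logic.I; rewrite /V/=; case: eqP => [ji|_]; last by rewrite js.
        by move: is0; rewrite -ji js.
      move=> j _; rewrite /V/=; case: eqP => [->|ji]; first exact: Hw.1.
      case: ifPn => js; first exact: (Hw.2 j).
      by apply: z; rewrite inE negb_or js andbT; exact/eqP.
    rewrite prod_rectangle; first 1 last.
    + exact: measurable_preimT.
    + by apply: fin_bigcap_measurable => // j _; exact: measurable_preimT.
    rewrite (@indep_cond (mem (i :: s)))// (@indep_cond (mem s))//.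
    by rewrite -!(big_uniq _ us) -(big_uniq _ us')/= big_cons.
move=> A mA.
pose phi (t : n.-tuple R) := \sum_(j <- i :: s) al j * tnth t j.
have mphi : measurable_fun setT phi.
  by apply: measurable_sum => j; apply: measurable_funM => //; exact: measurable_tnth.
have eU w : phi (rvec U w) = \sum_(j <- i :: s) al j * Y j w.
  by apply: eq_big_seq => j js; rewrite tnth_mktuple /U -in_cons js.
have eV z : phi (rvec V z) = al i * Y i z.1 + \sum_(j <- s) al j * Y j z.2.
  rewrite /phi big_cons tnth_mktuple {1}/V eqxx; congr +%R.
  apply: eq_big_seq => j js; rewrite tnth_mktuple /V js; case: eqP => // ji.
  by move: is0; rewrite -ji js.
have := UV (phi @^-1` A) (measurable_preimT mphi mA).
rewrite (_ : _ @^-1` _ = (fun w => \sum_(j <- i :: s) al j * Y j w) @^-1` A); last first.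
  by apply/funext => w; rewrite /preimage/= eU.
move=> ->; congr (prodP P P _); apply/funext => z.
by rewrite /preimage/= eV.
Qed.

Lemma same_law_sum_nlaw (s : seq 'I_n) (al : 'I_n -> R) : uniq s ->
  (forall i, same_law P (Y i) (nlaw 1) id) ->
  same_law P (fun w => \sum_(j <- s) al j * Y j w)
    (nlaw (Num.sqrt (\sum_(j <- s) al j ^+ 2))) id.
Proof.
move=> us NY.
have msum (r : seq 'I_n) : measurable_fun setT (fun w => \sum_(j <- r) al j * Y j w).
  by apply: measurable_sum => j; exact: measurable_funM.
elim: s us => [|i s IH] us.
  move=> A mA; rewrite big_nil sqrtr0 nlawE /normal_law eqxx.
  have [A0|A0] := pselect (A 0).
    rewrite [X in P X](_ : _ = setT) ?probability_setT ?diracE ?mem_set//.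
    by apply/seteqP; split => // w _ /=; rewrite big_nil.
  rewrite [X in P X](_ : _ = set0) ?measure0 ?diracE ?memNset//.
  by apply/seteqP; split => // w /=; rewrite big_nil.
move=> A mA; rewrite (same_law_sum_cons al us mA).
have h1 := same_law_nlaw_scale (al i) (mY i) (NY i).
have := same_law_nlaw_add (measurable_funM (measurable_cst (al i)) (mY i)) (msum s) h1 (IH _).
move=> /(_ (andP us).2) /(_ A mA) ->.
rewrite big_cons sqr_sqrtr//; apply: sumr_ge0 => j _; exact: sqr_ge0.
Qed.

Lemma Ex_expR_sum (M : R) (s : seq 'I_n) (al : 'I_n -> R) : uniq s ->
  (forall i w, `|Y i w| <= M) ->
  Ex P (fun w => expR (\sum_(j <- s) al j * Y j w)) =
  \prod_(j <- s) Ex P (fun w => expR (al j * Y j w)).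
Proof.
move=> us YM.
have msum (r : seq 'I_n) : measurable_fun setT (fun w => \sum_(j <- r) al j * Y j w).
  by apply: measurable_sum => j; exact: measurable_funM.
have mexp : measurable_fun setT (@expR R) by exact: measurable_expR.
have bsum (r : seq 'I_n) w : `|\sum_(j <- r) al j * Y j w| <= \sum_(j <- r) `|al j| * M.
  by apply: (le_trans (ler_norm_sum _ _ _)); apply: ler_sum => j _; rewrite normrM ler_wpM2l.
elim: s us => [|i s IH] us.
  rewrite big_nil (_ : (fun w => _) = cst 1) ?Ex_cst//.
  by apply/funext => w; rewrite big_nil expR0.
have us' := andP us; rewrite big_cons -(IH us'.2).
have E := same_law_sum_cons al us.
have mv : measurable_fun setT (fun z : W * W => al i * Y i z.1 + \sum_(j <- s) al j * Y j z.2).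
  apply: measurable_funD.
    by apply: measurable_funM => //; exact: (measurableT_comp (mY i)).
  exact: (measurableT_comp (msum s)).
rewrite [LHS](same_law_Ex (msum (i :: s)) mv E mexp).
pose B := `|al i| * M + \sum_(j <- s) `|al j| * M.
rewrite (@Ex_fubini _ _ _ _ _ _ _ _ (expR B)); last 2 first.
- exact: measurableT_comp.
- move=> z; rewrite ger0_norm ?expR_ge0// ler_expR /=.
  apply: (le_trans (ler_norm _)); apply: (le_trans (ler_normD _ _)).
  by rewrite lerD// normrM ler_wpM2l.
rewrite [RHS]mulrC -[RHS]ExZ; last first.
  apply: (@itg_bnd _ _ _ _ _ (expR (`|al i| * M))).
    by apply: measurableT_comp => //; exact: measurable_funM.
  move=> w; rewrite ger0_norm ?expR_ge0// ler_expR.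
  by rewrite (le_trans (ler_norm _))// normrM ler_wpM2l.
apply: (congr1 (Ex P)); apply/funext => x /=.
rewrite [RHS]mulrC -[RHS]ExZ; last first.
  apply: (@itg_bnd _ _ _ _ _ (expR (\sum_(j <- s) `|al j| * M))).
    exact: measurableT_comp.
  move=> w; rewrite ger0_norm ?expR_ge0// ler_expR.
  by rewrite (le_trans (ler_norm _)).
by apply: (congr1 (Ex P)); apply/funext => y; rewrite expRD.
Qed.

Lemma expR1_le4 : expR 1 <= 4 :> R.
Proof.
have h : 1 / 2 <= expR (- (1 / 2)) :> R by have := expR_ge1Dx (- (1 / 2) : R); lra.
have E : expR 1 * (expR (- (1 / 2)) * expR (- (1 / 2))) = 1 :> R.
  by rewrite -!expRD -[RHS]expR0; congr expR; field.
have q : 1 / 2 * (1 / 2) <= expR (- (1 / 2)) * expR (- (1 / 2)) :> R by rewrite ler_pM.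
have := ler_wpM2l (expR_ge0 (1 : R)) q; rewrite E; move: (expR 1 : R) => *; lra.
Qed.

(** Chernoff bound at l = sqrt(K / n) / (2 s). The condition on M gives 2 l M <= 1, so that e^u <= 1
    + u + 4 u^2 applies to u = l (Y - m), and each factor is at most e^(l m + K / n). With t = 8 s
    sqrt(K / n) one has n l t = 4 K, and the exponent is K - 4 K. *)
Lemma bernstein_upper (M m s K : R) : (0 < n)%N ->
  (forall i w, `|Y i w| <= M) -> (forall i, Ex P (Y i) = m) ->
  (forall i, Ex P (fun w => Y i w ^+ 2) <= s ^+ 2) ->
  0 < s -> 0 < K -> M ^+ 2 * K <= n%:R * s ^+ 2 ->
  (P [set w | (8 * s * Num.sqrt (K / n%:R) < (\sum_i Y i w) / n%:R - m)%R]
    <= (expR (- 3 * K))%:E)%E.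
Proof.
move=> n0 YM Em Es s0 K0 MK.
have nR : 0 < n%:R :> R by rewrite ltr0n.
pose l := Num.sqrt (K / n%:R) / (2 * s).
set t := 8 * s * Num.sqrt (K / n%:R).
have sK : 0 < Num.sqrt (K / n%:R) by rewrite sqrtr_gt0 divr_gt0.
have l0 : 0 < l by rewrite divr_gt0// mulr_gt0.
have sKK : Num.sqrt (K / n%:R) ^+ 2 = K / n%:R by rewrite sqr_sqrtr// ltW// divr_gt0.
have lt4 : l * t = 4 * (K / n%:R) by rewrite -sKK /l /t; field; rewrite gt_eqF.
have ll : l ^+ 2 = K / n%:R / (4 * s ^+ 2) by rewrite /l expr_div_n sKK; field; rewrite !gt_eqF.
clearbody l; clearbody t.
have bY i : itg P (Y i) by exact: (itg_bnd P (mY i) (YM i)).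
have mY2 i : measurable_fun setT (fun w => Y i w ^+ 2) by exact: measurable_funX.
have bY2 i : itg P (fun w => Y i w ^+ 2).
  apply: (@itg_bnd _ _ _ _ _ (M ^+ 2)) => // w.
  rewrite normrX ler_pXn2r ?nnegrE//; exact: le_trans (YM i w).
have mM : `|m| <= M by rewrite -(Em (Ordinal n0)); exact: Ex_bnd.
have step i : Ex P (fun w => expR (l * Y i w)) <= expR (l * m + K / n%:R).
  have M0 : 0 <= M by exact: (le_trans _ mM).
  have lM : (2 * l * M) ^+ 2 <= 1.
    rewrite !exprMn ll [leLHS](_ : _ = (M ^+ 2 * K) / (n%:R * s ^+ 2)); last by field; rewrite !gt_eqF.
    by rewrite ler_pdivrMr ?mul1r// mulr_gt0// exprn_gt0.
  have lM1 : 2 * l * M <= 1.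
    by rewrite -(@ler_pXn2r _ 2) ?nnegrE ?expr1n// !mulr_ge0// ltW.
  have pt w : expR (l * Y i w) <= expR (l * m) *
      (1 + l * (Y i w - m) + 4 * l ^+ 2 * (Y i w ^+ 2 - 2 * m * Y i w + m ^+ 2)).
    rewrite -[in leLHS](subrK m (Y i w)) addrC mulrDr expRD ler_pM2l ?expR_gt0//.
    set u := l * (Y i w - m).
    have u1 : `|u| <= 1.
      apply: le_trans lM1; rewrite normrM (gtr0_norm l0) [2 * l]mulrC -mulrA ler_pM2l//.
      by apply: (le_trans (ler_normB _ _)); rewrite mulr_natl mulr2n lerD// mM.
    have := expR_taylor2 u; rewrite ler_norml => /andP[_].
    have : `|u| ^+ 2 * expR `|u| <= u ^+ 2 * 4.
      by rewrite real_normK ?num_real// ler_wpM2l ?sqr_ge0// (le_trans _ expR1_le4)// ler_expR.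
    rewrite (_ : 4 * l ^+ 2 * _ = u ^+ 2 * 4); last by rewrite /u; ring.
    have aux (x y z e : R) : x <= z -> e - 1 - y <= x -> e <= 1 + y + z by move=> *; lra.
    exact: aux.
  pose g w := expR (l * m) * (1 + l * (Y i w - m) + 4 * l ^+ 2 * (Y i w ^+ 2 - 2 * m * Y i w + m ^+ 2)).
  have I1 : itg P (fun w => 1 + l * (Y i w - m)).
    by apply: itgD; [exact: itg_cst|apply: itgZ; apply: itgB => //; exact: itg_cst].
  have I3 : itg P (fun w => Y i w ^+ 2 - 2 * m * Y i w) by apply: itgB => //; exact: itgZ.
  have I2 : itg P (fun w => Y i w ^+ 2 - 2 * m * Y i w + m ^+ 2).
    by apply: itgD => //; exact: itg_cst.
  have I4 : itg P (fun w => 4 * l ^+ 2 * (Y i w ^+ 2 - 2 * m * Y i w + m ^+ 2)) by exact: itgZ.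
  have Ig : itg P g by apply: itgZ; exact: itgD.
  have Ie : itg P (fun w => expR (l * Y i w)).
    apply: (@itg_bnd _ _ _ _ _ (expR (l * M))).
      by apply: measurableT_comp => //; exact: measurable_funM.
    by move=> w; rewrite ger0_norm ?expR_ge0// ler_expR ler_pM2l// (le_trans (ler_norm _)).
  apply: (le_trans (Ex_le Ie Ig pt)).
  rewrite /g ExZ; last exact: itgD.
  rewrite expRD ler_pM2l ?expR_gt0// ExD// ExD; [|exact: itg_cst|by apply: itgZ; apply: itgB => //; exact: itg_cst].
  rewrite Ex_cst ExZ; last by apply: itgB => //; exact: itg_cst.
  rewrite ExB//; last exact: itg_cst.
  rewrite Ex_cst Em subrr mulr0 addr0 ExZ// ExD//; last exact: itg_cst.
  rewrite Ex_cst ExB//; last exact: itgZ.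
  rewrite ExZ// Em; apply: le_trans (expR_ge1Dx _); rewrite lerD2l.
  rewrite ll [leRHS](_ : K / n%:R = 4 * (K / n%:R / (4 * s ^+ 2)) * s ^+ 2); last by field; rewrite !gt_eqF.
  rewrite ler_wpM2l; first by [].
    by rewrite -ll mulr_ge0// sqr_ge0.
  have aux (x y z : R) : 0 <= y -> x <= z -> x - 2 * m * m + m ^+ 2 <= z.
    by move=> *; have := sqr_ge0 m; rewrite -[2 * m * m]mulrA -expr2 => *; lra.
  by apply: aux (Es i); exact: lexx.
have mS : measurable_fun setT (fun w => \sum_i Y i w) by exact: measurable_sum.
have mA : measurable [set w | t < (\sum_i Y i w) / n%:R - m].
  by apply: measurable_gt_set; apply: measurable_funB => //; exact: measurable_funM.
rewrite -(Ex_indic _ mA) lee_fin.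
pose h w := expR (- (n%:R * (l * m) + n%:R * (l * t))) * expR (\sum_(i <- index_enum 'I_n) l * Y i w).
have Ie : itg P (fun w => expR (\sum_(i <- index_enum 'I_n) l * Y i w)).
  apply: (@itg_bnd _ _ _ _ _ (expR (\sum_(i <- index_enum 'I_n) l * M))).
    by apply: measurableT_comp => //; apply: measurable_sum => i; exact: measurable_funM.
  move=> w; rewrite ger0_norm ?expR_ge0// ler_expR; apply: ler_sum => i _.
  by rewrite ler_pM2l// (le_trans (ler_norm _)).
apply: (@le_trans _ _ (Ex P h)).
  apply: Ex_le.
  - apply: (@itg_bnd _ _ _ _ _ 1) => [|w]; first exact: measurable_indic.
    by rewrite indicE; case: (_ \in _); rewrite ?normr1 ?normr0.
  - exact: itgZ.
  - move=> w; rewrite indicE; have [H|/negP H] := boolP (t < (\sum_i Y i w) / n%:R - m); last first.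
      by rewrite memNset// mulr_ge0// expR_ge0.
    rewrite mem_set//; move: H; rewrite ltrBrDr ltr_pdivlMr// => H.
    rewrite /h -expRD -[leLHS]expR0 ler_expR -mulr_sumr addrC subr_ge0.
    by rewrite !(mulrCA n%:R) -mulrDr ler_pM2l// -mulrDr mulrC addrC ltW.
rewrite /h ExZ// (Ex_expR_sum _ (index_enum_uniq _) YM).
apply: (@le_trans _ _ (expR (- (n%:R * (l * m) + n%:R * (l * t))) * \prod_(j <- index_enum 'I_n) expR (l * m + K / n%:R))).
  rewrite ler_wpM2l ?expR_ge0//; apply: ler_prod => i _.
  by rewrite step andbT; apply: Ex_ge0 => w; exact: expR_ge0.
rewrite prodr_const cardT size_enum_ord -expRM_natl -expRD ler_expR lt4.
rewrite le_eqVlt; apply/orP; left; apply/eqP; rewrite -mulr_natl.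
by field; rewrite gt_eqF.
Qed.

End sums.

Lemma mutually_independent_comp (R : realType) d d1 d2 (W : measurableType d)
    (T1 : measurableType d1) (T2 : measurableType d2) (P : probability W R) n
    (X : 'I_n -> W -> T1) (h : T1 -> T2) :
  measurable_fun setT h -> mutually_independent P X ->
  mutually_independent P (fun i => h \o X i).
Proof. by move=> mh iX A mA; apply: (iX (fun i => h @^-1` A i)) => i; exact: measurable_preimT. Qed.

Lemma bernstein (R : realType) d (W : measurableType d) (P : probability W R) n
    (Y : 'I_n -> W -> R) (M m s K : R) : (0 < n)%N ->
  (forall i, measurable_fun setT (Y i)) -> mutually_independent P Y ->
  (forall i w, `|Y i w| <= M) -> (forall i, Ex P (Y i) = m) ->
  (forall i, Ex P (fun w => Y i w ^+ 2) <= s ^+ 2) ->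
  0 < s -> 0 < K -> M ^+ 2 * K <= n%:R * s ^+ 2 ->
  (P [set w | (8 * s * Num.sqrt (K / n%:R) < `|(\sum_i Y i w) / n%:R - m|)%R]
    <= (2 * expR (- 3 * K))%:E)%E.
Proof.
move=> n0 mY iY YM Em Es s0 K0 MK.
have H1 := bernstein_upper mY iY n0 YM Em Es s0 K0 MK.
have mN : measurable_fun setT (-%R : R -> R) by exact: measurable_funN.
have a1 i : measurable_fun setT (fun w => - Y i w) by exact: measurableT_comp.
have a2 : mutually_independent P (fun i w => - Y i w) by exact: (mutually_independent_comp mN iY).
have a3 i w : `|- Y i w| <= M by rewrite normrN.
have a4 i : Ex P (fun w => - Y i w) = - m by rewrite ExN ?Em//; exact: (itg_bnd P (mY i) (YM i)).
have a5 i : Ex P (fun w => (- Y i w) ^+ 2) <= s ^+ 2.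
  by under [X in Ex P X]funext do rewrite sqrrN; exact: Es.
have H2 := bernstein_upper a1 a2 n0 a3 a4 a5 s0 K0 MK.
have -> : (2 * expR (- 3 * K))%:E = ((expR (- 3 * K))%:E + (expR (- 3 * K))%:E)%E.
  by rewrite -EFinD; congr EFin; rewrite mulr_natl mulr2n.
have mS : measurable_fun setT (fun w => \sum_i Y i w) by exact: measurable_sum.
have mT : measurable_fun setT (fun w => (\sum_i Y i w) / n%:R - m).
  by apply: measurable_funB => //; exact: measurable_funM.
have mA : measurable [set w | 8 * s * Num.sqrt (K / n%:R) < (\sum_i Y i w) / n%:R - m].
  exact: measurable_gt_set.
have mB : measurable [set w | 8 * s * Num.sqrt (K / n%:R) < (\sum_i - Y i w) / n%:R - - m].
  apply: measurable_gt_set.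
  apply: measurable_funB => //; apply: measurable_funM => //.
  by apply: measurable_sum => i; exact: measurableT_comp.
apply: le_trans (leeD H1 H2).
apply: le_trans (measureU2 _ _ _) => //; apply: le_measure; rewrite ?inE//.
- apply: measurable_gt_set.
  exact: measurableT_comp.
- exact: measurableU.
- move=> w /=; rewrite ltr_normr => /orP[?|H]; [by left|right].
  by move: H; rewrite opprB sumrN mulNr opprK addrC.
Qed.

(** On rectangles the probability factors over coordinates and over the two copies, and each
    coordinate's factor is symmetric in the copies. *)
Lemma same_law_swap (R : realType) d d' (W : measurableType d) (S : measurableType d')
    (P : probability W R) n (X : 'I_n -> W -> S) (sg : 'I_n -> bool) :
  (forall i, measurable_fun setT (X i)) -> mutually_independent P X ->
  same_law (prodP P P) (rvec (fun i z =>
      if sg i then (X i z.2, X i z.1) else (X i z.1, X i z.2)))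
    (prodP P P) (rvec (fun i z => (X i z.1, X i z.2))).
Proof.
move=> mX iX.
have mX1 i : measurable_fun setT (fun z : W * W => X i z.1) by exact: measurableT_comp.
have mX2 i : measurable_fun setT (fun z : W * W => X i z.2) by exact: measurableT_comp.
apply: (same_law_tuple (measurable_prod_measurableType S S)).
- move=> _ _ [A1 mA1 [B1 mB1 <-]] [A2 mA2 [B2 mB2 <-]].
  exists (A1 `&` A2); first exact: measurableI.
  exists (B1 `&` B2); first exact: measurableI.
  by rewrite setXI.
- by exists setT => //; exists setT => //; rewrite setXTT.
- by move=> i; case: (sg i); exact: measurable_fun_pair.
- by move=> i; exact: measurable_fun_pair.
move=> A CA.
have /choice[UV UVP] : forall i, exists uv : set S * set S,
    [/\ measurable uv.1, measurable uv.2 & A i = uv.1 `*` uv.2].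
  by move=> i; have [U mU [V mV UV]] := CA i; exists (U, V).
pose c (b : bool) i := if b then (UV i).2 else (UV i).1.
have mc b i : measurable (c b i) by have [] := UVP i; case: b.
have E (g : 'I_n -> bool) : prodP P P (\bigcap_i ((fun z =>
      if g i then (X i z.2, X i z.1) else (X i z.1, X i z.2)) @^-1` A i)) =
    (\prod_(i < n) (P (X i @^-1` (UV i).1) * P (X i @^-1` (UV i).2)))%E.
  rewrite (_ : \bigcap_i _ = (\bigcap_i (X i @^-1` c (g i) i)) `*`
      (\bigcap_i (X i @^-1` c (~~ g i) i))); last first.
    apply/seteqP; split => [[w1 w2] H|[w1 w2] [H1 H2] i _].
      split => i _; have := H i Logic.I; have [_ _ ->] := UVP i; rewrite /c /=; by case: (g i) => -[].
    have := H1 i Logic.I; have := H2 i Logic.I; have [_ _ ->] := UVP i; rewrite /c /=.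
    by case: (g i).
  rewrite prod_rectangle; last 2 first.
  - by apply: fin_bigcap_measurable => // i _; exact: measurable_preimT.
  - by apply: fin_bigcap_measurable => // i _; exact: measurable_preimT.
  rewrite !iX// -big_split/=; apply: eq_bigr => i _.
  by rewrite /c; case: (g i) => //=; rewrite muleC.
by rewrite (E sg) (E (fun=> false)).
Qed.

(** * Entropy *)

Section discrete_probability.
Context (R : realType) d (S : measurableType d) (m : nat) (x : 'I_m.+1 -> S) (p : 'I_m.+1 -> R).
Hypothesis p0 : forall i, 0 <= p i.
Hypothesis p1 : \sum_i p i = 1.

Let m_ (j : nat) : {measure set S -> \bar R} := mscale (NngNum (p0 (inord j))) \d_(x (inord j)).
Let Q : set S -> \bar R := msum m_ m.+1.

Let QE A : Q A = (\sum_(i < m.+1) (p i)%:E * \d_(x i) A)%E.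
Proof.
by rewrite /Q /msum; apply: eq_bigr => i _; rewrite /m_ /mscale/= inord_val.
Qed.

HB.instance Definition _ := Measure.on Q.

Let Q1 : Q setT = 1%E.
Proof.
rewrite QE (eq_bigr (fun i => (p i)%:E)) => [|i _]; last by rewrite diracT mule1.
by rewrite sumEFin p1.
Qed.

HB.instance Definition _ := Measure_isProbability.Build _ _ _ Q Q1.

Lemma discrete_probability : exists P : probability S R, finitely_discrete P /\
  forall f : S -> R, measurable_fun setT f -> (forall s, 0 <= f s) ->
    (\int[P]_s (f s)%:E = (\sum_i p i * f (x i))%:E)%E.
Proof.
exists Q; split.
  by exists m.+1, x, p; split => // A mA; exact: QE.
move=> f mf f0; have mf' : measurable_fun setT (EFin \o f) by exact/measurable_EFinP.
rewrite (@ge0_integral_measure_sum _ _ _ m_ setT measurableT (EFin \o f))//; last first.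
  by move=> s _; rewrite lee_fin.
rewrite -sumEFin; apply: eq_bigr => i _.
rewrite /m_ inord_val ge0_integral_mscale//; last by move=> s _; rewrite lee_fin.
by rewrite integral_dirac// diracT mul1e.
Qed.
End discrete_probability.

Section grid.
Context (R : realType) (k N : nat) (M eta : R).

(** For each coordinate the code records which multiples of [eta] lie below y i + M. The codes form
    a finite type and every bit is a measurable comparison; once N eta exceeds 2 M, equal codes
    force coordinates within eta. *)
Definition grid_code (y : 'I_k -> R) : {ffun 'I_k * 'I_N.+1 -> bool} :=
  [ffun c : 'I_k * 'I_N.+1 => (c.2 : nat)%:R * eta <= y c.1 + M].

Lemma grid_code_close (y y' : 'I_k -> R) i : 0 < eta -> 2 * M / eta < N%:R ->
  (forall i, `|y i| <= M) -> (forall i, `|y' i| <= M) ->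
  grid_code y = grid_code y' -> `|y i - y' i| <= eta.
Proof.
move=> e0 MN.
suff H (z z' : 'I_k -> R) : (forall i, `|z i| <= M) -> (forall i, `|z' i| <= M) ->
    grid_code z = grid_code z' -> z' i - z i <= eta.
  by move=> yM yM' E; rewrite ler_norml lerNl opprB !H.
move=> zM zM' E; rewrite leNgt; apply/negP => gap.
have zi : 0 <= z i + M by have := zM i; rewrite ler_norml => /andP[]; lra.
have z'i : z' i + M <= 2 * M by have := zM' i; rewrite ler_norml => /andP[]; lra.
pose j := (Num.truncn ((z i + M) / eta)).+1.
have q0 : 0 <= (z i + M) / eta by rewrite divr_ge0// ltW.
have jlt : z i + M < j%:R * eta by rewrite -ltr_pdivrMr//; exact: truncnS_gt.
have jle : j%:R * eta <= z' i + M.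
  have : (Num.truncn ((z i + M) / eta))%:R * eta <= z i + M.
    by rewrite -ler_pdivlMr//; have /andP[] := truncn_itv q0.
  rewrite [in X in _ -> X](_ : j%:R = (Num.truncn ((z i + M) / eta))%:R + 1); last by rewrite natr1.
  have aux (q : R) : q * eta <= z i + M -> (q + 1) * eta <= z' i + M.
    by rewrite mulrDl mul1r; move: (q * eta) => *; lra.
  exact: aux.
have jN : (j < N.+1)%N.
  rewrite ltnS -(@ler_nat R); apply: ltW; apply: le_lt_trans MN.
  by rewrite ler_pdivlMr//; apply: (le_trans jle).
have := congr1 (fun f : {ffun _ -> _} => f (i, Ordinal jN)) E.
by rewrite !ffunE/= jle leNgt jlt.
Qed.

Lemma measurable_grid_code d (W : measurableType d) (Y : 'I_k -> W -> R) c :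
  (forall i, measurable_fun setT (Y i)) ->
  measurable [set w | grid_code (Y ^~ w) = c].
Proof.
move=> mY.
rewrite (_ : [set w | _] = \bigcap_(q : 'I_k * 'I_N.+1) [set w | ((q.2 : nat)%:R * eta <= Y q.1 w + M) = c q]); last first.
  apply/seteqP; split => w /= H; first by move=> q _ /=; rewrite -H ffunE.
  by apply/ffunP => q; rewrite ffunE; exact: H.
apply: fin_bigcap_measurable => // q _.
have mq : measurable_fun setT (fun w => (q.2 : nat)%:R * eta <= Y q.1 w + M).
  by apply: measurable_fun_ler => //; exact: measurable_funD.
by have := mq measurableT [set c q] Logic.I; rewrite setTI.
Qed.

End grid.

(** The mass of each cell of [code] is placed at one point of that cell. This transfers entropy
    bounds, assumed only for finitely discrete measures, to an arbitrary [Q]. *)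
Lemma quantization (R : realType) d (S : measurableType d) (Q : probability S R)
    (C : finType) (code : S -> C) :
  (forall c, measurable [set s | code s = c]) ->
  exists (m : nat) (x : 'I_m.+1 -> S) (p : 'I_m.+1 -> R),
  [/\ forall i, 0 <= p i, \sum_i p i = 1 &
    forall (f : S -> R) (e : R), itg Q f ->
      (forall s s', code s = code s' -> `|f s - f s'| <= e) ->
      `|Ex Q f - \sum_i p i * f (x i)| <= e].
Proof.
move=> mc.
have [s0 _] : exists s : S, True.
  apply: contrapT => /forallNP nS; have := probability_setT Q.
  rewrite (_ : setT = set0) ?measure0; last by apply/seteqP; split => // s _; exact: (nS s).
  by move=> /eqP; rewrite eq_sym onee_eq0.
have [m cm] : exists m, #|C| = m.+1.
  have : (0 < #|C|)%N by apply/card_gt0P; exists (code s0).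
  by case: #|C| => // m _; exists m.
pose ev (i : 'I_m.+1) : C := enum_val (cast_ord (esym cm) i).
pose A c := [set s | code s = c].
pose xc c := if pselect (exists s, code s = c) is left h then sval (cid h) else s0.
have xcP s : code (xc (code s)) = code s.
  rewrite /xc; case: pselect => [h|[]]; last by exists s.
  by case: cid.
pose pc c := Ex Q (\1_(A c)).
have bI c s : `|\1_(A c) s : R| <= 1.
  by rewrite indicE; case: (_ \in _); rewrite ?normr1 ?normr0.
have mI c : measurable_fun setT (\1_(A c) : S -> R) by apply: measurable_indic; exact: mc.
have Ic c : itg Q (\1_(A c)) by exact: (itg_bnd Q (mI c) (bI c)).
have sumI (h : C -> R) s : \sum_c h c * \1_(A c) s = h (code s).
  rewrite (bigD1 (code s))//= indicE mem_set// mulr1 big1 ?addr0// => c cs.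
  by rewrite indicE memNset ?mulr0// => E; rewrite E eqxx in cs.
have sum_ev (h : C -> R) : \sum_(i < m.+1) h (ev i) = \sum_c h c.
  rewrite (reindex (fun i : 'I_m.+1 => ev i))//.
  exists (fun c => cast_ord cm (enum_rank c)) => c _.
    by rewrite /ev enum_valK cast_ordKV.
  by rewrite /ev cast_ordK enum_rankK.
exists m, (fun i => xc (ev i)), (fun i => pc (ev i)); split.
- by move=> i; apply: Ex_ge0 => s; rewrite indicE.
- rewrite (sum_ev pc) -(Ex_cst Q 1) -Ex_sum//; congr (Ex Q _); apply/funext => s.
  by rewrite -(sumI (fun=> 1) s); apply: eq_bigr => c _; rewrite mul1r.
- move=> f e If fe.
  rewrite (sum_ev (fun c => pc c * f (xc c))).
  pose g s := \sum_c f (xc c) * \1_(A c) s.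
  have Ig : itg Q g by apply: itg_sum => c _; exact: itgZ.
  have -> : \sum_c pc c * f (xc c) = Ex Q g.
    rewrite /g Ex_sum; last by move=> c _; exact: itgZ.
    by apply: eq_bigr => c _; rewrite ExZ// mulrC.
  rewrite -ExB// -[leRHS](Ex_cst Q); apply: Ex_abs_le.
  + exact: itgB.
  + exact: itg_cst.
  + by move=> s; rewrite /g sumI fe.
Qed.

Section entropy.
Context (R : realType) d (S : measurableType d) (G : set (S -> R)) (b a v : R).
Hypothesis b0 : 0 < b.
Hypothesis a0 : 0 < a.
Hypothesis Gmeas : forall g, G g -> measurable_fun [set: S] g.
Hypothesis GVC : VC_type G b a v.

Let G' : choiceType := G.

Definition sqdist (Q : probability S R) (g h : G) : R :=
  Ex Q (fun s => (set_val g s - set_val h s) ^+ 2).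

Lemma G_meas (g : G) : measurable_fun setT (set_val g).
Proof. exact: Gmeas (set_valP g). Qed.

Lemma G_bnd (g : G) s : `|set_val g s| <= b.
Proof. exact: GVC.1 (set_valP g). Qed.

Lemma entropy_discrete m (x : 'I_m.+1 -> S) (p : 'I_m.+1 -> R) (tau : R) :
  (forall i, 0 <= p i) -> \sum_i p i = 1 -> 0 < tau < 1 ->
  exists (k : nat) (c : 'I_k -> G) (r : G -> 'I_k),
    k%:R <= 2 * (a / tau) `^ v /\
    forall g, \sum_i p i * (set_val g (x i) - set_val (c (r g)) (x i)) ^+ 2 <= b ^+ 2 * tau ^+ 2.
Proof.
move=> p0 p1 t01; have /andP[t0 t1] := t01.
have [Q [fQ QE]] := discrete_probability x p0 p1.
pose y := (a / tau) `^ v.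
have y0 : 0 < y by rewrite powR_gt0// divr_gt0.
(* The factor 2 makes the inequality strict, so that the infimum defining the covering number yields
   an actual cover. *)
have : (covering_number G Q (b * tau) < (2 * y)%:E)%E.
  apply: (@le_lt_trans _ _ y%:E); last by rewrite lte_fin; lra.
  apply: le_trans (GVC.2 _ t01); apply: ereal_sup_ubound.
  by exists Q.
move=> /ereal_inf_lt[_ [k [c [Gc cov]] <-]]; rewrite lte_fin => ky.
pose c' (i : 'I_k) : G := exist _ (c i) (mem_set (Gc i)).
have c'E i : set_val (c' i) = c i by [].
have /choice[r rP] : forall g : G, exists i, ('N[Q]_2%:E[EFin \o (set_val g \- c i)%R] <= (b * tau)%:E)%E.
  by move=> g; exact: cov (set_valP g).
exists k, c', r; split; first exact: ltW.
move=> g; rewrite c'E.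
set f := (fun s => (set_val g s - c (r g) s) ^+ 2).
have mf : measurable_fun setT f.
  by apply: measurable_funX; apply: measurable_funB; [exact: G_meas|exact: Gmeas].
have := QE f mf (fun s => sqr_ge0 _).
have -> : (\int[Q]_s (f s)%:E = 'N[Q]_2%:E[EFin \o (set_val g \- c (r g))%R] `^ 2)%E.
  rewrite powR_Lnorm ?pnatr_eq0//; apply: eq_integral => s _ /=.
  by rewrite powR_mulrn// real_normK// num_real.
move=> E; rewrite -lee_fin -E -exprMn -powR_mulrn; last by rewrite mulr_ge0// ltW.
rewrite -poweR_EFin; apply: gt0_ler_poweR => //.
- by rewrite in_itv/= Lnorm_ge0 leey.
- by rewrite in_itv/= leey andbT lee_fin mulr_ge0// ltW.
Qed.

Lemma sqdist_bnd (g h : G) s : `|(set_val g s - set_val h s) ^+ 2| <= 4 * b ^+ 2.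
Proof.
have hb : `|set_val g s - set_val h s| <= 2 * b.
  by rewrite mulr_natl mulr2n (le_trans (ler_normB _ _))// lerD// G_bnd.
rewrite normrX (_ : 4 * b ^+ 2 = (2 * b) ^+ 2); last by ring.
by rewrite ler_pXn2r ?nnegrE// mulr_ge0// ltW.
Qed.

Lemma sqdist_meas (g h : G) : measurable_fun setT (fun s => (set_val g s - set_val h s) ^+ 2).
Proof. by apply: measurable_funX; apply: measurable_funB; exact: G_meas. Qed.

Lemma sqdist_itg (Q : probability S R) (g h : G) :
  itg Q (fun s => (set_val g s - set_val h s) ^+ 2).
Proof. exact: (itg_bnd Q (sqdist_meas g h) (sqdist_bnd g h)). Qed.

Lemma sqrB_le (x y z : R) : (x - z) ^+ 2 <= 2 * (x - y) ^+ 2 + 2 * (y - z) ^+ 2.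
Proof.
have := sqr_ge0 ((x - y) - (y - z)).
by rewrite (_ : 2 * (x - y) ^+ 2 + 2 * (y - z) ^+ 2 = (x - z) ^+ 2 + ((x - y) - (y - z)) ^+ 2);
  [lra|ring].
Qed.

(** Quantization controls only the functions of the finite set [F], so each centre is replaced by a
    member of [F] in its cell. The constant 8 is 4 for the triangle inequality through the centre
    plus 4 for the quantization error [e]. *)
Lemma entropy_prob (Q : probability S R) (F : seq G') (tau : R) : 0 < tau < 1 ->
  exists pi : G' -> G',
    (forall g, g \in F -> sqdist Q g (pi g) <= 8 * b ^+ 2 * tau ^+ 2) /\
    (size (undup (map pi F)))%:R <= 2 * (a / tau) `^ v.
Proof.
move=> t01; have /andP[t0 t1] := t01.
pose e := 4 * b ^+ 2 * tau ^+ 2.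
have e0 : 0 < e by rewrite !mulr_gt0// exprn_gt0.
(* If two functions bounded by b each vary by at most eta, their squared difference varies by at
   most 2 eta times 4 b, that is [e]. *)
pose eta := e / (8 * b).
have eta0 : 0 < eta by rewrite divr_gt0// mulr_gt0.
pose N := (Num.truncn (2 * b / eta)).+1.
pose Y (i : 'I_(size F)) s := set_val (tnth (in_tuple F) i) s.
have YM i s : `|Y i s| <= b by exact: G_bnd.
have mY i : measurable_fun setT (Y i) by exact: G_meas.
have [m [x [p [p0 p1 close]]]] := @quantization R _ S Q _ _
  (fun c => @measurable_grid_code R _ N b eta _ S Y c mY).
have approx g h : g \in F -> h \in F ->
    sqdist Q g h <= \sum_i p i * (set_val g (x i) - set_val h (x i)) ^+ 2 + e.
  move=> gF hF; rewrite -lerBlDl.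
  apply: le_trans (ler_norm _) _.
  apply: (close (fun s => (set_val g s - set_val h s) ^+ 2)); first exact: sqdist_itg.
  move=> s s' E.
  have cl f : f \in F -> `|set_val f s - set_val f s'| <= eta.
    move=> /seq_tnthP[i ->].
    exact: (@grid_code_close R _ N b eta (Y ^~ s) (Y ^~ s') i eta0 (truncnS_gt _)).
  rewrite subr_sqr normrM (_ : e = (2 * eta) * (4 * b)); last by rewrite /eta; field; rewrite gt_eqF.
  apply: ler_pM => //.
    rewrite (_ : _ - _ - _ = (set_val g s - set_val g s') - (set_val h s - set_val h s')); last by ring.
    by rewrite mulr_natl mulr2n (le_trans (ler_normB _ _))// lerD// cl.
  rewrite (_ : 4 * b = (b + b) + (b + b)); last by ring.
  by apply: (le_trans (ler_normD _ _)); apply: lerD; apply: (le_trans (ler_normB _ _)); apply: lerD; exact: G_bnd.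
have [k [c [r [kN cr]]]] := entropy_discrete x p0 p1 t01.
pose rep i : G' := if [seq h : G' <- F | r h == i] is h :: _ then h else c i.
have repP g : g \in F -> rep (r g) \in F /\ r (rep (r g)) = r g.
  move=> gF; have : g \in [seq h : G' <- F | r h == r g] by rewrite mem_filter eqxx.
  rewrite /rep; case E : [seq h : G' <- F | r h == r g] => [|h s] // _.
  have : h \in [seq h : G' <- F | r h == r g] by rewrite E mem_head.
  by rewrite mem_filter => /andP[/eqP].
exists (fun g => rep (r g)); split.
  move=> g gF; have [repF rrep] := repP g gF.
  apply: (le_trans (approx _ _ gF repF)).
  have h1 := cr g; have h2 := cr (rep (r g)); rewrite rrep in h2.
  suff : \sum_i p i * (set_val g (x i) - set_val (rep (r g)) (x i)) ^+ 2 <=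
    2 * (\sum_i p i * (set_val g (x i) - set_val (c (r g)) (x i)) ^+ 2) +
    2 * (\sum_i p i * (set_val (rep (r g)) (x i) - set_val (c (r g)) (x i)) ^+ 2).
    have aux (A B C D : R) : A <= D -> B <= D -> C <= 2 * A + 2 * B -> C + 4 * D <= 8 * D.
      by move=> *; lra.
    by rewrite /e -(mulrA 4) -(mulrA 8); exact: aux h1 h2.
  rewrite !mulr_sumr -big_split/=; apply: ler_sum => i _.
  rewrite !(mulrCA 2 (p i)) -mulrDr ler_wpM2l//.
  rewrite -[(set_val (rep _) _ - _) ^+ 2]sqrrN opprB.
  exact: sqrB_le.
apply: le_trans kN; rewrite ler_nat.
have -> : k = size [seq rep i | i : 'I_k] by rewrite size_map size_enum_ord.
apply: uniq_leq_size; first exact: undup_uniq.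
by move=> g; rewrite mem_undup => /mapP[h _ ->]; apply: map_f; rewrite mem_enum.
Qed.

End entropy.

(** * The sample event *)

Lemma prob_union_seq (R : realType) d (W : measurableType d) (P : probability W R)
    (I : eqType) (s : seq I) (A : I -> set W) (e : R) : (forall i, measurable (A i)) ->
  (forall i, (P (A i) <= e%:E)%E) ->
  (P (\big[setU/set0]_(i <- s) A i) <= ((size s)%:R * e)%:E)%E.
Proof.
move=> mA Ae; elim: s => [|i s IH]; first by rewrite big_nil measure0 mul0r.
rewrite big_cons; apply: (le_trans (measureU2 _ _ _)) => //.
  by apply: bigsetU_measurable.
by rewrite /= -natr1 mulrDl mul1r addrC EFinD leeD.
Qed.

Definition emp (R : realType) (S : Type) n (x : n.-tuple S) (f : S -> R) : R :=
  (\sum_i f (tnth x i)) / n%:R.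

Section emp.
Context (R : realType) d (S : measurableType d) (n : nat).
Implicit Types f g : S -> R.

Lemma measurable_emp f : measurable_fun setT f -> measurable_fun setT (fun x : n.-tuple S => emp x f).
Proof.
move=> mf; apply: measurable_funM => //; apply: measurable_sum => i.
exact: (measurableT_comp mf (measurable_tnth i)).
Qed.

Lemma emp_le f g (x : n.-tuple S) : (forall s, f s <= g s) -> emp x f <= emp x g.
Proof. by move=> fg; rewrite ler_wpM2r ?invr_ge0//; apply: ler_sum. Qed.

Lemma empD f g (x : n.-tuple S) : emp x (fun s => f s + g s) = emp x f + emp x g.
Proof. by rewrite /emp big_split mulrDl. Qed.

Lemma empZ (c : R) f (x : n.-tuple S) : emp x (fun s => c * f s) = c * emp x f.
Proof. by rewrite /emp -mulr_sumr mulrA. Qed.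

Lemma emp_bnd f (M : R) (x : n.-tuple S) : (0 < n)%N -> (forall s, `|f s| <= M) -> `|emp x f| <= M.
Proof.
move=> n0 fM; rewrite /emp normrM normfV (ger0_norm (ler0n _ n)) ler_pdivrMr ?ltr0n//.
apply: (le_trans (ler_norm_sum _ _ _)); apply: (le_trans (ler_sum _ (fun i _ => fM _))).
by rewrite sumr_const card_ord mulr_natr.
Qed.
End emp.

Section numeric.
Context (R : realType) (b a v K : R) (n : nat).
Hypothesis ea : expR 1 <= a.
Hypothesis v1 : 1 <= v.
Hypothesis n4 : (4 <= n)%N.
Hypothesis Ka : 128 * (v * ln a) <= K.
Hypothesis Kn : 128 * (v * ln n%:R) <= K.

(** The entropy bound at the scale tau = 1 / sqrt n. Its logarithm is at most K / 32, so unions over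
    the net, over pairs of its points, or over the net and a cover are absorbed by the exponential
    bounds. *)
Definition net_size : R := 2 * (a / (Num.sqrt n%:R)^-1) `^ v.

Lemma sample_size_gt0 : 0 < n%:R :> R.
Proof. by rewrite ltr0n (leq_trans _ n4). Qed.

Let nR := sample_size_gt0.

Lemma scale_in01 : 0 < (Num.sqrt n%:R : R)^-1 < 1.
Proof.
have s0 : 0 < Num.sqrt n%:R :> R by rewrite sqrtr_gt0.
rewrite invr_gt0 s0/= invf_lt1// -(@ltr_pXn2r _ 2) ?nnegrE ?(ltW s0)// sqr_sqrtr ?ltW//.
by rewrite expr1n ltr1n (leq_trans _ n4).
Qed.

Lemma sqr_scale : (Num.sqrt n%:R)^-1 ^+ 2 = n%:R^-1 :> R.
Proof. by rewrite exprVn sqr_sqrtr// ltW. Qed.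

Lemma a_gt0 : 0 < a. Proof. exact: (lt_le_trans (expR_gt0 1)). Qed.

Lemma ln_a_ge1 : 1 <= ln a.
Proof. by rewrite -(expRK 1) ler_ln ?posrE ?expR_gt0// a_gt0. Qed.

Lemma K_ge128 : 128 <= K.
Proof.
apply: le_trans Ka; rewrite ler_peMr// -[leLHS]mulr1 ler_pM// ln_a_ge1 //.
Qed.

Lemma net_size_gt0 : 0 < net_size.
Proof.
by rewrite mulr_gt0// powR_gt0// invrK mulr_gt0 ?a_gt0// sqrtr_gt0.
Qed.

Lemma ln_net_size : ln net_size <= K / 32.
Proof.
have s0 : 0 < Num.sqrt n%:R :> R by rewrite sqrtr_gt0.
have ln2 : ln 2 <= 1 :> R.
  by rewrite -ler_expR lnK ?posrE//; have := expR_ge1Dx (1 : R); lra.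
have lns : ln (Num.sqrt n%:R) = ln n%:R / 2 :> R.
  have snn : Num.sqrt n%:R ^+ 2 = n%:R :> R by rewrite sqr_sqrtr// ltW.
  by rewrite -{2}snn lnXn// -[_ *+ 2]mulr_natr mulfK.
rewrite /net_size invrK lnM ?posrE//; last by rewrite powR_gt0// mulr_gt0// a_gt0.
rewrite ln_powR lnM ?posrE ?a_gt0// lns mulrDr mulrA.
move: Ka Kn K_ge128; move: (v * ln a) (v * ln n%:R) => *; lra.
Qed.

Lemma net_size_le : net_size <= expR (K / 32).
Proof. by rewrite -[leLHS]lnK ?posrE ?net_size_gt0// ler_expR ln_net_size. Qed.

Lemma n_le_expK : n%:R <= expR K.
Proof.
rewrite -[leLHS]lnK ?posrE// ler_expR.
have l0 : 0 <= ln n%:R :> R by rewrite ln_ge0// ler1n (leq_trans _ n4).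
have : ln n%:R <= v * ln n%:R by rewrite ler_peMl.
by move: Kn l0; move: (ln n%:R : R) (v * _) => *; lra.
Qed.

End numeric.

Section net.
Context (R : realType) d (S : measurableType d) (G : set (S -> R)) (b a v : R) (n : nat).
Hypothesis b0 : 0 < b.
Hypothesis ea : expR 1 <= a.
Hypothesis n4 : (4 <= n)%N.
Hypothesis Gmeas : forall g, G g -> measurable_fun [set: S] g.
Hypothesis GVC : VC_type G b a v.
Variable (Q : probability S R).

Let a0 := a_gt0 ea.
Let nR := @sample_size_gt0 R n n4.

Lemma sqdistC (g h : G) : sqdist Q g h = sqdist Q h g.
Proof. by congr (Ex Q _); apply/funext => s; rewrite -[LHS]sqrrN opprB. Qed.

Lemma sqdist_tri (g h k : G) : sqdist Q g k <= 2 * sqdist Q g h + 2 * sqdist Q h k.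
Proof.
have I := sqdist_itg b0 Gmeas GVC Q.
rewrite /sqdist -!ExZ// -ExD; [|exact: itgZ..].
apply: Ex_le => //; first by apply: itgD; exact: itgZ.
by move=> s; exact: sqrB_le.
Qed.

(** A separated family of maximal size is a net. Its size is bounded because two members with the
    same projection in [entropy_prob] would be within 2 * 8 + 2 * 8 = 32 times b^2 / n. This detour
    produces a net of all of [G] although [entropy_prob] treats only finite subsets. *)
Lemma separated_net : exists T : seq G, (size T)%:R <= net_size a v n /\
  forall g : G, exists2 t, t \in T & sqdist Q g t <= 32 * b ^+ 2 / n%:R.
Proof.
pose sep (F : seq G) := forall g h, g \in F -> h \in F -> g != h ->
  32 * b ^+ 2 / n%:R < sqdist Q g h.
have sepN F : uniq F -> sep F -> (size F)%:R <= net_size a v n.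
  move=> uF sF.
  have [pi [Dpi Npi]] := entropy_prob b0 a0 Gmeas GVC Q F (scale_in01 R n4).
  suff E : uniq (map pi F).
    by move: Npi; rewrite undup_id// size_map.
  rewrite map_inj_in_uniq// => g h gF hF pgh; apply/eqP/negPn/negP => gh.
  have := sF g h gF hF gh; rewrite ltNge => /negP; apply.
  apply: (le_trans (sqdist_tri g (pi g) h)).
  have h1 := Dpi g gF; have := Dpi h hF; rewrite -pgh sqdistC => h2.
  move: h1 h2; rewrite sqr_scale//.
  rewrite -!mulrA; move: (b ^+ 2 * n%:R^-1) => q h1 h2.
  by apply: (le_trans (lerD (ler_wpM2l _ h1) (ler_wpM2l _ h2))) => //; lra.
pose Pk k := `[< exists F : seq G, [/\ uniq F, sep F & size F = k] >].
have P0 : exists k, Pk k by exists 0%N; apply/asboolP; exists [::].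
have Pb k : Pk k -> (k <= Num.truncn (net_size a v n))%N.
  move=> /asboolP[F [uF sF <-]]; rewrite truncn_ge_nat ?sepN//.
  exact: ltW (net_size_gt0 v ea n4).
case: (ex_maxnP P0 Pb) => k.
move=> /asboolP[F [uF sF kF]] kmax.
exists F; split; first exact: sepN.
move=> g; apply: contrapT => H.
have far t : t \in F -> 32 * b ^+ 2 / n%:R < sqdist Q g t.
  by move=> tF; rewrite ltNge; apply/negP => gt; apply: H; exists t.
have gF : g \notin F.
  apply/negP => /far; rewrite /sqdist (_ : (fun s => _) = cst 0); last first.
    by apply/funext => s; rewrite subrr expr0n.
  by rewrite Ex_cst ltNge divr_ge0// mulr_ge0// ?sqr_ge0.
have : (k.+1 <= k)%N; last by rewrite ltnn.
apply: kmax; apply/asboolP; exists (g :: F); split => /=.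
- by rewrite gF.
- move=> g1 g2; rewrite !inE => /orP[/eqP->|g1F] /orP[/eqP->|g2F].
  + by rewrite eqxx.
  + by move=> _; exact: far.
  + by move=> _; rewrite sqdistC; exact: far.
  + exact: sF.
- by rewrite kF.
Qed.

End net.

Section swaps.
Context (R : realType) (n : nat).

Lemma expR_quad (y : R) : `|y| <= 1 / 2 -> expR y <= 1 + y + 2 * y ^+ 2.
Proof.
move=> y1.
have e2 : expR (1 / 2) <= 2 :> R.
  have E : expR (1 / 2) * expR (- (1 / 2)) = 1 :> R by rewrite -expRD subrr expR0.
  have h : 1 / 2 <= expR (- (1 / 2)) :> R by have := expR_ge1Dx (- (1 / 2) : R); lra.
  have := ler_wpM2l (expR_ge0 (1 / 2 : R)) h; rewrite E; move: (expR (1 / 2) : R) => *; lra.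
have := expR_taylor2 y; rewrite ler_norml => /andP[_].
have : `|y| ^+ 2 * expR `|y| <= 2 * y ^+ 2.
  rewrite real_normK ?num_real// mulrC ler_wpM2r ?sqr_ge0//.
  by apply: le_trans e2; rewrite ler_expR.
by move: (2 * y ^+ 2) (_ * expR _) (expR y) => *; lra.
Qed.

(** The first-order terms add up to -3/4 (u + w), which outweighs the quadratic terms when u and w
    are at most 1/4. *)
Lemma swap_factor (u w : R) : 0 <= u <= 1 / 4 -> 0 <= w <= 1 / 4 ->
  expR (u / 4 - w) + expR (w / 4 - u) <= 2.
Proof.
move=> /andP[u0 u1] /andP[w0 w1].
have h1 : `|u / 4 - w| <= 1 / 2 by rewrite ler_norml; apply/andP; split; lra.
have h2 : `|w / 4 - u| <= 1 / 2 by rewrite ler_norml; apply/andP; split; lra.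
apply: (le_trans (lerD (expR_quad h1) (expR_quad h2))).
have : u * u <= 1 / 4 * u by rewrite ler_wpM2r.
have : w * w <= 1 / 4 * w by rewrite ler_wpM2r.
have : 0 <= u * w by rewrite mulr_ge0.
rewrite (_ : (u / 4 - w) ^+ 2 = u * u / 16 + w * w - u * w / 2); last by field.
rewrite (_ : (w / 4 - u) ^+ 2 = w * w / 16 + u * u - u * w / 2); last by field.
by move: (u * u) (w * w) (u * w) => *; lra.
Qed.

(* For [w] a ghost copy of [u], swapping coordinates preserves the joint law, so
   this bounds the exponential moment of [\sum_i (u i / 4 - w i)]. *)
Lemma swap_average (u w : 'I_n -> R) : (forall i, 0 <= u i <= 1 / 4) -> (forall i, 0 <= w i <= 1 / 4) ->
  \sum_(sg : {ffun 'I_n -> bool})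
    expR (\sum_i ((if sg i then w i else u i) / 4 - (if sg i then u i else w i))) <= 2 ^+ n.
Proof.
move=> u01 w01.
rewrite (eq_bigr (fun sg : {ffun 'I_n -> bool} => \prod_i
   (fun i (e : bool) => expR ((if e then w i else u i) / 4 - (if e then u i else w i))) i (sg i))); last first.
  by move=> sg _; rewrite expR_sum.
rewrite -(bigA_distr_bigA (fun i (e : bool) => expR ((if e then w i else u i) / 4 - (if e then u i else w i)))).
apply: (@le_trans _ _ (\prod_(i < n) 2)); last by rewrite prodr_const card_ord.
apply: ler_prod => i _; rewrite big_bool/= addr_ge0 ?expR_ge0//= addrC.
exact: swap_factor.
Qed.

End swaps.

Section event.
Context (R : realType) dS (S : measurableType dS) (G : set (S -> R)) (b a v K sigma : R) (n : nat).
Hypothesis b0 : 0 < b.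
Hypothesis ea : expR 1 <= a.
Hypothesis v1 : 1 <= v.
Hypothesis n4 : (4 <= n)%N.
Hypothesis Gmeas : forall g, G g -> measurable_fun [set: S] g.
Hypothesis GVC : VC_type G b a v.
Hypothesis Ka : 128 * (v * ln a) <= K.
Hypothesis Kn : 128 * (v * ln n%:R) <= K.
Hypothesis sigma0 : 0 < sigma.
Hypothesis bK : b ^+ 2 * K <= n%:R * sigma ^+ 2.

Let a0 := a_gt0 ea.
Let nR := @sample_size_gt0 R n n4.
Let K128 := K_ge128 ea v1 Ka.
Let b20 : 0 < b ^+ 2. Proof. exact: exprn_gt0. Qed.

Definition sqd (g h : G) (s : S) : R := (set_val g s - set_val h s) ^+ 2.

Let sqd0 g h s : 0 <= sqd g h s. Proof. exact: sqr_ge0. Qed.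
Let sqd_bnd g h s : sqd g h s <= 4 * b ^+ 2.
Proof. exact: le_trans (ler_norm _) (sqdist_bnd b0 GVC g h s). Qed.
Let sqd_meas g h : measurable_fun setT (sqd g h). Proof. exact: sqdist_meas. Qed.
Let sqdC g h s : sqd g h s = sqd h g s. Proof. by rewrite /sqd -sqrrN opprB. Qed.
Let sqd_tri g h k s : sqd g k s <= 2 * sqd g h s + 2 * sqd h k s.
Proof. exact: sqrB_le. Qed.

Let entropy_points m (x : 'I_m -> S) : (0 < m)%N ->
  exists (k : nat) (c : 'I_k -> G) (r : G -> 'I_k), k%:R <= net_size a v n /\
    forall g, \sum_i sqd g (c (r g)) (x i) <= m%:R * (b ^+ 2 / n%:R).
Proof.
case: m x => // m x _.
have mR : 0 < m.+1%:R :> R by rewrite ltr0n.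
have [|||k [c [r [kN H]]]] := @entropy_discrete R _ S G b a v b0 a0 Gmeas GVC m x (fun=> m.+1%:R^-1) (Num.sqrt n%:R)^-1.
- by move=> i; rewrite invr_ge0.
- by rewrite sumr_const card_ord -(mulr_natr m.+1%:R^-1) mulVf// gt_eqF.
- exact: scale_in01.
exists k, c, r; split => // g.
have := H g; rewrite -mulr_sumr sqr_scale// -ler_pdivlMl ?invr_gt0// invrK.
by rewrite mulrA.
Qed.

Let sel (sg : 'I_n -> bool) (z : n.-tuple (S * S)) i := if sg i then (tnth z i).2 else (tnth z i).1.

(** [sel sg] reads off the first sample after the exchange [sg], and the negation of [sg] reads off
    the second. In a bad exchange some function is far from a net point on the first sample and near
    it on the second; the thresholds are n times [s1] and [s2] below. *)
Let bad (T : seq G) (z : n.-tuple (S * S)) (sg : {ffun 'I_n -> bool}) : Prop :=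
  exists h : G, exists2 t, t \in T &
    320 * b ^+ 2 * K < \sum_i sqd h t (sel sg z i) /\
    \sum_i sqd h t (sel (fun i => ~~ sg i) z i) <= 128 * b ^+ 2.

(** For a fixed double sample the class reduces to at most [net_size] centres, every function being
    within total squared distance 2 b^2 of its centre on both samples together. A bad exchange makes
    [ex] at least 2 K for some centre and net point, whereas the mean of e^ex over exchanges is at
    most 1 by [swap_average]. The union over at most e^(K/16) pairs leaves e^(-3K/2). *)
Let swap_count (T : seq G) z : (size T)%:R <= net_size a v n ->
  \sum_(sg : {ffun 'I_n -> bool}) (`[< bad T z sg >])%:R <= 2 ^+ n * expR (- (3 / 2 * K)).
Proof.
move=> TN.
have n0 : (0 < n)%N by exact: leq_trans n4.
have [|k [c [r [kN H]]]] := @entropy_points (n + n)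
  (fun j => match fintype.split j with inl i => (tnth z i).1 | inr i => (tnth z i).2 end).
  by rewrite addn_gt0 n0.
have near g : \sum_i sqd g (c (r g)) (tnth z i).1 + \sum_i sqd g (c (r g)) (tnth z i).2 <= 2 * b ^+ 2.
  have := H g; rewrite big_split_ord/=.
  under eq_bigr do rewrite (unsplitK (inl _)).
  under [X in _ + X]eq_bigr do rewrite (unsplitK (inr _)).
  rewrite natrD (_ : (n%:R + n%:R) * (b ^+ 2 / n%:R) = 2 * b ^+ 2)//.
  by field; rewrite gt_eqF.
have nearS g (sg : 'I_n -> bool) : \sum_i sqd g (c (r g)) (sel sg z i) <= 2 * b ^+ 2.
  apply: le_trans (near g); rewrite -big_split/=; apply: ler_sum => i _.
  by rewrite /sel; case: (sg i); rewrite ?lerDl ?lerDr.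
(* As squared differences are at most 4 b^2, this scaling puts them in [0, 1/4], the range required
   by [swap_average]. *)
pose lam := (16 * b ^+ 2)^-1.
have lam0 : 0 < lam by rewrite invr_gt0 mulr_gt0.
pose u (j : 'I_k) (t : G) i := lam * sqd (c j) t (tnth z i).1.
pose w (j : 'I_k) (t : G) i := lam * sqd (c j) t (tnth z i).2.
have u01 j t s : 0 <= lam * sqd (c j) t s <= 1 / 4.
  rewrite mulr_ge0 ?(ltW lam0)//= /lam mulrC ler_pdivrMr ?mulr_gt0//.
  by rewrite (_ : 1 / 4 * _ = 4 * b ^+ 2)//; field.
pose ex j t (sg : {ffun 'I_n -> bool}) :=
  \sum_i ((if sg i then w j t i else u j t i) / 4 - (if sg i then u j t i else w j t i)).
have avg j t : \sum_(sg : {ffun 'I_n -> bool}) expR (ex j t sg) <= 2 ^+ n.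
  by apply: swap_average => i; exact: u01.
apply: (@le_trans _ _ (\sum_(sg : {ffun 'I_n -> bool}) \sum_j \sum_(t <- T) expR (- (2 * K)) * expR (ex j t sg))).
  apply: ler_sum => sg _; case: asboolP => [[h [t tT [hU hV]]]|_]; last first.
    by do 2 (apply: sumr_ge0 => ? _); rewrite mulr_ge0 ?expR_ge0.
  set U := \sum_i _ in hU; set V := \sum_i _ in hV.
  pose j := r h.
  have e1 : (320 * b ^+ 2 * K - 4 * b ^+ 2) / 2 <= \sum_i sqd (c j) t (sel sg z i).
    have : U <= 2 * (\sum_i sqd h (c j) (sel sg z i)) + 2 * (\sum_i sqd (c j) t (sel sg z i)).
      by rewrite !mulr_sumr -big_split; apply: ler_sum => i _; exact: sqd_tri.
    have := nearS h sg; rewrite -/j; move: hU.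
    move: U (\sum_i _) (\sum_i _) => x y y'; move: (320 * b ^+ 2 * K) (b ^+ 2) => *; lra.
  have e2 : \sum_i sqd (c j) t (sel (fun i => ~~ sg i) z i) <= 260 * b ^+ 2.
    have : \sum_i sqd (c j) t (sel (fun i => ~~ sg i) z i) <=
        2 * (\sum_i sqd h (c j) (sel (fun i => ~~ sg i) z i)) + 2 * V.
      rewrite !mulr_sumr -big_split; apply: ler_sum => i _.
      by rewrite [sqd h (c j) _]sqdC; exact: sqd_tri.
    have := nearS h (fun i => ~~ sg i); rewrite -/j; move: hV.
    move: V (\sum_i _) (\sum_i _) => x y y'; move: (b ^+ 2) => *; lra.
  have e3 : 2 * K <= ex j t sg.
    rewrite (_ : ex j t sg = lam * ((\sum_i sqd (c j) t (sel sg z i)) / 4 -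
       \sum_i sqd (c j) t (sel (fun i => ~~ sg i) z i))); last first.
      rewrite mulr_suml -sumrB mulr_sumr; apply: eq_bigr => i _.
      by rewrite /sel/= /u /w; case: (sg i); rewrite /= mulrBr (mulrA lam _ 4^-1).
    rewrite /lam ler_pdivlMl ?mulr_gt0//.
    have : 128 * b ^+ 2 <= K * b ^+ 2 by rewrite ler_wpM2r// ltW.
    move: e1 e2; rewrite (_ : 16 * b ^+ 2 * (2 * K) = 32 * (K * b ^+ 2)); last by ring.
    rewrite (_ : 320 * b ^+ 2 * K = 320 * (K * b ^+ 2)); last by ring.
    move: (K * b ^+ 2) (b ^+ 2) (\sum_i _) (\sum_i _) b20 => *; lra.
  rewrite (bigD1 j)//= (big_rem t)//= -addrA.
  apply: (@le_trans _ _ (expR (- (2 * K)) * expR (ex j t sg))).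
    by rewrite -expRD -[leLHS]expR0 ler_expR addrC subr_ge0.
  rewrite lerDl addr_ge0//; first by apply: sumr_ge0 => ? _; rewrite mulr_ge0 ?expR_ge0.
  by do 2 (apply: sumr_ge0 => ? _); rewrite mulr_ge0 ?expR_ge0.
rewrite exchange_big/=.
under eq_bigr do rewrite exchange_big/=.
apply: (@le_trans _ _ (\sum_(j < k) \sum_(t <- T) expR (- (2 * K)) * 2 ^+ n)).
  apply: ler_sum => j _; apply: ler_sum => t _.
  by rewrite -mulr_sumr ler_wpM2l ?expR_ge0.
have E (q : R) : \sum_(j < k) \sum_(t <- T) q = q * ((size T)%:R * k%:R).
  by rewrite sumr_const card_ord big_const_seq count_predT iter_addr_0 -mulrnA -(mulr_natr q) natrM.
rewrite E.
rewrite [leRHS]mulrC [leLHS]mulrAC ler_wpM2r ?exprn_ge0//.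
apply: (@le_trans _ _ (expR (- (2 * K)) * (expR (K / 32) * expR (K / 32)))).
  rewrite ler_wpM2l ?expR_ge0// ler_pM//.
    by apply: (le_trans TN); exact: net_size_le.
  by apply: (le_trans kN); exact: net_size_le.
by rewrite -!expRD ler_expR; move: K128 => *; lra.
Qed.

Context dO (Omega : measurableType dO) (P : probability Omega R) (X : 'I_n -> Omega -> S)
  (Q : probability S R).
Hypothesis mX : forall i, measurable_fun setT (X i).
Hypothesis iX : mutually_independent P X.
Hypothesis lX : forall i, same_law P (X i) Q id.

Let mrX : measurable_fun setT (rvec X). Proof. exact: rvec_measurable. Qed.

Let Ex_X i (f : S -> R) : measurable_fun setT f -> Ex P (fun w => f (X i w)) = Ex Q f.
Proof. by move=> mf; exact: (same_law_Ex (mX i) (@measurable_id _ S setT) (lX i) mf). Qed.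

Let itg_emp (f : S -> R) (M : R) : measurable_fun setT f -> (forall s, `|f s| <= M) ->
  itg P (fun w => emp (rvec X w) f).
Proof.
move=> mf fM; apply: (@itg_bnd _ _ _ _ _ M).
  by apply: (measurableT_comp (f := fun x : n.-tuple S => emp x f)) => //; exact: measurable_emp.
by move=> w; apply: emp_bnd => //; exact: leq_trans n4.
Qed.

Let Ex_emp (f : S -> R) (M : R) : measurable_fun setT f -> (forall s, `|f s| <= M) ->
  Ex P (fun w => emp (rvec X w) f) = Ex Q f.
Proof.
move=> mf fM.
have I i : itg P (fun w => f (X i w)).
  by apply: (@itg_bnd _ _ _ _ _ M) => //; exact: measurableT_comp.
rewrite (_ : (fun w => _) = (fun w => n%:R^-1 * \sum_i f (X i w))); last first.
  by apply/funext => w; rewrite /emp mulrC; congr (_ * _); apply: eq_bigr => i _; rewrite tnth_mktuple.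
rewrite ExZ; last exact: itg_sum.
rewrite Ex_sum// (eq_bigr (fun=> Ex Q f)) => [|i _]; last exact: Ex_X.
by rewrite sumr_const card_ord -(mulr_natl (Ex Q f)) mulKf// gt_eqF.
Qed.

Let s1 := 320 * b ^+ 2 * K / n%:R.
Let s2 := 128 * b ^+ 2 / n%:R.
(** The pairs are confined to a finite list to keep the events measurable; an increasing union over
    lists is taken in [sample_event]. *)
Let A (L : seq (G * G)) : set (n.-tuple S) :=
  [set x | exists2 q, q \in L & s1 < emp x (sqd q.1 q.2)].
Let C (L : seq (G * G)) : set (n.-tuple (S * S)) :=
  [set z | exists2 q, q \in L & s1 < emp (map_tuple fst z) (sqd q.1 q.2) /\
                               emp (map_tuple snd z) (sqd q.1 q.2) <= s2].

Let mA L : measurable (A L).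
Proof.
rewrite (_ : A L = \bigcup_(q in [set` L]) [set x | s1 < emp x (sqd q.1 q.2)]); last first.
  by apply/seteqP; split => x [q]; exists q.
apply: fin_bigcup_measurable => // q _; apply: measurable_gt_set.
exact: measurable_emp.
Qed.

Let mC L : measurable (C L).
Proof.
rewrite (_ : C L = \bigcup_(q in [set` L]) ([set z | s1 < emp (map_tuple fst z) (sqd q.1 q.2)] `\`
    [set z | s2 < emp (map_tuple snd z) (sqd q.1 q.2)])); last first.
  apply/seteqP; split => x [q qL] [h1 h2]; exists q => //; split => //.
    by apply/negP; rewrite -leNgt.
  by move/negP: h2; rewrite -leNgt.
have mt (p : S * S -> S) : measurable_fun setT p -> measurable_fun setT (@map_tuple n _ _ p).
  move=> mp; apply/measurable_fun_tnthP => i.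
  rewrite (_ : _ \o _ = (fun z => p (tnth z i))); last by apply/funext => z; rewrite /= tnth_map.
  exact: (measurableT_comp mp (measurable_tnth i)).
apply: fin_bigcup_measurable => // q _; apply: measurableD; apply: measurable_gt_set.
  apply: (measurableT_comp (f := fun x : n.-tuple S => emp x (sqd q.1 q.2)) (g := map_tuple fst)).
    exact: measurable_emp.
  by apply: mt; exact: measurable_fst.
apply: (measurableT_comp (f := fun x : n.-tuple S => emp x (sqd q.1 q.2)) (g := map_tuple snd)).
    exact: measurable_emp.
  by apply: mt; exact: measurable_snd.
Qed.

Let indic_bnd (W : Type) (B : set W) w : `|\1_B w : R| <= 1.
Proof. by rewrite indicE; case: (_ \in _); rewrite ?normr1 ?normr0. Qed.

Let Z sg := rvec (fun i (z : Omega * Omega) =>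
  if sg i then (X i z.2, X i z.1) else (X i z.1, X i z.2)).

Let ZE sg z i : tnth (Z sg z) i = if sg i then (X i z.2, X i z.1) else (X i z.1, X i z.2).
Proof. exact: tnth_mktuple. Qed.

Let mZ sg : measurable_fun setT (Z sg).
Proof.
apply: rvec_measurable => i.
have m1 : measurable_fun setT (fun z : Omega * Omega => X i z.1) by exact: measurableT_comp.
have m2 : measurable_fun setT (fun z : Omega * Omega => X i z.2) by exact: measurableT_comp.
by case: (sg i); exact: measurable_fun_pair.
Qed.

(** Markov's inequality makes the ghost sample good for a given pair with probability at least 1/2,
    since [s2] is twice the bound on the mean. This gives the factor 2 in front of the probability
    of [C L]. That probability is invariant under exchanges of the two samples, so it is at most the
    mean over exchanges, bounded pointwise by [swap_count]. *)
Let ghost L (T : seq G) : (size T)%:R <= net_size a v n ->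
  (forall q, q \in L -> q.2 \in T /\ sqdist Q q.1 q.2 <= 64 * b ^+ 2 / n%:R) ->
  (P (rvec X @^-1` A L) <= (2 * expR (- (3 / 2 * K)))%:E)%E.
Proof.
move=> TN LT.
have mXA : measurable (rvec X @^-1` A L) by exact: measurable_preimT.
have mI1 : measurable_fun setT (\1_(rvec X @^-1` A L) : Omega -> R) by exact: measurable_indic.
have mIC : measurable_fun setT (\1_(C L) : _ -> R) by apply: measurable_indic.
pose Z0 := Z (fun=> false).
have mIZ sg : measurable_fun setT (fun z => \1_(C L) (Z sg z) : R) by exact: (measurableT_comp mIC).
have half : 1 / 2 * Ex P (\1_(rvec X @^-1` A L)) <= Ex (prodP P P) (fun z => \1_(C L) (Z0 z)).
  rewrite (@Ex_fubini _ _ _ _ _ _ _ _ 1) => [||z]; [|exact: mIZ|exact: indic_bnd].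
  rewrite -ExZ; last exact: (itg_bnd P mI1 (indic_bnd _)).
  apply: Ex_le.
  - by apply: itgZ; exact: (itg_bnd P mI1 (indic_bnd _)).
  - apply: (@itg_bnd _ _ _ _ _ 1) => [|w].
      exact: (measurable_Ex_section P P (mIZ _) (fun z => indic_bnd _ _)).
    apply: Ex_bnd => [|w']; last exact: indic_bnd.
    exact: (measurableT_comp (mIZ (fun=> false)) (measurable_pair1 w)).
  - move=> w; have [[q qL qw]|nA] := pselect (A L (rvec X w)); last first.
      by rewrite indicE memNset// mulr0; apply: Ex_ge0 => w'; rewrite indicE.
    have -> : \1_(rvec X @^-1` A L) w = 1 :> R by rewrite indicE mem_set//; exists q.
    rewrite mulr1.
    have [qT qD] := LT q qL.
    have Ie : itg P (fun w => emp (rvec X w) (sqd q.1 q.2)).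
      exact: (itg_emp (sqd_meas _ _) (sqdist_bnd b0 GVC _ _)).
    have Ee : Ex P (fun w => emp (rvec X w) (sqd q.1 q.2)) <= s2 / 2.
      rewrite (Ex_emp (sqd_meas _ _) (sqdist_bnd b0 GVC _ _)).
      by apply: (le_trans qD); rewrite /s2 le_eqVlt; apply/orP; left; apply/eqP; field; rewrite gt_eqF.
    have s20 : 0 < s2 by rewrite divr_gt0// mulr_gt0.
    apply: (@le_trans _ _ (Ex P (fun w' => 1 - s2^-1 * emp (rvec X w') (sqd q.1 q.2)))).
      rewrite ExB; [|exact: itg_cst|exact: itgZ].
      rewrite Ex_cst ExZ//.
      have : s2^-1 * Ex P (fun w => emp (rvec X w) (sqd q.1 q.2)) <= s2^-1 * (s2 / 2).
        by rewrite ler_pM2l ?invr_gt0.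
      by rewrite mulKf ?gt_eqF//; move: (s2^-1 * _) => *; lra.
    apply: Ex_le.
    + by apply: itgB; [exact: itg_cst|exact: itgZ].
    + apply: (@itg_bnd _ _ _ _ _ 1) => [|w']; last exact: indic_bnd.
      exact: (measurableT_comp (mIZ (fun=> false)) (measurable_pair1 w)).
    + move=> w'.
      have emp0 : 0 <= emp (rvec X w') (sqd q.1 q.2).
        by rewrite /emp divr_ge0//; apply: sumr_ge0.
      have [small|large] := leP (emp (rvec X w') (sqd q.1 q.2)) s2; last first.
        apply: (@le_trans _ _ 0); last by rewrite indicE.
        by rewrite subr_le0 -[leLHS](mulVf (lt0r_neq0 s20)) ler_pM2l ?invr_gt0// ltW.
      have -> : \1_(C L) (Z0 (w, w')) = 1 :> R; last by rewrite gerBl mulr_ge0// invr_ge0 ltW.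
      rewrite indicE mem_set//; exists q => //; split.
        rewrite (_ : map_tuple _ _ = rvec X w)//; apply: eq_from_tnth => i.
        by rewrite tnth_map !tnth_mktuple.
      rewrite (_ : map_tuple _ _ = rvec X w')//; apply: eq_from_tnth => i.
      by rewrite tnth_map !tnth_mktuple.
have swap : 2 ^+ n * Ex (prodP P P) (fun z => \1_(C L) (Z0 z)) <= 2 ^+ n * expR (- (3 / 2 * K)).
  have E (sg : {ffun 'I_n -> bool}) : Ex (prodP P P) (fun z => \1_(C L) (Z0 z)) =
      Ex (prodP P P) (fun z => \1_(C L) (Z sg z)).
    exact: (esym (same_law_Ex (mZ sg) (mZ (fun=> false)) (same_law_swap sg mX iX) mIC)).
  have -> : 2 ^+ n * Ex (prodP P P) (fun z => \1_(C L) (Z0 z)) =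
      \sum_(sg : {ffun 'I_n -> bool}) Ex (prodP P P) (fun z => \1_(C L) (Z sg z)).
    rewrite (eq_bigr (fun=> Ex (prodP P P) (fun z => \1_(C L) (Z0 z)))) => [|sg _]; last by rewrite -E.
    by rewrite sumr_const card_ffun card_bool card_ord -[RHS]mulr_natl natrX.
  have II sg : itg (prodP P P) (fun z => \1_(C L) (Z sg z)).
    by apply: (@itg_bnd _ _ _ _ _ 1) => // z; exact: indic_bnd.
  rewrite -Ex_sum; last by move=> sg _; exact: II.
  rewrite -[leRHS](Ex_cst (prodP P P)); apply: Ex_le.
  - by apply: itg_sum => sg _; exact: II.
  - exact: itg_cst.
  - move=> z; apply: le_trans (swap_count (Z0 z) TN); apply: ler_sum => sg _.
    rewrite indicE; have [[q qL [q1 q2]]|nC] := pselect (C L (Z sg z)); last by rewrite memNset.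
    have -> : Z sg z \in C L by apply: mem_set; exists q.
    suff B : bad T (Z0 z) sg by rewrite (asboolT B).
    exists q.1, q.2; first exact: (LT q qL).1.
    have E1 i : sel sg (Z0 z) i = tnth (map_tuple fst (Z sg z)) i.
      by rewrite (tnth_map fst) /sel !ZE; case: (sg i).
    have E2 i : sel (fun i => ~~ sg i) (Z0 z) i = tnth (map_tuple snd (Z sg z)) i.
      by rewrite (tnth_map snd) /sel !ZE; case: (sg i).
    split.
      under eq_bigr do rewrite E1.
      by move: q1; rewrite /s1 /emp ltr_pM2r ?invr_gt0.
    under eq_bigr do rewrite E2.
    by move: q2; rewrite /s2 /emp ler_pM2r ?invr_gt0.
rewrite -(Ex_indic _ mXA) lee_fin.
move: swap; rewrite ler_pM2l ?exprn_gt0// => swap.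
by move: (le_trans half swap); move: (Ex P _) (expR _) => *; lra.
Qed.

Hypothesis Qsig : forall g : G, Ex Q (fun s => set_val g s ^+ 2) <= sigma ^+ 2.
Hypothesis GPM : pointwise_measurable G.

Let Gm (g : G) : measurable_fun setT (set_val g). Proof. exact: G_meas. Qed.
Let Gb (g : G) s : `|set_val g s| <= b. Proof. exact: (G_bnd GVC). Qed.

Let dev (f : S -> R) (c : R) : set (n.-tuple S) := [set x | c < `|emp x f - Ex Q f|].

Let dev_meas f c : measurable_fun setT f -> measurable (dev f c).
Proof.
move=> mf; apply: measurable_gt_set; apply: measurableT_comp => //.
by apply: measurable_funB => //; exact: measurable_emp.
Qed.

Let dev_prob (f : S -> R) (M s : R) : measurable_fun setT f -> (forall y, `|f y| <= M) ->
  Ex Q (fun y => f y ^+ 2) <= s ^+ 2 -> 0 < s -> M ^+ 2 * K <= n%:R * s ^+ 2 ->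
  (P (rvec X @^-1` dev f (8 * s * Num.sqrt (K / n%:R))) <= (2 * expR (- 3 * K))%:E)%E.
Proof.
move=> mf fM fs s0 MK.
have n0 : (0 < n)%N by exact: leq_trans n4.
have K0 : 0 < K by exact: lt_le_trans K128.
have m1 i : measurable_fun setT (fun w => f (X i w)) by exact: measurableT_comp.
have i1 : mutually_independent P (fun i w => f (X i w)) by exact: (mutually_independent_comp mf iX).
have m2 : measurable_fun setT (fun y => f y ^+ 2) by exact: measurable_funX.
have f2 i : Ex P (fun w => f (X i w) ^+ 2) <= s ^+ 2 by rewrite (Ex_X i m2).
have := bernstein n0 m1 i1 (fun i w => fM _) (fun i => Ex_X i mf) f2 s0 K0 MK.
congr (P _ <= _)%E.
have E w : emp (rvec X w) f = (\sum_i f (X i w)) / n%:R.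
  by rewrite /emp; congr (_ / _); apply: eq_bigr => i _; rewrite tnth_mktuple.
by apply/seteqP; split => w; rewrite /dev /= E.
Qed.

Let limit_sqd (h : nat -> G) (g t : G) s : (fun m => set_val (h m) s) @ \oo --> set_val g s ->
  (fun m => sqd (h m) t s) @ \oo --> sqd g t s.
Proof.
move=> hg; rewrite /sqd expr2.
under eq_fun do rewrite expr2.
by apply: cvgM; (apply: cvgB => //; exact: cvg_cst).
Qed.

Lemma sample_event (g0 : G) : exists (S0 : set (n.-tuple S)) (T : seq G),
  [/\ measurable S0, ((1 - 3 / n%:R)%:E <= P (rvec X @^-1` S0))%E,
      (size T)%:R <= net_size a v n &
  forall x, S0 x ->
    (forall s t, s \in T -> t \in T ->
      `|(emp x (fun y => set_val s y * set_val t y) - emp x (set_val s) * emp x (set_val t)) -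
        (Ex Q (fun y => set_val s y * set_val t y) - Ex Q (set_val s) * Ex Q (set_val t))| <=
      24 * b * sigma * Num.sqrt (K / n%:R)) /\
    (forall g : G, exists2 t, t \in T & sqdist Q g t <= 32 * b ^+ 2 / n%:R /\
       emp x (sqd g t) <= 320 * b ^+ 2 * K / n%:R)].
Proof.
have [T [TN Tnet]] := separated_net b0 ea n4 Gmeas GVC Q.
have [H [/countable_injP[code codeI] HG Hlim]] := GPM.
(* An enumeration of the countable subclass with default value [g0]. *)
pose hk k : G := if pselect (exists h : G, H (set_val h) /\ code (set_val h) = k) is left p
  then sval (cid p) else g0.
have hkP (h : G) : H (set_val h) -> hk (code (set_val h)) = h.
  move=> Hh; rewrite /hk; case: pselect => [p|[]]; last by exists h.
  case: cid => h' /= [Hh' E]; apply: val_inj; apply: codeI; rewrite ?inE//.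
(* The constant 64 instead of the 32 of the net leaves room for a sequence of the countable subclass
   converging to g: its members are eventually this close to the net point of g. *)
pose small (q : G * G) := sqdist Q q.1 q.2 <= 64 * b ^+ 2 / n%:R.
pose L m := [seq q <- [seq (hk j, t) | j <- iota 0 m, t <- T] | small q].
have LP m q : q \in L m -> q.2 \in T /\ sqdist Q q.1 q.2 <= 64 * b ^+ 2 / n%:R.
  by rewrite mem_filter => /andP[sq /allpairsP[[j t] /= [_ tT E]]]; split => //; rewrite E.
pose B2 := \bigcup_m A (L m).
have mB2 : measurable B2 by apply: bigcup_measurable.
have PB2 : (P (rvec X @^-1` B2) <= (2 * expR (- (3 / 2 * K)))%:E)%E.
  have mF m : measurable (rvec X @^-1` A (L m)) by exact: measurable_preimT.
  rewrite preimage_bigcup.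
  have ndF : nondecreasing_seq (fun m => rvec X @^-1` A (L m)).
    move=> m m' mm'; apply/subsetPset => w [q qL sq]; exists q => //.
    move: qL; rewrite !mem_filter => /andP[-> /=] /allpairsP[[j t] /= [jm tT ->]].
    apply: allpairs_f => //; move: jm; rewrite !mem_iota /= !add0n => jm; exact: leq_trans mm'.
  have cv := nondecreasing_cvg_mu mF (bigcup_measurable (fun m _ => mF m)) ndF (mu := P).
  rewrite -(cvg_lim (@ereal_hausdorff R) cv); apply: lime_le.
    by apply/cvg_ex; eexists; exact: cv.
  by apply: nearW => m; exact: (ghost TN (LP m)).
(* Both are the deviation of [bernstein], for one function and for a product of two, whose second
   moment is at most (b sigma)^2. A covariance then deviates by at most r2 + 2 b r1, which is the
   constant 24. *)
pose r1 := 8 * sigma * Num.sqrt (K / n%:R).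
pose r2 := 8 * (b * sigma) * Num.sqrt (K / n%:R).
pose D1 (t : G) := dev (set_val t) r1.
pose D2 (q : G * G) := dev (fun y => set_val q.1 y * set_val q.2 y) r2.
have mst (s t : G) : measurable_fun setT (fun y => set_val s y * set_val t y).
  by apply: measurable_funM; exact: Gm.
have mD1 t : measurable (D1 t) by apply: dev_meas; exact: Gm.
have mD2 q : measurable (D2 q) by apply: dev_meas; exact: mst.
have mXD1 t : measurable (rvec X @^-1` D1 t) by exact: measurable_preimT.
have mXD2 q : measurable (rvec X @^-1` D2 q) by exact: measurable_preimT.
have PD1 t : (P (rvec X @^-1` D1 t) <= (2 * expR (- 3 * K))%:E)%E.
  exact: (dev_prob (Gm t) (Gb t) (Qsig t) sigma0 bK).
have PD2 q : (P (rvec X @^-1` D2 q) <= (2 * expR (- 3 * K))%:E)%E.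
  apply: (@dev_prob _ (b ^+ 2)).
  - exact: mst.
  - by move=> y; rewrite normrM expr2 ler_pM//; exact: Gb.
  - apply: (@le_trans _ _ (b ^+ 2 * Ex Q (fun y => set_val q.2 y ^+ 2))); last first.
      by rewrite exprMn ler_wpM2l// sqr_ge0.
    have i2 : itg Q (fun y => set_val q.2 y ^+ 2).
      apply: (@itg_bnd _ _ _ _ _ (b ^+ 2)) => [|y]; first by apply: measurable_funX; exact: Gm.
      by rewrite normrX ler_pXn2r ?nnegrE ?(ltW b0)//; exact: Gb.
    rewrite -ExZ//; apply: Ex_le; last 2 first.
    + exact: itgZ.
    + move=> y; rewrite exprMn ler_wpM2r ?sqr_ge0// -real_normK ?num_real//.
      by rewrite ler_pXn2r ?nnegrE ?(ltW b0)//; exact: Gb.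
    + apply: (@itg_bnd _ _ _ _ _ ((b * b) ^+ 2)) => [|y]; first by apply: measurable_funX; exact: mst.
      by rewrite normrX ler_pXn2r ?nnegrE ?mulr_ge0 ?(ltW b0)// normrM ler_pM//; exact: Gb.
  - exact: mulr_gt0.
  - rewrite (_ : (b ^+ 2) ^+ 2 * K = b ^+ 2 * (b ^+ 2 * K)); last by ring.
    by rewrite (_ : n%:R * (b * sigma) ^+ 2 = b ^+ 2 * (n%:R * sigma ^+ 2)) ?ler_pM2l//; ring.
pose TT := [seq (s, t) | s <- T, t <- T].
pose Bad := (\big[setU/set0]_(t <- T) D1 t) `|` (\big[setU/set0]_(q <- TT) D2 q) `|` B2.
have mU1 : measurable (\big[setU/set0]_(t <- T) D1 t) by apply: bigsetU_measurable.
have mU2 : measurable (\big[setU/set0]_(q <- TT) D2 q) by apply: bigsetU_measurable.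
have mBad : measurable Bad by apply: measurableU => //; exact: measurableU.
have mXU1 := measurable_preimT mrX mU1.
have mXU2 := measurable_preimT mrX mU2.
have mXB2 := measurable_preimT mrX mB2.
have mXBad := measurable_preimT mrX mBad.
(* Each of the three families of bad events has probability at most e^(-K), hence at most 1 / n. *)
have PBad : (P (rvec X @^-1` Bad) <= (3 / n%:R)%:E)%E.
  rewrite /Bad !preimage_setU.
  apply: (le_trans (measureU2 _ _ _)) => //; first exact: measurableU.
  have h1 : (P (rvec X @^-1` (\big[setU/set0]_(t <- T) D1 t)) <= ((size T)%:R * (2 * expR (- 3 * K)))%:E)%E.
    have := prob_union_seq T mXD1 PD1; congr (P _ <= _)%E.
    by rewrite (big_morph _ (preimage_setU (rvec X)) (preimage_set0 (rvec X))).
  have h2 : (P (rvec X @^-1` (\big[setU/set0]_(q <- TT) D2 q)) <= ((size TT)%:R * (2 * expR (- 3 * K)))%:E)%E.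
    have := prob_union_seq TT mXD2 PD2; congr (P _ <= _)%E.
    by rewrite (big_morph _ (preimage_setU (rvec X)) (preimage_set0 (rvec X))).
  have hU : (P (rvec X @^-1` (\big[setU/set0]_(t <- T) D1 t) `|`
      rvec X @^-1` (\big[setU/set0]_(q <- TT) D2 q)) <=
      ((size T)%:R * (2 * expR (- 3 * K)))%:E + ((size TT)%:R * (2 * expR (- 3 * K)))%:E)%E.
    by apply: (le_trans (measureU2 _ _ _)) => //; exact: leeD.
  apply: (le_trans (leeD hU PB2)); rewrite -!EFinD lee_fin.
  have two (y z : R) : y + K / 2 <= z -> 2 * expR y <= expR z.
    move=> yz; apply: (@le_trans _ _ (expR 1 * expR y)).
      by rewrite ler_wpM2r ?expR_ge0//; have := expR_ge1Dx (1 : R); lra.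
    by rewrite -expRD ler_expR; move: K128 yz => *; lra.
  have K0 : 0 <= K by move: K128 => *; lra.
  have TK : (size T)%:R <= expR (K / 32) by exact: le_trans (net_size_le ea v1 n4 Ka Kn).
  have e1 : (size T)%:R * (2 * expR (- 3 * K)) <= expR (- K).
    apply: (le_trans (ler_wpM2r _ TK)); first by rewrite mulr_ge0// expR_ge0.
    by rewrite mulrCA -expRD; apply: two; lra.
  have e2 : (size TT)%:R * (2 * expR (- 3 * K)) <= expR (- K).
    rewrite size_allpairs natrM.
    have TK2 := ler_pM (ler0n _ _) (ler0n _ _) TK TK.
    apply: (le_trans (ler_wpM2r _ TK2)); first by rewrite mulr_ge0// expR_ge0.
    by rewrite -expRD mulrCA -expRD; apply: two; lra.
  have e3 : 2 * expR (- (3 / 2 * K)) <= expR (- K) by apply: two; lra.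
  have e4 : expR (- K) <= n%:R^-1.
    by rewrite expRN lef_pV2 ?posrE ?expR_gt0//; exact: (n_le_expK v1 n4 Kn).
  apply: (le_trans (lerD (lerD e1 e2) e3)).
  by move: (expR (- K)) (n%:R^-1 : R) e4 => *; lra.
exists (~` Bad), T; split => //.
- exact: measurableC.
- by rewrite -preimage_setC probability_setC// EFinB leeB.
- move=> x nBad.
  have nB1 t : t \in T -> `|emp x (set_val t) - Ex Q (set_val t)| <= r1.
    move=> tT; rewrite leNgt; apply/negP => d; apply: nBad; left; left.
    by rewrite -bigcup_seq; exists t.
  have nB2 s t : s \in T -> t \in T -> `|emp x (fun y => set_val s y * set_val t y) -
      Ex Q (fun y => set_val s y * set_val t y)| <= r2.
    move=> sT tT; rewrite leNgt; apply/negP => d; apply: nBad; left; right.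
    by rewrite -bigcup_seq; exists (s, t) => //=; apply: allpairs_f.
  have nB3 m : ~ A (L m) x by move=> Am; apply: nBad; right; exists m.
  split.
    move=> s t sT tT.
    have h1 := nB2 s t sT tT; have h2 := nB1 s sT; have h3 := nB1 t tT.
    set es := emp x (set_val s) in h2 *; set et := emp x (set_val t) in h3 *.
    set qs := Ex Q (set_val s) in h2 *; set qt := Ex Q (set_val t) in h3 *.
    have n0 : (0 < n)%N by exact: leq_trans n4.
    have bes : `|es| <= b by apply: emp_bnd => //; exact: Gb.
    have bqt : `|qt| <= b by apply: Ex_bnd => //; exact: Gb.
    set est := emp x _ in h1 *; set qst := Ex Q _ in h1 *.
    rewrite (_ : _ - _ - _ = (est - qst) - (es * (et - qt) + (es - qs) * qt)); last by ring.
    apply: (le_trans (ler_normB _ _)).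
    have h4 : `|es * (et - qt) + (es - qs) * qt| <= b * r1 + r1 * b.
      apply: (le_trans (ler_normD _ _)); apply: lerD.
        by rewrite normrM; apply: ler_pM.
      by rewrite normrM; apply: ler_pM.
    apply: (le_trans (lerD h1 h4)); rewrite /r1 /r2.
    by rewrite le_eqVlt; apply/orP; left; apply/eqP; ring.
  move=> g; have [t tT gt] := Tnet g; exists t => //; split => //.
  (* The bound holds eventually along a sequence of the countable subclass converging to g, and
     passes to the limit because the empirical distance is a finite sum of pointwise limits. *)
  have [h [hH hlim]] := Hlim _ (set_valP g).
  pose h' m : G := exist _ (h m) (mem_set (HG _ (hH m))).
  have hcv s : (fun m => sqd (h' m) t s) @ \oo --> sqd g t s by apply: limit_sqd; exact: hlim.
  have c1 : (fun m => sqdist Q (h' m) t) @ \oo --> sqdist Q g t.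
    exact: (@Ex_cvg _ _ _ Q (fun m => sqd (h' m) t) (sqd g t) _ (fun m => sqd_meas _ _)
      (fun m => sqdist_bnd b0 GVC _ _) hcv).
  have c2 : (fun m => emp x (sqd (h' m) t)) @ \oo --> emp x (sqd g t).
    rewrite /emp; apply: cvgM; last exact: cvg_cst.
    elim: (index_enum _) => [|i r IH].
      by under eq_fun do rewrite big_nil; rewrite big_nil; exact: cvg_cst.
    by under eq_fun do rewrite big_cons; rewrite big_cons; apply: cvgD.
  rewrite -(cvg_lim (@Rhausdorff R) c2); apply: limr_le; first by apply/cvg_ex; eexists; exact: c2.
  have lt64 : sqdist Q g t < 64 * b ^+ 2 / n%:R.
    apply: (le_lt_trans gt); rewrite -(mulrA 32) -(mulrA 64).
    have : 0 < b ^+ 2 / n%:R by exact: divr_gt0.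
    by move: (b ^+ 2 / n%:R) => *; lra.
  have ev : \forall m \near \oo, sqdist Q (h' m) t < 64 * b ^+ 2 / n%:R.
    by apply: (cvgr_lt (sqdist Q g t)) lt64.
  apply: filterS ev => m sm.
  rewrite leNgt; apply/negP => big.
  apply: (nB3 (code (h m)).+1); exists (h' m, t) => //.
  rewrite mem_filter; apply/andP; split; first exact: ltW.
  have <- : hk (code (h m)) = h' m by exact: (hkP (h' m) (hH m)).
  by apply: allpairs_f => //; rewrite mem_iota/= add0n.
Qed.

End event.

(** * Gaussian processes and their suprema *)

Section finite_nets.
Context (R : realType) (T : choiceType).

Lemma finite_representatives (C : finType) (code : T -> C) :
  exists F : seq T, forall t, exists2 f, f \in F & code t = code f.
Proof.
pose h c : option T := if pselect (exists t, code t = c) is left p then Some (sval (cid p)) else None.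
exists (pmap h (enum C)) => t.
have : h (code t) = Some (odflt t (h (code t))) by rewrite /h; case: pselect => // -[]; exists t.
rewrite {2}/h; case: pselect => [p|[]]; last by exists t.
case: cid => /= f fE E; exists f => //.
by rewrite mem_pmap -E; apply: map_f; rewrite mem_enum.
Qed.

Lemma finite_net k (phi : T -> 'I_k -> R) (M e : R) :
  (forall t i, `|phi t i| <= M) -> 0 < e ->
  exists F : seq T, forall t, exists2 f, f \in F & forall i, `|phi t i - phi f i| <= e.
Proof.
move=> phiM e0.
have [F FP] := finite_representatives (fun t => grid_code (Num.truncn (2 * M / e)).+1 M e (phi t)).
exists F => t; have [f fF E] := FP t; exists f => // i.
exact: (grid_code_close i e0 (truncnS_gt _) (phiM t) (phiM f) E).
Qed.

Variables (t0 : T) (z : T -> R) (M : R).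
Hypothesis zM : forall t, `|z t| <= M.

Let hs : has_sup (range (fun t => `|z t|)).
Proof. by split; [exists `|z t0|, t0|exists M => _ [t _ <-]]. Qed.

Lemma supnorm_ge t : `|z t| <= supnorm z.
Proof. by apply: ub_le_sup; [exact: hs.2|exists t]. Qed.

Lemma seqmax_le_supnorm (F : seq T) : seqmax F (fun t => `|z t|) <= supnorm z.
Proof.
apply: seqmax_lub => [|t _]; last exact: supnorm_ge.
exact: le_trans (supnorm_ge t0).
Qed.

Lemma supnorm_le_seqmax (F : seq T) e :
  (forall t, exists2 f, f \in F & `|z t - z f| <= e) ->
  supnorm z <= seqmax F (fun t => `|z t|) + e.
Proof.
move=> FP; apply: ge_sup; first by exists `|z t0|, t0.
move=> _ [t _ <-]; have [f fF zf] := FP t.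
rewrite -(subrK (z f) (z t)) addrC; apply: (le_trans (ler_normD _ _)).
by apply: lerD => //; exact: (seqmax_ge (fun t => `|z t|)).
Qed.
End finite_nets.

(** * Tight random elements of the space of bounded functions *)

Section tight.
Context (R : realType) (T : choiceType) (t0 : T) d (W : measurableType d)
  (P : probability W R) (B : W -> {uniform T -> R^o}).
Hypothesis tB : tight_random_element P B.

Let U := {uniform T -> R^o}.

Lemma uniform_ball_nbhs (z : U) (e : R) : 0 < e ->
  nbhs z [set y : U | forall t, `|z t - y t| < e].
Proof.
move=> e0; apply/uniform_nbhs; exists [set xy : R^o * R^o | ball xy.1 e xy.2]; split.
  exact: (entourage_ball _ (PosNum e0)).
by move=> y /= zy t; have := zy t Logic.I; rewrite /ball/=.
Qed.

Lemma open_eval_gt (g : R -> R) (a : R) t : (forall x y, `|g x - g y| <= `|x - y|) ->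
  open [set z : U | a < g (z t)].
Proof.
move=> gL; rewrite openE => z /= az; rewrite /interior.
apply: filterS (uniform_ball_nbhs z (e := g (z t) - a) _); last by rewrite subr_gt0.
move=> y /= /(_ t) zy; have := gL (z t) (y t); rewrite ler_norml => /andP[_].
by move: zy; move: (`|_ - _|) => *; lra.
Qed.

(** Makes compact sets closed, so that their preimages under [B] are measurable. *)
Lemma uniform_hausdorff : hausdorff_space U.
Proof.
rewrite open_hausdorff => f g fg.
have [t ft] : exists t, f t != g t.
  apply: contrapT => /forallNP H; move/negP: fg; apply; apply/eqP/funext => t.
  by apply/eqP; apply: contrapT => /negP/H.
pose c := (f t + g t) / 2.
have o1 : open [set z : U | c < z t] by exact: (@open_eval_gt id).
have o2 : open [set z : U | - c < - z t].
  by apply: (@open_eval_gt -%R) => x y; rewrite -opprD normrN.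
have disj : [set z : U | c < z t] `&` [set z : U | - c < - z t] = set0.
  by apply/seteqP; split => // z [] /=; rewrite ltrN2 => a b; have := lt_trans a b; rewrite ltxx.
move: ft; rewrite neq_lt => /orP[lt|lt].
  exists ([set z : U | - c < - z t], [set z : U | c < z t]); rewrite /= ?inE /=.
    by split; rewrite ?ltrN2 /c; lra.
  by split => //; rewrite setIC disj.
exists ([set z : U | c < z t], [set z : U | - c < - z t]); rewrite /= ?inE /=.
  by split; rewrite ?ltrN2 /c; lra.
by split => //; rewrite disj.
Qed.

Let Bb w : exists M, forall t, `|B w t| <= M.
Proof. by have [b _ _] := tB; exact: b. Qed.

Let measurable_from_gt (f : W -> R) : (forall a, measurable [set w | a < f w]) ->
  measurable_fun setT f.
Proof.
move=> mf; apply: (measurability (@RGenOInfty.G R)); first exact: RGenOInfty.measurableE.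
move=> _ [_ [a ->] <-]; rewrite setTI.
have := mf a; congr measurable; apply/seteqP; split => w /=; rewrite in_itv/= andbT//.
Qed.

Lemma measurable_tight_eval t : measurable_fun setT (fun w => B w t : R).
Proof.
have [_ oB _] := tB; apply: measurable_from_gt => a.
exact: (oB _ (@open_eval_gt id a t (fun x y => lexx _))).
Qed.

(** The set where the norm exceeds a is the preimage of a union of open sets. Openness makes it
    measurable even when the index set is uncountable. *)
Lemma measurable_tight_supnorm : measurable_fun setT (fun w => supnorm (B w)).
Proof.
have [_ oB _] := tB; apply: measurable_from_gt => a.
have -> : [set w | a < supnorm (B w)] = B @^-1` (\bigcup_t [set z : U | a < `|z t|]).
  apply/seteqP; split => w /=; have [M BM] := Bb w.
    move=> aS; apply: contrapT => H; move: aS; rewrite ltNge => /negP; apply.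
    apply: ge_sup; first by exists `|B w t0|, t0.
    by move=> _ [t _ <-]; rewrite leNgt; apply/negP => at_; apply: H; exists t.
  by move=> [t _ /= at_]; apply: (lt_le_trans at_); exact: (supnorm_ge t0 BM).
apply: oB; apply: bigcup_open => t _; apply: (@open_eval_gt Num.norm) => x y.
exact: ler_dist_dist.
Qed.

(** Each bounded function has a finite set of indices representing its values within e, and the same
    set works within 3 e for every function uniformly e-close to it. Compactness makes one finite
    set work on [K]. The filter of finite sets containing a given one expresses that any enlargement
    works too. *)
Lemma tight_finite (e : R) : 0 < e -> exists F0 : seq T, forall F : seq T,
  {subset F0 <= F} ->
  (P [set w | (3 * e < supnorm (B w) - seqmax F (fun t => `|B w t : R|))%R] <= e%:E)%E.
Proof.
move=> e0; have [_ oB /(_ e e0)[K [Kl cK PK]]] := tB.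
pose sup_filter : set_system (seq T) :=
  [set A | exists F0 : seq T, forall F : seq T, {subset F0 <= F} -> A F].
have Ff : Filter sup_filter.
  split; first by exists [::].
    move=> A1 A2 [F1 h1] [F2 h2]; exists (F1 ++ F2) => F sF.
    by split; [apply: h1|apply: h2] => t tF; apply: sF; rewrite mem_cat tF ?orbT.
  by move=> A1 A2 A12 [F1 h1]; exists F1 => F sF; apply: A12; exact: h1.
have net z : K z -> exists F0 : seq T, forall t, exists2 f, f \in F0 & `|z t - z f| <= e.
  move=> /Kl[M zM]; have [F0 F0P] := @finite_net R T 1 (fun t _ => z t) M e (fun t _ => zM t) e0.
  by exists F0 => t; have [f fF ff] := F0P t; exists f => //; exact: ff ord0.
have [F0 F0P] : sup_filter [set F : seq T | K `<=` [set z : U | forall t, exists2 f, f \in F & `|z t - z f| <= 3 * e]].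
  apply: ((compact_near_coveringP K).1 cK (seq T) sup_filter
    (fun F (z : U) => forall t, exists2 f, f \in F & `|z t - z f| <= 3 * e) Ff) => z Kz.
  have [F0 F0P] := net z Kz.
  exists ([set y : U | forall t, `|z t - y t| < e], [set F : seq T | {subset F0 <= F}]) => /=.
    by split; [exact: uniform_ball_nbhs|exists F0].
  move=> [y F] /= [zy F0F] t; have [f fF ff] := F0P t; exists f; first exact: F0F.
  have := ler_distD (z t) (y t) (y f); have := ler_distD (z f) (z t) (y f).
  rewrite (distrC (y t) (z t)); move: ff (zy t) (zy f).
  by move: (`|_ - _|) (`|_ - _|) (`|_ - _|) (`|_ - _|) (`|_ - _|) => *; lra.
exists F0 => F F0F.
have KF z : K z -> forall t, exists2 f, f \in F & `|z t - z f| <= 3 * e.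
  by move=> Kz; exact: (F0P F F0F z Kz).
have mK : measurable (B @^-1` K).
  have cl : closed K by exact: compact_closed uniform_hausdorff cK.
  rewrite -[K]setCK -preimage_setC; apply: measurableC; apply: oB.
  exact: closed_openC.
have mA : measurable [set w | 3 * e < supnorm (B w) - seqmax F (fun t => `|B w t : R|)].
  apply: measurable_gt_set; apply: measurable_funB; first exact: measurable_tight_supnorm.
  apply: (@measurable_seqmax R T _ W F (fun t w => `|B w t : R|)) => t.
  apply: measurableT_comp => //; exact: measurable_tight_eval.
apply: (@le_trans _ _ (P (~` (B @^-1` K)))).
  apply: le_measure; rewrite ?inE//; first exact: measurableC.
  move=> w /= lt Kw; move: lt; rewrite ltNge => /negP; apply.
  have [M' BM'] := Bb w.
  rewrite lerBlDl; apply: (supnorm_le_seqmax t0).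
  exact: KF.
rewrite probability_setC//.
apply: (@le_trans _ _ (1 - (1 - e)%:E)%E); first by apply: leeB.
by rewrite -EFinB lee_fin opprB addrC subrK.
Qed.

End tight.

Section gaussian_moments.
Context (R : realType).

Lemma normal_law_shift (m s : R) (A : set R) : measurable A ->
  normal_law m s [set y | A (y - m)] = nlaw s A.
Proof.
move=> mA; rewrite [RHS]nlawE /normal_law; have [_|s0] := eqVneq s 0.
  rewrite !diracE; congr (_%:R%:E); congr nat_of_bool.
  by apply/idP/idP; rewrite !inE /= subrr.
have mB : measurable [set y | A (y - m)].
  by apply: (@measurable_preimT _ _ R R (fun y : R => y - m)) => //; exact: measurable_funB.
rewrite /normal_prob integral_mkcond [RHS]integral_mkcond.
have mf t (D : set R) : measurable D -> measurable_fun setT ((fun x : R => (normal_pdf t s x)%:E) \_ D).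
  move=> mD; apply: (measurable_restrictT _ mD).1; apply: measurable_funTS.
  by apply/measurable_EFinP; exact: measurable_normal_pdf.
rewrite -(ge0_integral_translation m (mf m _ mB)); last first.
  by move=> y; rewrite patchE; case: ifP => // _; rewrite lee_fin normal_pdf_ge0.
apply: eq_integral => y _; rewrite !patchE.
have -> : (m + y \in [set y | A (y - m)]) = (y \in A).
  by apply/idP/idP; rewrite !inE /= addrC addKr.
case: ifP => // _; rewrite !normal_pdfE// /normal_fun; congr (_%:E); congr (_ * expR _).
by rewrite subr0 addrC addKr.
Qed.

(** The definition of [gaussian_variable] only asserts that some m and s exist; the moments of Y - m
    identify m with the mean and s^2 with the variance. *)
Lemma centered_gaussian d (W : measurableType d) (P : probability W R) (Y : W -> R) :
  measurable_fun setT Y -> gaussian_variable P Y ->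
  [/\ itg P Y, itg P (fun w => Y w ^+ 2) &
    Ex P Y = 0 -> same_law P Y (nlaw (Num.sqrt (Ex P (fun w => Y w ^+ 2)))) id].
Proof.
move=> mY [m [s Yms]].
have mYm : measurable_fun setT (fun w => Y w - m) by exact: measurable_funB.
have L : same_law P (fun w => Y w - m) (nlaw s) id.
  move=> A mA; rewrite preimage_id -(normal_law_shift m s mA).
  have mB : measurable [set y | A (y - m)].
    by apply: (@measurable_preimT _ _ R R (fun y : R => y - m)) => //; exact: measurable_funB.
  exact: (Yms _ mB).
have mid : measurable_fun setT (@id R) by exact: measurable_id.
have mX (k : nat) : measurable_fun setT (fun x : R => x ^+ k) by exact: measurable_funX.
have I k : itg P (fun w => (Y w - m) ^+ k).
  exact: (same_law_itg mYm mid L (mX k) (itg_exp_nlaw s k)).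
have E k : Ex P (fun w => (Y w - m) ^+ k) = Ex (nlaw s) (fun x => x ^+ k).
  exact: (same_law_Ex mYm mid L (mX k)).
have I1 : itg P Y.
  rewrite (_ : Y = fun w => (Y w - m) ^+ 1 + m); last by apply/funext => w; rewrite expr1 subrK.
  by apply: itgD => //; exact: itg_cst.
have I2 : itg P (fun w => Y w ^+ 2).
  rewrite (_ : (fun w => _) = fun w => (Y w - m) ^+ 2 + (2 * m * Y w + - m ^+ 2)); last first.
    by apply/funext => w; ring.
  by apply: itgD => //; apply: itgD; [exact: itgZ|exact: itg_cst].
split; [exact: I1|exact: I2|move=> EY0].
have [n1 n2] := Ex_nlaw s.
have m0 : m = 0.
  have E1 : Ex P (fun w => Y w - m) = 0 by rewrite -n1; exact: (E 1%N).
  by move: E1; rewrite ExB// ?EY0 ?Ex_cst; [lra|exact: itg_cst].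
have Es : Ex P (fun w => Y w ^+ 2) = s ^+ 2.
  by rewrite -n2 -E m0; apply: (congr1 (Ex P)); apply/funext => w; rewrite subr0.
rewrite Es sqrtr_sqr => A mA.
have -> : Y = fun w => Y w - m by apply/funext => w; rewrite m0 subr0.
rewrite (L A mA) preimage_id.
have I' (q : R) : nlaw q A = (\int[nlaw q]_x (\1_A x : R)%:E)%E.
  by rewrite (integral_indic _ measurableT mA) setIT.
by rewrite !I' nlaw_norm.
Qed.

End gaussian_moments.

Lemma expectation_Ex (R : realType) d (W : measurableType d) (P : probability W R) (f : W -> R) (c : R) :
  ('E_P[f] = c%:E)%E -> Ex P f = c.
Proof. by rewrite unlock /Ex => ->. Qed.

Lemma normrM_le_sqr (R : realType) (x y : R) : `|x * y| <= x ^+ 2 + y ^+ 2.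
Proof.
have h1 := sqr_ge0 (x + y); have h2 := sqr_ge0 (x - y).
have h3 := sqr_ge0 x; have h4 := sqr_ge0 y.
by rewrite ler_norml; apply/andP; split; nra.
Qed.

Lemma gvec_tight (R : realType) (T : choiceType) (t0 : T) d (W : measurableType d)
    (P : probability W R) (B : W -> {uniform T -> R^o}) (cov : T -> T -> \bar R)
    (cv : T -> T -> R) : centered_tight_gaussian P B cov ->
  (forall s t, cov s t = (cv s t)%:E) ->
  forall k (ts : 'I_k -> T), gvec P (fun i w => B w (ts i) : R) (fun i j => cv (ts i) (ts j)).
Proof.
move=> [tB gB EB cB] cvE k ts.
have mB t : measurable_fun setT (fun w => B w t : R) by exact: measurable_tight_eval tB t.
have gB1 t : gaussian_variable P (fun w => B w t : R).
  have [m [s H]] := gB 1%N (fun=> t) (fun=> 1); exists m, s.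
  rewrite (_ : (fun w => B w t : R) = (fun w => \sum_(i < 1) 1 * (B w t : R)))//.
  by apply/funext => w; rewrite big_ord1 mul1r.
have I1 t : itg P (fun w => B w t : R) by have [] := centered_gaussian (mB t) (gB1 t).
have I2 t : itg P (fun w => (B w t : R) ^+ 2) by have [] := centered_gaussian (mB t) (gB1 t).
have I12 s t : itg P (fun w => (B w s : R) * (B w t : R)).
  apply: (itg_le (g := fun w => (B w s : R) ^+ 2 + (B w t : R) ^+ 2)).
  - exact: measurable_funM.
  - move=> w; exact: normrM_le_sqr.
  - exact: itgD.
have E1 t : Ex P (fun w => B w t : R) = 0 by exact: (expectation_Ex (EB t)).
have E2 s t : Ex P (fun w => (B w s : R) * (B w t : R)) = cv s t.
  by apply: expectation_Ex; rewrite cB cvE.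
have qE c : Ex P (fun w => (\sum_i c i * B w (ts i) : R) ^+ 2) = qform (fun i j => cv (ts i) (ts j)) c.
  rewrite (_ : (fun w => _) = (fun w => \sum_i \sum_j (c i * c j) * ((B w (ts i) : R) * (B w (ts j) : R)))); last first.
    apply/funext => w; rewrite expr2 mulr_suml; apply: eq_bigr => i _.
    by rewrite mulr_sumr; apply: eq_bigr => j _; rewrite mulrACA.
  rewrite Ex_sum; last by move=> i _; apply: itg_sum => j _; exact: itgZ.
  apply: eq_bigr => i _; rewrite Ex_sum; last by move=> j _; exact: itgZ.
  by apply: eq_bigr => j _; rewrite ExZ// E2.
split => //.
- by move=> i j; rewrite -!E2; apply: (congr1 (Ex P)); apply/funext => w; rewrite mulrC.
- by move=> c; rewrite -qE; apply: Ex_ge0 => w; exact: sqr_ge0.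
- move=> c.
  have mc : measurable_fun setT (fun w => \sum_i c i * (B w (ts i) : R)).
    by apply: measurable_sum => i; exact: measurable_funM.
  have [_ _] := centered_gaussian mc (gB k ts c).
  rewrite qE; apply; rewrite Ex_sum; last by move=> i _; exact: itgZ.
  by rewrite big1// => i _; rewrite ExZ// E1 mulr0.
Qed.

Section gaussian_process.
Context (R : realType) (I : choiceType) d (W : measurableType d) (P : probability W R)
  (Z : I -> W -> R) (cv : I -> I -> R).
Hypothesis gZ : forall k (ts : 'I_k -> I), gvec P (fun i => Z (ts i)) (fun i j => cv (ts i) (ts j)).

Lemma gprocess_meas s : measurable_fun setT (Z s).
Proof. by have [m _ _ _] := gZ (fun _ : 'I_1 => s); exact: (m ord0). Qed.

Lemma gprocess_subgauss (D : I -> I -> R) :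
  (forall s t, cv s s - 2 * cv s t + cv t t <= D s t) ->
  forall s t l, itg P (fun w => expR (l * (Z s w - Z t w))) /\
  Ex P (fun w => expR (l * (Z s w - Z t w))) <= expR (l ^+ 2 * D s t / 2).
Proof.
move=> cD s t l.
pose ts (i : 'I_2) := if i == ord0 then s else t.
have G := gZ ts.
pose c (k : 'I_2) : R := 1 * (k == ord0)%:R + (-1) * (k == ord_max)%:R.
have [mts sym _ _] := G.
have lin w : \sum_i c i * Z (ts i) w = Z s w - Z t w.
  by rewrite (sum_delta2 _ _ _ _ (fun i => Z (ts i) w)) /ts/= mul1r mulN1r.
have := gvec_mgf G c l.
rewrite (qform_delta2 _ _ _ _ sym) /ts/=.
rewrite (eq_integral (fun w => (expR (l * (Z s w - Z t w)))%:E)); last by move=> w _; rewrite lin.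
set q := _ + _ => H.
have qD : q <= D s t by apply: le_trans (cD s t); rewrite /q le_eqVlt; apply/orP; left; apply/eqP; ring.
have mE : measurable_fun setT (fun w => expR (l * (Z s w - Z t w))).
  by apply: measurableT_comp => //; apply: measurable_funM => //; apply: measurable_funB; exact: gprocess_meas.
split.
  apply/integrableP; split; first exact/measurable_EFinP.
  rewrite (eq_integral (fun w => (expR (l * (Z s w - Z t w)))%:E)); first by rewrite H ltry.
  by move=> w _ /=; rewrite ger0_norm ?expR_ge0.
by rewrite /Ex H/= ler_expR ler_wpM2r// ler_wpM2l// sqr_ge0.
Qed.

End gaussian_process.

Section multiplier_process.
Context (R : realType) dS (S : measurableType dS) (G : set (S -> R)) d (W : measurableType d)
  (P : probability W R) (n : nat) (xi : 'I_n -> W -> R) (x : n.-tuple S).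
Hypothesis mxi : forall i, measurable_fun setT (xi i).
Hypothesis ixi : mutually_independent P xi.
Hypothesis lxi : forall i, has_law P (xi i) (normal_prob 0 1).
Hypothesis n0 : (0 < n)%N.

Definition multiplier (g : G) (w : W) : R :=
  1 / Num.sqrt n%:R * \sum_(i < n) xi i w *
      (set_val g (tnth x i) - 1 / n%:R * \sum_(j < n) set_val g (tnth x j)).

Definition emp_cov (s t : G) : R :=
  emp x (fun y => set_val s y * set_val t y) - emp x (set_val s) * emp x (set_val t).

Let nR : 0 < n%:R :> R. Proof. by rewrite ltr0n. Qed.
Let sn0 : 0 < Num.sqrt n%:R :> R. Proof. by rewrite sqrtr_gt0. Qed.
Let snn : Num.sqrt n%:R ^+ 2 = n%:R :> R. Proof. by rewrite sqr_sqrtr// ltW. Qed.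

Let cen (g : G) i := set_val g (tnth x i) - emp x (set_val g).

Let multiplierE g w : multiplier g w = \sum_(i < n) (cen g i / Num.sqrt n%:R) * xi i w.
Proof.
rewrite /multiplier mulr_sumr; apply: eq_bigr => i _.
by rewrite /cen /emp; ring.
Qed.

Let sum_emp (f : S -> R) : \sum_i f (tnth x i) = n%:R * emp x f.
Proof. by rewrite /emp mulrCA divff ?mulr1// gt_eqF. Qed.

Let cen_cov s t : (\sum_i cen s i * cen t i) / n%:R = emp_cov s t.
Proof.
rewrite /emp_cov {1}/emp; set a := emp x (set_val s); set b := emp x (set_val t).
rewrite (eq_bigr (fun i => set_val s (tnth x i) * set_val t (tnth x i) - b * set_val s (tnth x i)
  - a * set_val t (tnth x i) + a * b)); last by move=> i _; rewrite /cen -/a -/b; ring.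
rewrite big_split/= !sumrB -!mulr_sumr !sum_emp -/a -/b sumr_const card_ord -[_ *+ n]mulr_natr.
by field; rewrite gt_eqF.
Qed.

(** For a fixed sample the process is linear in the normal variables, and the Gram matrix of its
    coefficients is the empirical covariance because they are centred at the empirical mean. *)
Lemma gvec_multiplier k (ts : 'I_k -> G) :
  gvec P (fun i => multiplier (ts i)) (fun i j => emp_cov (ts i) (ts j)).
Proof.
have mm g : measurable_fun setT (multiplier g).
  rewrite (_ : multiplier g = fun w => \sum_(i < n) (cen g i / Num.sqrt n%:R) * xi i w); last first.
    by apply/funext => w; rewrite multiplierE.
  by apply: measurable_sum => i; exact: measurable_funM.
pose al c i := \sum_(l < k) c l * cen (ts l) i / Num.sqrt n%:R.
have qE c : qform (fun i j => emp_cov (ts i) (ts j)) c = \sum_(i < n) al c i ^+ 2.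
  transitivity (\sum_(l < k) \sum_(l' < k) \sum_(i < n)
     (c l * cen (ts l) i / Num.sqrt n%:R) * (c l' * cen (ts l') i / Num.sqrt n%:R)).
    apply: eq_bigr => l _; apply: eq_bigr => l' _; rewrite -cen_cov mulr_suml mulr_sumr.
    apply: eq_bigr => i _.
    have -> : n%:R^-1 = (Num.sqrt n%:R)^-1 * (Num.sqrt n%:R)^-1 :> R by rewrite -expr2 exprVn snn.
    by ring.
  under eq_bigr do rewrite exchange_big/=.
  rewrite exchange_big/=; apply: eq_bigr => i _.
  rewrite /al expr2 mulr_suml; apply: eq_bigr => l _.
  by rewrite mulr_sumr.
split => //.
- by move=> i j; rewrite -!cen_cov; congr (_ / _); apply: eq_bigr => l _; rewrite mulrC.
- by move=> c; rewrite qE; apply: sumr_ge0 => i _; exact: sqr_ge0.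
- move=> c; rewrite qE.
  have lx i : same_law P (xi i) (nlaw 1) id.
    by apply: nlaw_same => A mA; rewrite lxi// /normal_law oner_eq0.
  have := same_law_sum_nlaw mxi ixi (al c) (index_enum_uniq _) lx.
  rewrite (_ : (fun w => \sum_(j <- index_enum 'I_n) al c j * xi j w) =
    (fun w => \sum_i c i * multiplier (ts i) w))//.
  apply/funext => w; under [RHS]eq_bigr do rewrite multiplierE mulr_sumr.
  rewrite exchange_big/=; apply: eq_bigr => i _; rewrite mulr_suml.
  by apply: eq_bigr => l _; rewrite !mulrA.
Qed.

Lemma multiplier_close (g f : G) (eta : R) w :
  (forall i, `|set_val g (tnth x i) - set_val f (tnth x i)| <= eta) ->
  `|multiplier g w - multiplier f w| <= 2 * eta * \sum_(i < n) `|xi i w|.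
Proof.
move=> gf; rewrite !multiplierE -sumrB mulr_sumr.
apply: (le_trans (ler_norm_sum _ _ _)); apply: ler_sum => i _.
have sn1 : (Num.sqrt n%:R)^-1 <= 1 :> R.
  by rewrite invf_le1// -[leLHS]sqrtr1 ler_sqrt// ler1n.
rewrite -mulrBl normrM ler_wpM2r// -mulrBl normrM [`|_^-1|]ger0_norm ?invr_ge0 ?(ltW sn0)//.
apply: (@le_trans _ _ (`|cen g i - cen f i|)); first by rewrite ler_piMr.
rewrite /cen (_ : _ - _ - _ = (set_val g (tnth x i) - set_val f (tnth x i)) -
  (emp x (set_val g) - emp x (set_val f))); last by ring.
apply: (le_trans (ler_normB _ _)); rewrite mulr_natl mulr2n; apply: lerD => //.
rewrite /emp -mulrBl -sumrB normrM [`|_^-1|]ger0_norm ?invr_ge0 ?(ltW nR)//.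
rewrite ler_pdivrMr//; apply: (le_trans (ler_norm_sum _ _ _)).
apply: (le_trans (ler_sum _ (fun i _ => gf i))).
by rewrite sumr_const card_ord -[_ *+ n]mulr_natr.
Qed.

Lemma multiplier_bnd (g : G) (M : R) w : (forall i, `|set_val g (tnth x i)| <= M) ->
  `|multiplier g w| <= 2 * M * \sum_(i < n) `|xi i w|.
Proof.
move=> gM; rewrite multiplierE mulr_sumr.
apply: (le_trans (ler_norm_sum _ _ _)); apply: ler_sum => i _.
have sn1 : (Num.sqrt n%:R)^-1 <= 1 :> R.
  by rewrite invf_le1// -[leLHS]sqrtr1 ler_sqrt// ler1n.
rewrite normrM ler_wpM2r// normrM [`|_^-1|]ger0_norm ?invr_ge0 ?(ltW sn0)//.
apply: (@le_trans _ _ (`|cen g i|)); first by rewrite ler_piMr.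
rewrite /cen; apply: (le_trans (ler_normB _ _)); rewrite mulr_natl mulr2n; apply: lerD => //.
rewrite /emp normrM [`|_^-1|]ger0_norm ?invr_ge0 ?(ltW nR)//.
rewrite ler_pdivrMr//; apply: (le_trans (ler_norm_sum _ _ _)).
apply: (le_trans (ler_sum _ (fun i _ => gM i))).
by rewrite sumr_const card_ord -[_ *+ n]mulr_natr.
Qed.

End multiplier_process.

Section lipschitz_expectations.
Context (R : realType) d (W : measurableType d) (P : probability W R) (f : R -> R) (Mf : R).
Hypothesis fL : forall x y, `|f x - f y| <= `|x - y|.
Hypothesis fM : forall x, `|f x| <= Mf.

Lemma lipschitz1_measurable : measurable_fun setT f.
Proof.
by apply: continuous_measurable_fun; apply: (@lipschitz_continuous R f 1) => x y; rewrite mul1r.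
Qed.

Lemma lipschitz_itg (X : W -> R) : measurable_fun setT X -> itg P (fun w => f (X w)).
Proof.
move=> mX; apply: (@itg_bnd _ _ _ _ _ Mf) => //.
exact: (measurableT_comp lipschitz1_measurable).
Qed.

Lemma lipschitz_Ex_le (X Y : W -> R) (g : W -> R) : measurable_fun setT X -> measurable_fun setT Y ->
  itg P g -> (forall w, `|X w - Y w| <= g w) ->
  `|Ex P (fun w => f (X w)) - Ex P (fun w => f (Y w))| <= Ex P g.
Proof.
move=> mX mY Ig XY; rewrite -ExB; [|exact: lipschitz_itg..].
apply: Ex_abs_le => //; first by apply: itgB; exact: lipschitz_itg.
by move=> w; apply: (le_trans (fL _ _)).
Qed.

End lipschitz_expectations.

Section reduction.
Context (R : realType) (I : choiceType) d (W : measurableType d) (P : probability W R)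
  (Z : I -> W -> R) (cv D : I -> I -> R) (N : W -> R) (f : R -> R) (Mf : R)
  (T : seq I) (pi : I -> I) (a b v K p : R) (n : nat).
Hypothesis gZ : forall k (ts : 'I_k -> I), gvec P (fun i => Z (ts i)) (fun i j => cv (ts i) (ts j)).
Hypothesis cD : forall s t, cv s s - 2 * cv s t + cv t t <= D s t.
Hypothesis Dsym : forall s t, D s t = D t s.
Hypothesis Dtri : forall s t q, D s q <= 2 * D s t + 2 * D t q.
Hypothesis n4 : (4 <= n)%N.
Hypothesis b0 : 0 < b.
Hypothesis ea : expR 1 <= a.
Hypothesis v1 : 1 <= v.
Hypothesis Ka : 128 * (v * ln a) <= K.
Hypothesis Kn : 128 * (v * ln n%:R) <= K.
Hypothesis ent : forall (F : seq I) tau, 0 < tau < 1 -> exists pit : I -> I,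
  (forall g, g \in F -> D g (pit g) <= 8 * b ^+ 2 * tau ^+ 2) /\
  (size (undup (map pit F)))%:R <= 2 * (a / tau) `^ v.
Hypothesis piT : forall g, pi g \in T.
Hypothesis Dpi : forall g, D g (pi g) <= 320 * b ^+ 2 * K / n%:R.
Hypothesis p1 : 1 <= p.
Hypothesis sT : (size T)%:R <= p.
Hypothesis lp : ln p <= K / 8.
Hypothesis fL : forall x y, `|f x - f y| <= `|x - y|.
Hypothesis fM : forall x, `|f x| <= Mf.
Hypothesis approx : forall e, 0 < e -> exists F0 : seq I, forall F : seq I, {subset F0 <= F} ->
  `|Ex P (fun w => f (N w)) - Ex P (fun w => f (seqmax F (fun g => `|Z g w|)))| <= e.

(** [N] stands for the supremum of the process, and [approx] is all that is used of this. Adding [T]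
    to the approximating finite set puts the maximum over [T] below the maximum over [F]; the gap is
    at most the increment between the identity and [pi], which chaining bounds uniformly in [F]. *)
Lemma process_reduction :
  `|Ex P (fun w => f (N w)) - Ex P (fun w => f (seqmax T (fun g => `|Z g w|)))| <=
  400 * (b * K / Num.sqrt n%:R).
Proof.
apply/ler_addgt0Pl => e e0; have [F0 F0P] := approx e0.
pose F := F0 ++ T.
have TF t : t \in T -> t \in F by rewrite mem_cat => ->; rewrite orbT.
have sF : {subset F0 <= F} by move=> t tF; rewrite mem_cat tF.
have mZ := gprocess_meas gZ.
have sg := gprocess_subgauss gZ cD.
have mm G : measurable_fun setT (fun w => seqmax G (fun g => `|Z g w|)).
  apply: (@measurable_seqmax R I _ W G (fun g w => `|Z g w|)) => g.
  by apply: measurableT_comp => //; exact: mZ.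
apply: (le_trans (ler_distD (Ex P (fun w => f (seqmax F (fun g => `|Z g w|)))) _ _)).
apply: lerD; first exact: F0P.
apply: (@le_trans _ _ (Ex P (incmax Z F id pi))).
  apply: (lipschitz_Ex_le fL fM) => //; first exact: (itg_incmax mZ sg).
  move=> w; rewrite ger0_norm; last first.
    rewrite subr_ge0; apply: seqmax_lub; first exact: seqmax_ge0.
    by move=> t tT; apply: (seqmax_ge (fun g => `|Z g w|)); exact: TF.
  rewrite lerBlDl; apply: seqmax_lub; first by rewrite addr_ge0// seqmax_ge0.
  move=> g gF; rewrite -(subrK (Z (pi g) w) (Z g w)) addrC.
  apply: (le_trans (ler_normD _ _)); apply: lerD.
    exact: (seqmax_ge (fun g => `|Z g w|)).
  exact: (seqmax_ge (fun g => `|Z g w - Z (pi g) w|)).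
apply: (@chaining R d W P I Z D mZ sg Dsym Dtri F pi a b v K p n) => //.
- by move=> tau t01; exact: ent.
- apply: le_trans sT; rewrite ler_nat; apply: uniq_leq_size; first exact: undup_uniq.
  by move=> t; rewrite mem_undup => /mapP[g _ ->].
Qed.

End reduction.

Section supremum_of_multipliers.
Context (R : realType) dS (S : measurableType dS) (G : set (S -> R)) d (W : measurableType d)
  (P : probability W R) (n : nat) (xi : 'I_n -> W -> R) (x : n.-tuple S) (b : R) (g0 : G).
Hypothesis mxi : forall i, measurable_fun setT (xi i).
Hypothesis ixi : mutually_independent P xi.
Hypothesis lxi : forall i, has_law P (xi i) (normal_prob 0 1).
Hypothesis n0 : (0 < n)%N.
Hypothesis Gb : forall (g : G) s, `|set_val g s| <= b.

Let Z := multiplier xi x (G := G).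
Let N w := W_tilde G x (fun i => xi i w).

Let NE w : N w = supnorm (Z ^~ w). Proof. by []. Qed.
Let gZ := gvec_multiplier x mxi ixi lxi n0 (G := G).
Let mZ := gprocess_meas gZ.

(** For a fixed sample a function matters only through its n values in [-b, b], so finitely many
    functions represent the class up to any precision, the error being proportional to the sum of
    the |xi i|. *)
Lemma W_tilde_net (e : R) : 0 < e -> exists F0 : seq G, forall F : seq G, {subset F0 <= F} ->
  forall w, 0 <= N w - seqmax F (fun g => `|Z g w|) <= e * \sum_(i < n) `|xi i w|.
Proof.
move=> e0; have e2 : 0 < e / 2 by rewrite divr_gt0.
have [F0 F0P] := @finite_net R G n (fun g i => set_val g (tnth x i)) b (e / 2) (fun g i => Gb g _) e2.
exists F0 => F sF w.
have bZ g : `|Z g w| <= 2 * b * \sum_(i < n) `|xi i w|.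
  by apply: multiplier_bnd => // i; exact: Gb.
rewrite subr_ge0 NE (seqmax_le_supnorm g0 bZ)/= lerBlDl.
apply: (supnorm_le_seqmax g0) => g; have [h hF gh] := F0P g.
exists h; first exact: sF.
apply: (le_trans (multiplier_close xi n0 w gh)); rewrite le_eqVlt; apply/orP; left; apply/eqP.
by field.
Qed.

Let itg_xi i : itg P (fun w => `|xi i w|).
Proof.
have lx : same_law P (xi i) (nlaw 1) id.
  by apply: nlaw_same => A mA; rewrite lxi// /normal_law oner_eq0.
have mid : measurable_fun setT (@id R) by exact: measurable_id.
have mn : measurable_fun setT (fun x : R => `|x| ^+ 1).
  by apply: measurable_funX; exact: normr_measurable.
exact: (same_law_itg (mxi i) mid lx mn (itg_norm_exp_nlaw 1 1)).
Qed.

(** The class may be uncountable; nets of precision 1 / (m + 1) exhibit the supremum as a pointwise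
    limit of finite maxima. *)
Lemma measurable_W_tilde : measurable_fun setT N.
Proof.
have pos m : 0 < (m.+1%:R)^-1 :> R by rewrite invr_gt0.
have [F FP] := choice (fun m => W_tilde_net (pos m)).
apply: (@measurable_fun_cvg _ _ _ _ (fun m w => seqmax (F m) (fun g => `|Z g w|))).
  move=> m; apply: (@measurable_seqmax R G _ W (F m) (fun g w => `|Z g w|)) => g.
  by apply: measurableT_comp => //; exact: mZ.
move=> w _; set C := \sum_(i < n) `|xi i w|.
have c1 : (fun m => N w - C * (m.+1%:R)^-1) @ \oo --> N w.
  rewrite -[X in _ --> X]subr0 -(mulr0 C); apply: cvgB; first exact: cvg_cst.
  by apply: cvgM; [exact: cvg_cst|exact: cvg_harmonic].
apply: (squeeze_cvgr _ c1); last exact: cvg_cst.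
apply: nearW => m; have /andP[h1 h2] := FP m (F m) (fun _ h => h) w.
by rewrite -/C mulrC in h2; apply/andP; split; [rewrite lerBlDr -lerBlDl|rewrite -subr_ge0].
Qed.

Variables (f : R -> R) (Mf : R).
Hypothesis fL : forall x y, `|f x - f y| <= `|x - y|.
Hypothesis fM : forall x, `|f x| <= Mf.

Lemma W_tilde_approx e : 0 < e -> exists F0 : seq G, forall F : seq G, {subset F0 <= F} ->
  `|Ex P (fun w => f (N w)) - Ex P (fun w => f (seqmax F (fun g => `|Z g w|)))| <= e.
Proof.
move=> e0; pose C := Ex P (fun w => \sum_(i < n) `|xi i w|).
have C0 : 0 <= C by apply: Ex_ge0 => w; exact: sumr_ge0.
have IC : itg P (fun w => \sum_(i < n) `|xi i w|) by apply: itg_sum.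
have [F0 F0P] := W_tilde_net (divr_gt0 e0 (ltr_pwDl ltr01 C0)).
exists F0 => F sF.
have mN := measurable_W_tilde.
have mm : measurable_fun setT (fun w => seqmax F (fun g => `|Z g w|)).
  apply: (@measurable_seqmax R G _ W F (fun g w => `|Z g w|)) => g.
  by apply: measurableT_comp => //; exact: mZ.
apply: (le_trans (lipschitz_Ex_le fL fM mN mm (itgZ (e / (1 + C)) IC) _)).
  by move=> w; have /andP[h1 h2] := F0P F sF w; rewrite ger0_norm.
rewrite ExZ// -/C mulrAC ler_pdivrMr ?ltr_pwDl// ler_pM2l//.
by rewrite lerDr.
Qed.

End supremum_of_multipliers.

Section supremum_of_tight_process.
Context (R : realType) (T : choiceType) (t0 : T) d (W : measurableType d)
  (P : probability W R) (B : W -> {uniform T -> R^o}) (f : R -> R) (Mf : R).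
Hypothesis tB : tight_random_element P B.
Hypothesis fL : forall x y, `|f x - f y| <= `|x - y|.
Hypothesis fM : forall x, `|f x| <= Mf.

Lemma tight_approx e : 0 < e -> exists F0 : seq T, forall F : seq T, {subset F0 <= F} ->
  `|Ex P (fun w => f (supnorm (B w))) - Ex P (fun w => f (seqmax F (fun t => `|B w t : R|)))| <= e.
Proof.
move=> e0; have M0 : 0 <= Mf by exact: le_trans (fM 0).
have d0 : 0 < 3 + 2 * Mf by rewrite ltr_pwDl// mulr_ge0.
(* Outside an event of probability at most q the supremum and the finite maximum differ by at most 3
   q; on that event [f] varies by at most 2 Mf. This q makes the total e. *)
have q0 : 0 < e / (3 + 2 * Mf) by rewrite divr_gt0.
have [F0 F0P] := tight_finite t0 tB q0.
exists F0 => F sF; have := F0P F sF; set q := e / _ in q0 *; set A := [set w | _] => PA.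
have mN := measurable_tight_supnorm t0 tB.
have mm : measurable_fun setT (fun w => seqmax F (fun t => `|B w t : R|)).
  apply: (@measurable_seqmax R T _ W F (fun t w => `|B w t : R|)) => t.
  by apply: measurableT_comp => //; exact: (measurable_tight_eval tB t).
have mA : measurable A by apply: measurable_gt_set; exact: measurable_funB.
have I1 : itg P (\1_A).
  apply: (@itg_bnd _ _ _ _ _ 1) => [|w]; first exact: measurable_indic.
  by rewrite indicE; case: (_ \in _); rewrite ?normr1 ?normr0.
have Ig : itg P (fun w => 3 * q + 2 * Mf * \1_A w) by apply: itgD; [exact: itg_cst|exact: itgZ].
rewrite -ExB; [|exact: (lipschitz_itg _ fL fM)..].
apply: (@le_trans _ _ (Ex P (fun w => 3 * q + 2 * Mf * \1_A w))).
  apply: Ex_abs_le => //; first by apply: itgB; exact: (lipschitz_itg _ fL fM).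
  move=> w; have [M BM] : exists M, forall t, `|B w t : R| <= M by have [b _ _] := tB; exact: b.
  have [Aw|nA] := pselect (A w).
    rewrite indicE mem_set// mulr1; apply: (@le_trans _ _ (2 * Mf)).
      by apply: (le_trans (ler_normB _ _)); rewrite mulr_natl mulr2n lerD.
    by rewrite lerDr mulr_ge0// ltW.
  rewrite indicE memNset// mulr0 addr0; apply: (le_trans (fL _ _)).
  rewrite ger0_norm; last by rewrite subr_ge0; exact: (seqmax_le_supnorm t0 BM).
  by rewrite leNgt; apply/negP.
rewrite ExD; [|exact: itg_cst|exact: itgZ].
rewrite Ex_cst ExZ//.
have PA' : Ex P (\1_A) <= q by rewrite -lee_fin Ex_indic.
apply: (@le_trans _ _ (3 * q + 2 * Mf * q)); first by rewrite lerD2l ler_wpM2l// mulr_ge0.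
by rewrite -mulrDl /q mulrC divfK// gt_eqF.
Qed.

End supremum_of_tight_process.

(** * Comparison of the suprema *)

Section rate.
Context (R : realType) (b sigma K : R) (n : nat).
Hypothesis b0 : 0 < b.
Hypothesis sigma0 : 0 < sigma.
Hypothesis K0 : 0 < K.
Hypothesis n0 : (0 < n)%N.

Let th := fourth_root_term n b sigma K.
Let q := b ^+ 2 * sigma ^+ 2 * K ^+ 3 / n%:R.
Let nR : 0 < n%:R :> R. Proof. by rewrite ltr0n. Qed.
Let q0 : 0 < q. Proof. by rewrite divr_gt0// !mulr_gt0// exprn_gt0. Qed.

Lemma fourth_root_term_gt0 : 0 < th.
Proof. exact: powR_gt0. Qed.

Lemma sqr_fourth_root_term : th ^+ 2 = Num.sqrt q.
Proof.
rewrite -powR_mulrn; last exact: ltW fourth_root_term_gt0.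
rewrite /th /fourth_root_term -powRrM -powR12_sqrt ?(ltW q0)//; congr (_ `^ _).
by field.
Qed.

(** Raised to the fourth power this reads b^4 K^4 / n^2 <= b^2 sigma^2 K^3 / n, which is the
    hypothesis multiplied by b^2 K^3 / n^2. *)
Lemma chaining_rate : b ^+ 2 * K <= n%:R * sigma ^+ 2 -> b * K / Num.sqrt n%:R <= th.
Proof.
move=> bK; have s0 : 0 < Num.sqrt n%:R :> R by rewrite sqrtr_gt0.
have l0 : 0 <= b * K / Num.sqrt n%:R by rewrite divr_ge0 ?mulr_ge0// ltW.
rewrite -(@ler_pXn2r _ 2) ?nnegrE ?(ltW fourth_root_term_gt0)// sqr_fourth_root_term.
rewrite expr_div_n sqr_sqrtr ?(ltW nR)//.
have p0 : 0 <= (b * K) ^+ 2 / n%:R by rewrite divr_ge0 ?sqr_ge0// ltW.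
rewrite -[leLHS](ger0_norm p0) -sqrtr_sqr ler_sqrt ?(ltW q0)//.
rewrite (_ : ((b * K) ^+ 2 / n%:R) ^+ 2 = b ^+ 2 * K ^+ 3 / n%:R ^+ 2 * (b ^+ 2 * K)); last by field; rewrite gt_eqF.
rewrite (_ : q = b ^+ 2 * K ^+ 3 / n%:R ^+ 2 * (n%:R * sigma ^+ 2)); last by rewrite /q; field; rewrite gt_eqF.
by rewrite ler_wpM2l// divr_ge0 ?mulr_ge0 ?exprn_ge0// ltW.
Qed.

(** The two sides are in fact equal: [th] is defined so that D K balances th^2 for the covariance
    error D of [sample_event]. *)
Lemma comparison_rate : 24 * b * sigma * Num.sqrt (K / n%:R) * K <= 24 * th ^+ 2.
Proof.
have k0 : 0 <= K / n%:R by rewrite divr_ge0// ltW.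
rewrite sqr_fourth_root_term -!mulrA ler_pM2l//.
have p0 : 0 <= b * (sigma * (Num.sqrt (K / n%:R) * K)).
  by rewrite !mulr_ge0 ?sqrtr_ge0// ltW.
rewrite -[leLHS](ger0_norm p0) -sqrtr_sqr ler_sqrt ?(ltW q0)// !exprMn sqr_sqrtr//.
by rewrite /q le_eqVlt; apply/orP; left; apply/eqP; field; rewrite gt_eqF.
Qed.

End rate.

Section core.
Context (R : realType) dS (S : measurableType dS) (G : set (S -> R)) (b a v K sigma : R) (n : nat).
Hypothesis b0 : 0 < b.
Hypothesis ea : expR 1 <= a.
Hypothesis v1 : 1 <= v.
Hypothesis n4 : (4 <= n)%N.
Hypothesis Gmeas : forall g, G g -> measurable_fun [set: S] g.
Hypothesis GVC : VC_type G b a v.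
Hypothesis GPM : pointwise_measurable G.
Hypothesis Ka : 128 * (v * ln a) <= K.
Hypothesis Kn : 128 * (v * ln n%:R) <= K.
Hypothesis sigma0 : 0 < sigma.
Hypothesis bK : b ^+ 2 * K <= n%:R * sigma ^+ 2.
Context dO (Omega : measurableType dO) (P : probability Omega R) (X : 'I_n -> Omega -> S)
  (xi : 'I_n -> Omega -> R) (Q : probability S R).
Hypothesis mX : forall i, measurable_fun setT (X i).
Hypothesis iX : mutually_independent P X.
Hypothesis lX : forall i, same_law P (X i) Q id.
Hypothesis mxi : forall i, measurable_fun setT (xi i).
Hypothesis ixi : mutually_independent P xi.
Hypothesis lxi : forall i, has_law P (xi i) (normal_prob 0 1).
Hypothesis Qsig : forall g : G, Ex Q (fun s => set_val g s ^+ 2) <= sigma ^+ 2.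

Definition cov_of (s t : G) : R :=
  Ex Q (fun y => set_val s y * set_val t y) - Ex Q (set_val s) * Ex Q (set_val t).

Context dB (OmegaB : measurableType dB) (PB : probability OmegaB R)
  (B : OmegaB -> {uniform G -> R^o}) (cov : G -> G -> \bar R).
Hypothesis gB : centered_tight_gaussian PB B cov.
Hypothesis covE : forall s t, cov s t = (cov_of s t)%:E.

Let a0 := a_gt0 ea.
Let n0 : (0 < n)%N. Proof. exact: leq_trans n4. Qed.
Let nR := @sample_size_gt0 R n n4.
Let K128 := K_ge128 ea v1 Ka.
Let K0 : 0 < K. Proof. exact: lt_le_trans K128. Qed.
Let Gm (g : G) : measurable_fun setT (set_val g). Proof. exact: G_meas. Qed.
Let Gb (g : G) s : `|set_val g s| <= b. Proof. exact: (G_bnd GVC). Qed.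
Let itgG (g : G) : itg Q (set_val g). Proof. exact: (itg_bnd Q (Gm g) (Gb g)). Qed.
Let itgGG (g h : G) : itg Q (fun y => set_val g y * set_val h y).
Proof.
apply: (@itg_bnd _ _ _ _ _ (b * b)) => [|y]; first by apply: measurable_funM; exact: Gm.
by rewrite normrM ler_pM//; exact: Gb.
Qed.

Let cov_of_le s t : cov_of s s - 2 * cov_of s t + cov_of t t <= sqdist Q s t.
Proof.
have -> : sqdist Q s t = Ex Q (fun y => set_val s y * set_val s y) -
    2 * Ex Q (fun y => set_val s y * set_val t y) + Ex Q (fun y => set_val t y * set_val t y).
  rewrite -ExZ// -ExB//; last exact: itgZ.
  rewrite -ExD//; last by apply: itgB => //; exact: itgZ.
  by congr (Ex Q _); apply/funext => y; ring.
rewrite /cov_of; have := sqr_ge0 (Ex Q (set_val s) - Ex Q (set_val t)).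
set x1 := Ex Q _; set x2 := Ex Q _; set x3 := Ex Q _; set x4 := Ex Q _; set x5 := Ex Q _.
by rewrite expr2; nra.
Qed.

Let emp_cov_le (x : n.-tuple S) (s t : G) :
  emp_cov x s s - 2 * emp_cov x s t + emp_cov x t t <= emp x (sqd s t).
Proof.
have -> : emp x (sqd s t) = emp x (fun y => set_val s y * set_val s y) -
    2 * emp x (fun y => set_val s y * set_val t y) + emp x (fun y => set_val t y * set_val t y).
  rewrite -empZ -mulN1r -empZ -!empD; congr (emp x _); apply/funext => y.
  by rewrite /sqd; ring.
rewrite /emp_cov; have := sqr_ge0 (emp x (set_val s) - emp x (set_val t)).
set x1 := emp x _; set x2 := emp x _; set x3 := emp x _; set x4 := emp x _; set x5 := emp x _.
by rewrite expr2; nra.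
Qed.

(** The empirical measure is finitely discrete, so [entropy_discrete] applies without
    quantization. *)
Let entropy_emp m (y : 'I_m -> S) (F : seq G) tau : (0 < m)%N -> 0 < tau < 1 ->
  exists pit : G -> G,
  (forall g, g \in F -> (\sum_i sqd g (pit g) (y i)) / m%:R <= 8 * b ^+ 2 * tau ^+ 2) /\
  (size (undup (map pit F)))%:R <= 2 * (a / tau) `^ v.
Proof.
case: m y => // m y _ t01.
have mR : 0 < m.+1%:R :> R by rewrite ltr0n.
have [||//|k [c [r [kN H]]]] := @entropy_discrete R _ S G b a v b0 a0 Gmeas GVC m y (fun=> m.+1%:R^-1) tau.
- by move=> i; rewrite invr_ge0.
- by rewrite sumr_const card_ord -(mulr_natr m.+1%:R^-1) mulVf// gt_eqF.
exists (fun g => c (r g)); split.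
  move=> g _; have := H g; rewrite -mulr_sumr mulrC => /le_trans; apply.
  by rewrite -mulrA ler_peMl ?ler1n// mulr_ge0 ?sqr_ge0.
apply: le_trans kN; rewrite ler_nat.
have -> : k = size [seq c i | i : 'I_k] by rewrite size_map size_enum_ord.
apply: uniq_leq_size; first exact: undup_uniq.
by move=> g; rewrite mem_undup => /mapP[h _ ->]; apply: map_f; rewrite mem_enum.
Qed.

(** The constant is 870 = 400 + 400 + 70: one reduction to the net for each supremum, and one
    Gaussian comparison on the net. The set is chosen before the sample point and the test function,
    as the dual form of the Wasserstein distance requires. *)
Lemma core_comparison (g0 : G) : exists S0 : set (n.-tuple S),
  [/\ measurable S0, ((1 - 3 / n%:R)%:E <= P (rvec X @^-1` S0))%E &
  forall x, S0 x -> forall (f : R -> R) (m Mf : R),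
    (forall x y, `|f x - f y| <= `|x - y|) -> (forall x, `|f x| <= Mf) ->
    (forall x, x <= m -> f x = 0) ->
    `|Ex P (fun w => f (W_tilde G x (fun i => xi i w))) - Ex PB (fun w => f (supnorm (B w)))| <=
    870 * fourth_root_term n b sigma K].
Proof.
have [S0 [T [mS0 PS0 TN H]]] := sample_event b0 ea v1 n4 Gmeas GVC Ka Kn sigma0 bK mX iX lX Qsig GPM g0.
exists S0; split => // x xS0 f m Mf fL fM f0.
have [Hcov Hnet] := H x xS0.
have /choice[pi piP] : forall g : G, exists t, [/\ t \in T, sqdist Q g t <= 32 * b ^+ 2 / n%:R &
    emp x (sqd g t) <= 320 * b ^+ 2 * K / n%:R].
  by move=> g; have [t tT [h1 h2]] := Hnet g; exists t.
have piT g : pi g \in T by have [] := piP g.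
have T0 : (0 < size T)%N by case: (T) (piT g0).
have p1 : 1 <= net_size a v n by apply: le_trans TN; rewrite ler1n.
have lp32 := ln_net_size ea v1 n4 Ka Kn.
have lp : ln (net_size a v n) <= K / 8 by apply: (le_trans lp32); move: K0 => *; lra.
have [tB _ _ _] := gB.
pose Z := multiplier xi x (G := G).
have gZ := gvec_multiplier x mxi ixi lxi n0 (G := G).
have gBB := gvec_tight g0 gB covE.
have red1 : `|Ex P (fun w => f (W_tilde G x (fun i => xi i w))) -
    Ex P (fun w => f (seqmax T (fun g => `|Z g w|)))| <= 400 * (b * K / Num.sqrt n%:R).
  apply: (process_reduction gZ (emp_cov_le x) _ _ n4 b0 ea v1 Ka Kn _ piT _ p1 TN lp fL fM _).
  - by move=> s t; congr (emp x _); apply/funext => y; rewrite /sqd -[LHS]sqrrN opprB.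
  - move=> s t q; rewrite -!empZ -empD; apply: emp_le => y; exact: sqrB_le.
  - by move=> F tau t01; exact: (entropy_emp (tnth x) F n0 t01).
  - by move=> g; have [] := piP g.
  - by move=> e e0; exact: (W_tilde_approx x g0 mxi ixi lxi n0 Gb fL fM e0).
have red2 : `|Ex PB (fun w => f (supnorm (B w))) -
    Ex PB (fun w => f (seqmax T (fun g => `|B w g : R|)))| <= 400 * (b * K / Num.sqrt n%:R).
  apply: (@process_reduction R _ _ _ PB (fun g w => B w g : R) cov_of (sqdist Q)
    (fun w => supnorm (B w)) f Mf T pi a b v K (net_size a v n) n gBB cov_of_le _ _ n4 b0 ea v1 Ka Kn _ piT _ p1 TN lp fL fM _).
  - exact: sqdistC.
  - exact: (sqdist_tri b0 Gmeas GVC Q).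
  - by move=> F tau t01; exact: (entropy_prob b0 a0 Gmeas GVC Q F t01).
  (* The population distance to the net is of order b^2 / n; the larger bound with the factor K is
     the one available for the empirical distance, and both processes are treated by the same
     lemma. *)
  - move=> g; have [_ h _] := piP g; apply: (le_trans h).
    rewrite ler_wpM2r ?invr_ge0 ?(ltW nR)// -(mulrA 320).
    have e1 : b ^+ 2 <= b ^+ 2 * K by rewrite ler_peMr ?sqr_ge0//; move: K128 => *; lra.
    by have := sqr_ge0 b; move: (b ^+ 2) (b ^+ 2 * K) e1 => *; lra.
  - by move=> e e0; exact: (tight_approx g0 tB fL fM e0).
pose tt (i : 'I_(size T)) := tnth (in_tuple T) i.
have mid : `|Ex P (fun w => f (seqmax T (fun g => `|Z g w|))) -
    Ex PB (fun w => f (seqmax T (fun g => `|B w g : R|)))| <= 70 * fourth_root_term n b sigma K.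
  have E1 : (fun w => f (seqmax T (fun g => `|Z g w|))) = (fun w => f (maxabs ((fun i => Z (tt i)) ^~ w))).
    by apply/funext => w; rewrite /seqmax /maxabs big_tnth.
  have E2 : (fun w => f (seqmax T (fun g => `|B w g : R|))) = (fun w => f (maxabs ((fun i w => B w (tt i) : R) ^~ w))).
    by apply/funext => w; rewrite /seqmax /maxabs big_tnth.
  rewrite E1 E2.
  apply: (gaussian_comparison T0 (gZ _ tt) (gBB _ tt) (D := 24 * b * sigma * Num.sqrt (K / n%:R)) _ fL fM f0 _ (K := K)).
  - by move=> i j; apply: Hcov; exact: mem_tnth.
  - exact: fourth_root_term_gt0.
  - by move: K128 => *; lra.
  - have ln2 : ln 2 <= 1 :> R.
      by rewrite -ler_expR lnK ?posrE//; have := expR_ge1Dx (1 : R); lra.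
    have sT : 0 < (size T)%:R :> R by rewrite ltr0n.
    rewrite lnM ?posrE//.
    have : ln (size T)%:R <= ln (net_size a v n) :> R by rewrite ler_ln ?posrE// (lt_le_trans _ p1).
    by move: ln2 lp32 K128; move: (ln 2 : R) (ln _) (ln _) => *; lra.
  - exact: comparison_rate.
have rate := chaining_rate b0 sigma0 K0 n0 bK.
move: red1 red2 mid rate.
set A1 := Ex P _; set A2 := Ex P _; set A3 := Ex PB _; set A4 := Ex PB _.
move=> r1 r2 md rt.
have := ler_distD A2 A1 A3; have := ler_distD A4 A2 A3; rewrite (distrC A4 A3).
move: r1 r2 md rt; move: (b * K / _) (fourth_root_term n b sigma K) => *; lra.
Qed.

End core.

(** * Quantile coupling *)

Lemma prob_union_le (R : realType) d (W : measurableType d) (P : probability W R)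
    (A : nat -> set W) (c : \bar R) : (forall k, measurable (A k)) ->
  (forall k l, (k <= l)%N -> A k `<=` A l) -> (forall k, (P (A k) <= c)%E) ->
  (P (\bigcup_k A k) <= c)%E.
Proof.
move=> mA nd Ac.
have ndF : nondecreasing_seq A by move=> k l kl; apply/subsetPset; exact: nd.
have cv := nondecreasing_cvg_mu mA (bigcup_measurable (fun k _ => mA k)) ndF (mu := P).
rewrite -(cvg_lim (@ereal_hausdorff R) cv); apply: lime_le.
  by apply/cvg_ex; eexists; exact: cv.
exact: nearW.
Qed.

Section distribution_function.
Context (R : realType) d (W : measurableType d) (P : probability W R) (V : W -> R).
Hypothesis mV : measurable_fun setT V.

Definition dfun (y : R) : R := fine (P [set w | V w <= y]).

Lemma measurable_le_set (c : R) : measurable [set w | V w <= c].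
Proof.
have := measurableC (measurable_gt_set c mV); congr measurable.
by apply/seteqP; split => w /=; [move/negP; rewrite -leNgt|move=> h; apply/negP; rewrite -leNgt].
Qed.

Lemma dfunE y : (dfun y)%:E = P [set w | V w <= y].
Proof. by rewrite fineK// fin_num_measure//; exact: measurable_le_set. Qed.

Lemma dfunC y : P [set w | y < V w] = (1 - dfun y)%:E.
Proof.
rewrite EFinB dfunE -probability_setC; last exact: measurable_le_set.
by congr (P _); apply/seteqP; split => w /=; [move=> h; apply/negP; rewrite -ltNge|move/negP; rewrite -ltNge].
Qed.

Lemma dfun_le x y : x <= y -> dfun x <= dfun y.
Proof.
move=> xy; rewrite -lee_fin !dfunE; apply: le_measure; rewrite ?inE; try exact: measurable_le_set.
by move=> w /= h; exact: le_trans xy.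
Qed.

Lemma dfun_ge0 y : 0 <= dfun y.
Proof. by rewrite -lee_fin dfunE. Qed.

Lemma dfun_le1 y : dfun y <= 1.
Proof. by rewrite -lee_fin dfunE; apply: probability_le1; exact: measurable_le_set. Qed.

Let inv_le k l : (k <= l)%N -> (l.+1%:R)^-1 <= (k.+1%:R)^-1 :> R.
Proof. by move=> kl; rewrite lef_pV2 ?posrE// ler_nat ltnS. Qed.
Let inv_lt (e : R) : 0 < e -> exists k, (k.+1%:R)^-1 < e :> R.
Proof.
move=> e0; exists (Num.truncn e^-1); rewrite invf_plt ?posrE//; exact: truncnS_gt.
Qed.

Lemma dfun_right y c : (forall y', y < y' -> c <= dfun y') -> c <= dfun y.
Proof.
move=> H; have : (P [set w | (y < V w)%R] <= (1 - c)%:E)%E.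
  rewrite (_ : [set w | _] = \bigcup_k [set w | y + (k.+1%:R)^-1 < V w]); last first.
    apply/seteqP; split => w /= [].
      rewrite -subr_gt0 => /inv_lt [k hk].
      by exists k => //=; rewrite -ltrBrDl.
    by move=> k _ /=; apply: lt_trans; rewrite ltrDl.
  apply: prob_union_le => [k|k l kl w /=|k]; first exact: measurable_gt_set.
    by apply: le_lt_trans; rewrite lerD2l inv_le.
  by rewrite dfunC lee_fin lerD2l lerN2; apply: H; rewrite ltrDl.
by rewrite dfunC lee_fin lerD2l lerN2.
Qed.

Lemma dfun_left y c : (forall y', y' < y -> dfun y' <= c) -> (P [set w | (V w < y)%R] <= c%:E)%E.
Proof.
move=> H.
rewrite (_ : [set w | _] = \bigcup_k [set w | V w <= y - (k.+1%:R)^-1]); last first.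
  apply/seteqP; split => w /=.
    rewrite -subr_gt0 => /inv_lt [k hk].
    by exists k => //=; rewrite lerBrDr -lerBrDl ltW.
  by move=> [k _ /=] /le_lt_trans; apply; rewrite ltrBlDr ltrDl.
apply: prob_union_le => [k|k l kl w /=|k]; first exact: measurable_le_set.
  by move=> /le_trans; apply; rewrite lerD2l lerN2 inv_le.
by rewrite -dfunE lee_fin; apply: H; rewrite ltrBlDr ltrDl.
Qed.

Lemma dfun_top c : c < 1 -> exists y, c < dfun y.
Proof.
move=> c1; apply: contrapT => /forallNP H.
have : (P [set: W] <= c%:E)%E; last by rewrite probability_setT lee_fin leNgt c1.
rewrite (_ : setT = \bigcup_k [set w | V w <= k%:R]); last first.
  apply/seteqP; split => // w _; exists (Num.truncn (V w)).+1 => //=.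
  exact: ltW (truncnS_gt _).
apply: prob_union_le => [k|k l kl w /=|k]; first exact: measurable_le_set.
  by move=> /le_trans; apply; rewrite ler_nat.
by rewrite -dfunE lee_fin leNgt; apply/negP; exact: H.
Qed.

Lemma dfun_bot c : 0 < c -> exists y, dfun y < c.
Proof.
move=> c0; apply: contrapT => /forallNP H.
have : (P [set: W] <= (1 - c)%:E)%E; last by rewrite probability_setT lee_fin lerBrDr gerDl leNgt c0.
rewrite (_ : setT = \bigcup_k [set w | - k%:R < V w]); last first.
  apply/seteqP; split => // w _; exists (Num.truncn (- V w)).+1 => //=.
  by rewrite ltrNl; exact: truncnS_gt.
apply: prob_union_le => [k|k l kl w /=|k]; first exact: measurable_gt_set.
  by apply: le_lt_trans; rewrite lerN2 ler_nat.
by rewrite dfunC lee_fin lerD2l lerN2 leNgt; apply/negP; exact: H.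
Qed.

Lemma measurable_dfun : measurable_fun setT dfun.
Proof.
apply: (measurability (@RGenOInfty.G R)); first exact: RGenOInfty.measurableE.
move=> _ [_ [c ->] <-]; rewrite setTI; apply: is_interval_measurable.
move=> x y /=; rewrite !in_itv/= !andbT => cx cy z /andP[xz zy].
by rewrite in_itv/= andbT; apply: (lt_le_trans cx); apply: dfun_le.
Qed.

Definition quantile (u : R) : R := inf [set y | u <= dfun y].

(** The Galois connection between a distribution function and its quantile function. Right
    continuity puts the infimum into the set, and 0 < u < 1 makes the set nonempty and bounded
    below. *)
Lemma quantile_le u y : 0 < u < 1 -> (quantile u <= y) = (u <= dfun y).
Proof.
move=> /andP[u0 u1]; have [y1 /ltW uy1] := dfun_top u1; have [y0 uy0] := dfun_bot u0.
have ne : [set y | u <= dfun y] !=set0 by exists y1.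
have lb : has_lbound [set y | u <= dfun y].
  exists y0 => x /= ux; rewrite leNgt; apply/negP => xy0.
  by have := lt_le_trans uy0 ux; rewrite ltNge (dfun_le (ltW xy0)).
apply/idP/idP => [qy|uy]; last exact: (ge_inf lb).
apply: dfun_right => y' yy'; have [z /= uz zy'] := inf_lt ne (le_lt_trans qy yy').
by apply: (le_trans uz); apply: dfun_le; exact: ltW.
Qed.

Hypothesis atomless : forall y, P [set w | V w = y] = 0%E.

(** Without atoms the distribution function takes the value u at the supremum [ys] of the set where
    it is at most u, and the event becomes V <= ys. *)
Let dfun_V_le u : 0 < u < 1 -> P [set w | dfun (V w) <= u] = u%:E.
Proof.
move=> /andP[u0 u1]; have [y1 uy1] := dfun_top u1; have [y0 /ltW uy0] := dfun_bot u0.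
pose E := [set y | dfun y <= u]; pose ys := sup E.
have neE : E !=set0 by exists y0.
have hs : has_sup E.
  split => //; exists y1 => x /= xu; rewrite leNgt; apply/negP => y1x.
  by have := lt_le_trans uy1 (dfun_le (ltW y1x)); rewrite ltNge xu.
have ys_le : dfun ys <= u.
  rewrite -lee_fin dfunE.
  rewrite (_ : [set w | _] = [set w | V w < ys] `|` [set w | V w = ys]); last first.
    apply/seteqP; split => w /=; first by rewrite le_eqVlt => /orP[/eqP|]; [right|left].
    by move=> [/ltW//|->].
  have m1 : measurable [set w | V w < ys].
    rewrite (_ : [set w | _] = [set w | - ys < - V w]); last by apply/seteqP; split => w /=; rewrite ltrN2.
    by apply: measurable_gt_set; exact: measurableT_comp.
  have m2 : measurable [set w | V w = ys] by exact: (measurable_preimT mV (measurable_set1 ys)).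
  apply: (@le_trans _ _ (P [set w | (V w < ys)%R] + P [set w | V w = ys])%E).
    exact: measureU2.
  rewrite atomless adde0; apply: dfun_left => y' y'ys.
  by have [z /= zu y'z] := sup_gt neE y'ys; apply: le_trans zu; apply: dfun_le; exact: ltW.
have ys_ge : u <= dfun ys.
  apply: dfun_right => y' ysy'; rewrite leNgt; apply/negP => lt.
  have : y' <= ys by apply: (ub_le_sup hs.2); exact: ltW.
  by rewrite leNgt ysy'.
rewrite (_ : [set w | _] = [set w | V w <= ys]).
  by rewrite -dfunE; congr (_%:E); apply/eqP; rewrite eq_le ys_le ys_ge.
apply/seteqP; split => w /= h; first exact: (ub_le_sup hs.2).
by apply: le_trans ys_le; exact: dfun_le.
Qed.

Let mdV : measurable_fun setT (fun w => dfun (V w)).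
Proof. exact: (measurableT_comp measurable_dfun mV). Qed.

Let mdV_le c : measurable [set w | dfun (V w) <= c].
Proof.
have := measurableC (measurable_gt_set c mdV); congr measurable.
by apply/seteqP; split => w /=; [move/negP; rewrite -leNgt|move=> h; apply/negP; rewrite -leNgt].
Qed.

Let dfun_V_le0 : P [set w | dfun (V w) <= 0] = 0%E.
Proof.
apply/eqP; rewrite eq_le measure_ge0 andbT; apply/lee_addgt0Pr => e e0; rewrite add0e.
pose u := Num.min e (1 / 2).
have u01 : 0 < u < 1 by rewrite /u lt_min e0 gt_min /=; apply/andP; split; [lra|apply/orP; right; lra].
apply: (@le_trans _ _ u%:E); last by rewrite lee_fin ge_min lexx.
rewrite -(dfun_V_le u01); apply: le_measure; rewrite ?inE//.
by move=> w /= h; apply: (le_trans h); case/andP: u01 => /ltW.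
Qed.

Lemma dfun_uniform u : 0 <= u <= 1 -> P [set w | dfun (V w) <= u] = u%:E.
Proof.
move=> /andP[u0 u1]; have [->|u0'] := eqVneq u 0; first exact: dfun_V_le0.
have [->|u1'] := eqVneq u 1.
  rewrite (_ : [set w | _] = setT) ?probability_setT//.
  by apply/seteqP; split => // w _; exact: dfun_le1.
by apply: dfun_V_le; rewrite !lt_neqAle eq_sym u0' u0 u1' u1.
Qed.

(** The event on which the quantile at [dfun (V w)] is a genuine infimum. It has full probability
    when V has no atoms, by [dfun_outer]. *)
Definition dfun_inner : set W := [set w | 0 < dfun (V w) < 1].

Lemma measurable_dfun_inner : measurable dfun_inner.
Proof.
rewrite (_ : dfun_inner = [set w | 0 < dfun (V w)] `&` [set w | - 1 < - dfun (V w)]); last first.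
  by apply/seteqP; split => w /=; rewrite /dfun_inner/= ltrN2; [move=> /andP[]|move=> [-> ->]].
by apply: measurableI; apply: measurable_gt_set => //; exact: measurableT_comp.
Qed.

Lemma dfun_outer : P (~` dfun_inner) = 0%E.
Proof.
have m1 : measurable [set w | 1 <= dfun (V w)].
  rewrite (_ : [set w | _] = [set w | - dfun (V w) <= - 1]); last by apply/seteqP; split => w /=; rewrite lerN2.
  have mN : measurable_fun setT (fun w => - dfun (V w)) by exact: measurableT_comp.
  have := measurableC (measurable_gt_set (-1) mN); congr measurable.
  by apply/seteqP; split => w /=; [move/negP; rewrite -leNgt|move=> h; apply/negP; rewrite -leNgt].
have p1 : P [set w | 1 <= dfun (V w)] = 0%E.
  apply/eqP; rewrite eq_le measure_ge0 andbT; apply/lee_addgt0Pr => e e0; rewrite add0e.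
  pose u := Num.min e (1 / 2).
  have u01 : 0 <= 1 - u <= 1.
    rewrite /u subr_ge0 ge_min gerDl oppr_le0 le_min (ltW e0)/=.
    by apply/andP; split; [apply/orP; right; lra|lra].
  have u0 : 0 < u by rewrite /u lt_min e0/=; lra.
  apply: (@le_trans _ _ u%:E); last by rewrite lee_fin ge_min lexx.
  apply: (@le_trans _ _ (P (~` [set w | (dfun (V w) <= 1 - u)%R]))).
    apply: le_measure; rewrite ?inE//; first exact: measurableC.
    move=> w /= h; apply/negP; rewrite -ltNge; apply: lt_le_trans h.
    by rewrite ltrBlDr ltrDl.
  by rewrite probability_setC// (dfun_uniform u01) -EFinB lee_fin opprB addrC subrK.
rewrite (_ : ~` dfun_inner = [set w | dfun (V w) <= 0] `|` [set w | 1 <= dfun (V w)]); last first.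
  apply/seteqP; split => w; rewrite /dfun_inner/=.
    by move/negP; rewrite negb_and -!leNgt => /orP[]; [left|right].
  by move=> H; apply/negP; rewrite negb_and -!leNgt; apply/orP.
apply/eqP; rewrite eq_le measure_ge0 andbT.
apply: (@le_trans _ _ (P [set w | (dfun (V w) <= 0)%R] + P [set w | (1 <= dfun (V w))%R])%E).
  exact: measureU2.
by rewrite dfun_V_le0 p1 adde0.
Qed.

End distribution_function.

Lemma same_law_half_lines (R : realType) d1 d2 (W1 : measurableType d1) (W2 : measurableType d2)
    (P1 : probability W1 R) (P2 : probability W2 R) (Y1 : W1 -> R) (Y2 : W2 -> R) :
  measurable_fun setT Y1 -> measurable_fun setT Y2 ->
  (forall y, P1 [set w | y < Y1 w] = P2 [set w | y < Y2 w]) -> same_law P1 Y1 P2 Y2.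
Proof.
move=> mY1 mY2 E A mA.
pose mu1 : {measure set R -> \bar R} := pushforward P1 Y1.
pose mu2 : {measure set R -> \bar R} := pushforward P2 Y2.
have half d (W : measurableType d) (Y : W -> R) (y : R) : Y @^-1` `]y, +oo[ = [set w | y < Y w].
  by apply/seteqP; split => w /=; rewrite in_itv/= andbT.
change (mu1 mY1 A = mu2 mY2 A).
apply: (@measure_unique _ R _ (@RGenOInfty.G R) (fun k => `]- k%:R, +oo[%classic)
  (RGenOInfty.measurableE R) _ _ _ (mu1 mY1) (mu2 mY2)) => //.
- move=> _ _ [x1 ->] [x2 ->]; exists (Num.max x1 x2).
  by apply/seteqP; split => w /=; rewrite !in_itv/= !andbT gt_max; [move=> [-> ->]|move=> /andP[]].
- by move=> k; exists (- k%:R).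
- apply/seteqP; split => // w _; exists (Num.truncn (- w)).+1 => //=.
  by rewrite in_itv/= andbT ltrNl; exact: truncnS_gt.
- move=> _ [x ->]; change (P1 (Y1 @^-1` `]x, +oo[) = P2 (Y2 @^-1` `]x, +oo[)).
  by rewrite !half.
- move=> k; change (P1 (Y1 @^-1` `](- k%:R)%R, +oo[%classic) < +oo)%E.
  by apply: le_lt_trans (ltry 1); apply: probability_le1; exact: measurable_preimT.
Qed.

Section monotone_coupling.
Context (R : realType) d (W : measurableType d) (P : probability W R) (V : W -> R)
  dB (WB : measurableType dB) (PB : probability WB R) (N : WB -> R).
Hypothesis mV : measurable_fun setT V.
Hypothesis mN : measurable_fun setT N.
Hypothesis atomless : forall y, P [set w | V w = y] = 0%E.
Notation F := (dfun P V).
Notation G := (dfun PB N).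
Notation inner := (dfun_inner P V).
Notation mu := (@lebesgue_measure R).

(** The value 0 is a default on the null event where the quantile is not meaningful. *)
Definition monotone_coupling (w : W) : R :=
  if 0 < F (V w) < 1 then quantile PB N (F (V w)) else 0.
Notation W0 := monotone_coupling.

Lemma monotone_coupling_le w y : inner w -> (W0 w <= y) = (F (V w) <= G y).
Proof. by rewrite /dfun_inner/= /W0 => iw; rewrite iw quantile_le. Qed.

Let minner := measurable_dfun_inner P mV.

Let mF : measurable_fun setT (fun w => F (V w)).
Proof. exact: (measurableT_comp (measurable_dfun P mV) mV). Qed.

Lemma measurable_monotone_coupling : measurable_fun setT W0.
Proof.
apply: (measurability (@RGenOInfty.G R)); first exact: RGenOInfty.measurableE.
move=> _ [_ [c ->] <-]; rewrite setTI.
have mB : measurable [set w : W | c < 0].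
  by have [c0|c0] := ltP c 0; [rewrite (_ : [set w | _] = setT)|rewrite (_ : [set w | _] = set0)];
    try (by []); apply/seteqP; split.
rewrite (_ : _ @^-1` _ = (inner `&` [set w | G c < F (V w)]) `|` (~` inner `&` [set w | c < 0])).
  apply: measurableU; apply: measurableI => //; [exact: measurable_gt_set|exact: measurableC].
apply/seteqP; split => w /=; rewrite in_itv/= andbT.
- have [iw|iw] := pselect (inner w); first by rewrite ltNge monotone_coupling_le// -ltNge; left.
  by rewrite /W0; case: ifPn => [//|_]; right.
- case=> -[iw] h; first by rewrite ltNge monotone_coupling_le// -ltNge.
  by move: h; rewrite /W0; case: ifPn.
Qed.

Let inner_ae A B : measurable A -> measurable B -> inner `&` A = inner `&` B -> P A = P B.
Proof.
have aux C D : measurable C -> measurable D -> inner `&` C = inner `&` D -> (P C <= P D)%E.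
  move=> mC mD CD; apply: (@le_trans _ _ (P (D `|` ~` inner))).
    apply: le_measure; rewrite ?inE//; first by apply: measurableU => //; exact: measurableC.
    move=> w Cw; have [iw|iw] := pselect (inner w); last by right.
    by left; have : (inner `&` C) w by []; rewrite CD => -[].
  apply: (@le_trans _ _ (P D + P (~` inner))%E).
    by apply: measureU2 => //; exact: measurableC.
  by rewrite dfun_outer// adde0.
by move=> mA mB AB; apply/eqP; rewrite eq_le !aux.
Qed.

Lemma same_law_monotone_coupling : same_law P W0 PB N.
Proof.
apply: same_law_half_lines => // [|y]; first exact: measurable_monotone_coupling.
rewrite [RHS]dfunC// [LHS](inner_ae (B := [set w | G y < F (V w)])).
- rewrite (_ : [set w | _] = ~` [set w | F (V w) <= G y]); last first.
    by apply/seteqP; split => w /=; [move=> h; apply/negP; rewrite -ltNge|move/negP; rewrite -ltNge].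
  rewrite probability_setC; last exact: measurable_le_set.
  by rewrite dfun_uniform ?dfun_ge0 ?dfun_le1.
- exact: measurable_gt_set measurable_monotone_coupling.
- exact: measurable_gt_set.
- by apply/seteqP; split => w /= [iw]; rewrite !ltNge monotone_coupling_le.
Qed.

Section test_function.
Variable M : R.
Hypothesis M0 : 0 <= M.

(** Truncation to a bounded interval makes [crossing] bounded and zero to the left of -M, as the
    comparison of expectations demands of a test function. *)
Let I : set R := `[- M, M[%classic.
Let A : set R := I `&` [set x | 0 < F x - G x].
Let B : set R := I `&` ~` [set x | 0 < F x - G x].
Let fmu (C : set R) : R := fine (mu C).

Let mI : measurable I. Proof. exact: measurable_itv. Qed.
Let mA0 : measurable [set x : R | 0 < F x - G x].
Proof. by apply: measurable_gt_set; apply: measurable_funB; exact: measurable_dfun. Qed.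
Let mA : measurable A. Proof. exact: measurableI. Qed.
Let mB : measurable B. Proof. by apply: measurableI => //; exact: measurableC. Qed.
Let muJ (y y' : R) : y <= y' -> mu `[y, y'[ = (y' - y)%:E.
Proof.
move=> yy'; rewrite lebesgue_measure_itv/= lte_fin; case: ifPn => [_//|].
rewrite -leNgt => y'y; congr (_%:E); apply/esym/eqP; rewrite subr_eq0; apply/eqP.
by apply: le_anti; rewrite yy' y'y.
Qed.
Let muI : mu I = (M + M)%:E.
Proof. by rewrite /I muJ ?opprK// (le_trans _ M0)// oppr_le0. Qed.
Let fin_I C : measurable C -> C `<=` I -> mu C \is a fin_num.
Proof.
move=> mC CI; rewrite ge0_fin_numE//; apply: le_lt_trans (ltry (M + M)).
by rewrite -muI; apply: le_measure; rewrite ?inE.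
Qed.
Let fmu_le C D : measurable C -> measurable D -> (mu D < +oo)%E -> C `<=` D -> fmu C <= fmu D.
Proof.
move=> mC mD Doo CD; have le : (mu C <= mu D)%E by apply: le_measure; rewrite ?inE.
by apply: fine_le => //; rewrite ge0_fin_numE//; exact: le_lt_trans Doo.
Qed.
Let fmuU C D : measurable C -> measurable D -> C `<=` I -> D `<=` I -> C `&` D = set0 ->
  fmu (C `|` D) = fmu C + fmu D.
Proof.
move=> mC mD CI DI CD; rewrite /fmu measureU//.
by rewrite fineD//; exact: fin_I.
Qed.
Let fmuJ y y' : y <= y' -> fmu `[y, y'[ = y' - y.
Proof. by move=> yy'; rewrite /fmu muJ. Qed.
Let fmuIJ_le y y' : y <= y' -> fmu (I `&` `[y, y'[) <= y' - y.
Proof.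
move=> yy'; rewrite -(fmuJ yy'); apply: fmu_le => //; first exact: measurableI.
by rewrite muJ ?ltry.
Qed.
Let fmuIJ_leI y y' : fmu (I `&` `[y, y'[) <= M + M.
Proof.
have -> : M + M = fmu I by rewrite /fmu muI.
by apply: fmu_le => //; [exact: measurableI|rewrite muI ltry].
Qed.
Let fmu_ge0 C : 0 <= fmu C. Proof. exact: fine_ge0. Qed.

Let occ C y := fmu (C `&` `]-oo, y[).
Let occ_incr C y y' : measurable C -> C `<=` I -> y <= y' ->
  occ C y' - occ C y = fmu (C `&` `[y, y'[).
Proof.
move=> mC CI yy'; rewrite /occ.
have -> : C `&` `]-oo, y'[ = (C `&` `]-oo, y[) `|` (C `&` `[y, y'[).
  rewrite -setIUr; congr (_ `&` _); apply/seteqP; split => x /=; rewrite !in_itv/=.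
    by move=> xy'; have [xy|yx] := ltP x y; [left|right].
  by case=> [xy|/andP[]//]; exact: lt_le_trans yy'.
rewrite fmuU; [by rewrite addrC addKr|exact: measurableI|exact: measurableI| | |].
- by move=> x [/CI].
- by move=> x [/CI].
- by rewrite setIACA setIid; apply/seteqP; split => // x [_ []] /=; rewrite !in_itv/= leNgt => ->.
Qed.

(* The function increases at unit speed where [G < F] and decreases at unit
   speed where [F <= G]; the quantile coupling carries [V] to [W0] across the
   former when [V < W0] and across the latter when [W0 < V]. *)
Definition crossing (y : R) : R := occ A y - occ B y.

Let incr y y' : y <= y' ->
  crossing y' - crossing y = fmu (A `&` `[y, y'[) - fmu (B `&` `[y, y'[).
Proof.
move=> yy'; rewrite -!occ_incr//; first by rewrite /crossing; ring.
- by move=> x [].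
- by move=> x [].
Qed.
Let addAB (y y' : R) : fmu (A `&` `[y, y'[) + fmu (B `&` `[y, y'[) = fmu (I `&` `[y, y'[).
Proof.
rewrite -fmuU; [|exact: measurableI|exact: measurableI|by move=> x [[]]|by move=> x [[]]|].
  by congr (fmu _); rewrite -setIUl -setIUr setUv setIT.
by rewrite setIACA setIid /A /B setIACA setIid setICr setI0 set0I.
Qed.

Let crossing_diff y y' : y <= y' -> `|crossing y' - crossing y| <= fmu (I `&` `[y, y'[).
Proof.
move=> yy'; rewrite incr// -addAB.
have := fmu_ge0 (A `&` `[y, y'[); have := fmu_ge0 (B `&` `[y, y'[).
by move: (fmu _) (fmu _) => p q q0 p0; rewrite ler_norml; apply/andP; split; lra.
Qed.

Lemma crossing_lipschitz x y : `|crossing x - crossing y| <= `|x - y|.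
Proof.
wlog yx : x y / y <= x.
  by move=> H; have [/H//|/ltW /H] := leP y x; rewrite distrC [`|y - x|]distrC.
by rewrite [leRHS]ger0_norm ?subr_ge0//; apply: le_trans (fmuIJ_le yx); exact: crossing_diff.
Qed.

Lemma crossing_left (y : R) : y <= - M -> crossing y = 0.
Proof.
move=> yM; have E C : C `<=` I -> C `&` `]-oo, y[ = set0.
  move=> CI; apply/seteqP; split => // x [/CI]; rewrite /I /= !in_itv/= => /andP[Mx _] xy.
  by move: (lt_le_trans xy yM); rewrite ltNge Mx.
by rewrite /crossing /occ !E /fmu ?measure0 ?subrr// => x [].
Qed.

Lemma crossing_bounded y : `|crossing y| <= M + M.
Proof.
have [yM|/ltW My] := leP y (- M); first by rewrite crossing_left// normr0 addr_ge0.
rewrite -[X in `|X|]subr0 -(crossing_left (lexx _)).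
by apply: le_trans (fmuIJ_leI _ _); exact: crossing_diff.
Qed.

(** Between V and W0 the order of [F] and [G] is constant. If W0 <= x < V then F x <= F (V w) <= G
    x, and if V <= x < W0 then G x < F (V w) <= F x. Hence [crossing] gains the full length of the
    part of the interval inside the truncation. *)
Let crossing_inner w : inner w -> crossing (W0 w) - crossing (V w) =
  fmu (I `&` `[Num.min (W0 w) (V w), Num.max (W0 w) (V w)[).
Proof.
move=> iw; have [WV|VW] := leP (W0 w) (V w).
  rewrite -opprB incr// -addAB.
  suff -> : A `&` `[W0 w, V w[ = set0 by rewrite /fmu measure0/=; ring.
  apply/seteqP; split => // x [[_ /=]]; rewrite in_itv/= subr_gt0 => GF /andP[Wx xV].
  have := Wx; rewrite monotone_coupling_le// leNgt => /negP; apply.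
  by apply: (lt_le_trans GF); apply: dfun_le => //; exact: ltW.
rewrite incr ?ltW// -addAB.
suff -> : B `&` `[V w, W0 w[ = set0 by rewrite /fmu measure0/=; ring.
apply/seteqP; split => // x [[_ /= nGF]]; rewrite in_itv/= => /andP[Vx xW].
apply: nGF; rewrite subr_gt0; apply: lt_le_trans (dfun_le P mV Vx).
by rewrite ltNge -monotone_coupling_le// -ltNge.
Qed.

Lemma crossing_coupling_ge0 w : inner w -> 0 <= crossing (W0 w) - crossing (V w).
Proof. by move=> iw; rewrite crossing_inner. Qed.

Lemma crossing_couplingE w : inner w -> `|V w| <= M -> `|W0 w| <= M ->
  crossing (W0 w) - crossing (V w) = `|V w - W0 w|.
Proof.
move=> iw VM WM; rewrite crossing_inner// setIidr.
  by have [WV|/ltW VW] := leP (W0 w) (V w); rewrite fmuJ//; [|rewrite distrC]; rewrite ger0_norm ?subr_ge0.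
rewrite /I => x /=; rewrite !in_itv/= => /andP[h1 h2]; apply/andP; split.
  by apply: le_trans h1; rewrite le_min; move: VM WM; rewrite !ler_norml => /andP[-> _] /andP[-> _].
apply: (lt_le_trans h2); rewrite ge_max.
by move: VM WM; rewrite !ler_norml => /andP[_ ->] /andP[_ ->].
Qed.

End test_function.

(** [crossing] is a Kantorovich potential: its increment from V to W0 equals |V - W0| within the
    truncation and is nonnegative otherwise. Its expectation is a difference of expectations under
    the two laws, hence at most kap, and Markov's inequality applies. Truncation levels then tend to
    infinity. *)
Lemma monotone_coupling_tail (kap del : R) : 0 < del ->
  (forall (f : R -> R) (m Mf : R), (forall x y, `|f x - f y| <= `|x - y|) ->
     (forall x, `|f x| <= Mf) -> (forall x, x <= m -> f x = 0) ->
     `|Ex P (fun w => f (V w)) - Ex PB (fun w => f (N w))| <= kap) ->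
  (P [set w | (del < `|V w - W0 w|)%R] <= (kap / del)%:E)%E.
Proof.
move=> del0 H; have mW0 := measurable_monotone_coupling.
have mD : measurable_fun setT (fun w => `|V w - W0 w|).
  by apply: measurableT_comp => //; exact: measurable_funB.
pose E k := [set w | del < `|V w - W0 w|] `&` (~` [set w | k%:R < `|V w|] `&` ~` [set w | k%:R < `|W0 w|]).
have mE k : measurable (E k).
  apply: measurableI; first exact: measurable_gt_set.
  by apply: measurableI; apply: measurableC; apply: measurable_gt_set; exact: measurableT_comp.
have -> : [set w | del < `|V w - W0 w|] = \bigcup_k E k.
  apply/seteqP; split => w /=; last by move=> [k _ []].
  move=> dw; exists (Num.truncn (Num.max `|V w| `|W0 w|)).+1 => //.
  have := truncnS_gt (Num.max `|V w| `|W0 w|); rewrite gt_max => /andP[h1 h2].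
  by split => //; split => /=; apply/negP; rewrite -leNgt ltW.
apply: prob_union_le => // [k l kl w [dw [/= h1 h2]]|k].
  split=> //; split=> /= h; [apply: h1|apply: h2]; apply: le_lt_trans h; by rewrite ler_nat.
have k0 : 0 <= k%:R :> R by [].
pose f := crossing k%:R.
have fL := crossing_lipschitz k0; have fB := crossing_bounded k0.
have HH := H f (- k%:R) (k%:R + k%:R) fL fB (fun x => @crossing_left _ x).
have iW := lipschitz_itg P fL fB mW0; have iV := lipschitz_itg P fL fB mV.
have lawE : Ex P (fun w => f (W0 w)) = Ex PB (fun w => f (N w)).
  exact: (same_law_Ex mW0 mN same_law_monotone_coupling (lipschitz1_measurable fL)).
have mo : measurable (~` inner) by exact: measurableC.
have mEi : measurable (E k `&` inner) by exact: measurableI.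
rewrite (inner_ae (mE k) mEi); last by rewrite setICA setIid setIC.
rewrite -Ex_indic// lee_fin ler_pdivlMr// mulrC.
have i1 C : measurable C -> itg P (\1_C : W -> R).
  move=> mC; apply: (@itg_bnd _ _ _ _ _ 1) => // w.
  by rewrite indicE; case: (_ \in _); rewrite ?normr1 ?normr0.
have Eo : Ex P (\1_(~` inner)) = 0 by apply: EFin_inj; rewrite Ex_indic// dfun_outer.
have i2 : itg P (fun w => f (W0 w) - f (V w)) by exact: itgB.
(* Off [inner] the sign of the increment is unknown, but [crossing] is at most 2 k in absolute
   value; the term with [c] restores the pointwise inequality and has zero expectation. *)
pose c := (k%:R + k%:R) + (k%:R + k%:R) : R.
have i3 : itg P (fun w => c * \1_(~` inner) w) by apply: itgZ; exact: i1.
apply: (@le_trans _ _ (Ex P (fun w => (f (W0 w) - f (V w)) + c * \1_(~` inner) w))).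
  rewrite -ExZ; last exact: i1.
  apply: Ex_le; [by apply: itgZ; exact: i1|exact: itgD|] => w.
  have [iw|iw] := pselect (inner w).
    have -> : \1_(~` inner) w = 0 :> R by rewrite indicE memNset//; exact.
    rewrite mulr0 addr0; have [Ew|Ew] := pselect (E k w).
      have -> : \1_(E k `&` inner) w = 1 :> R by rewrite indicE mem_set.
      case: Ew => /= dw [/negP VM /negP WM]; rewrite -!leNgt in VM WM.
      by rewrite mulr1 crossing_couplingE// ltW.
    have -> : \1_(E k `&` inner) w = 0 :> R by rewrite indicE memNset// => -[].
    by rewrite mulr0; exact: crossing_coupling_ge0.
  have -> : \1_(~` inner) w = 1 :> R by rewrite indicE mem_set.
  have -> : \1_(E k `&` inner) w = 0 :> R by rewrite indicE memNset// => -[].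
  have := fB (W0 w); have := fB (V w); rewrite !ler_norml mulr0 mulr1 /c.
  rewrite -/f; by move: (f _) (f _) (k%:R) => p q r /andP[? ?] /andP[? ?]; lra.
rewrite ExD// ExB// ExZ; last exact: i1.
rewrite Eo mulr0 addr0 lawE; apply: le_trans HH; rewrite distrC; exact: ler_norm.
Qed.

End monotone_coupling.

(** * Removing atoms and coupling *)

Section coupling.
Context (R : realType) d (W : measurableType d) (P : probability W R) (V : W -> R)
  dB (WB : measurableType dB) (PB : probability WB R) (N : WB -> R).
Hypothesis mV : measurable_fun setT V.
Hypothesis mN : measurable_fun setT N.

Lemma nlaw1_set1 (z : R) : nlaw 1 [set z] = 0%E.
Proof.
rewrite nlawE /normal_law oner_eq0.
apply: (iffLR (null_content_dominatesP _ _) (normal_prob_dominates 0 1)).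
  exact: measurable_set1.
exact: lebesgue_measure_set1.
Qed.

Variable eta : R.
Hypothesis eta0 : 0 < eta.
Let P' := prodP P (nlaw 1 : probability R R).
(* The bounded noise makes the law of [V] atomless, as the quantile coupling requires. *)
Definition smoothed (w : W * R) : R := V w.1 + eta * expR (- expR w.2).

Lemma measurable_smoothed : measurable_fun setT smoothed.
Proof.
apply: measurable_funD; first exact: (measurableT_comp mV measurable_fst).
apply: measurable_funM => //; apply: measurableT_comp => //.
by apply: measurableT_comp => //; apply: measurableT_comp => //; exact: measurable_snd.
Qed.

Lemma smoothed_close w : `|smoothed w - V w.1| <= eta.
Proof.
rewrite /smoothed addrC addKr ger0_norm; last by rewrite mulr_ge0 ?expR_ge0// ltW.
by rewrite ler_piMr ?(ltW eta0)// -[leRHS]expR0 ler_expR oppr_le0 expR_ge0.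
Qed.

(** For a fixed first coordinate the noise is an injective function of the second one, so each
    section of the event has at most one point and is null for the normal law. *)
Lemma smoothed_atomless y : P' [set w | smoothed w = y] = 0%E.
Proof.
have mA : measurable [set w | smoothed w = y].
  exact: (measurable_preimT measurable_smoothed (measurable_set1 y)).
have b1 (w : W * R) : `|\1_[set w | smoothed w = y] w : R| <= 1.
  by rewrite indicE; case: (_ \in _); rewrite ?normr1 ?normr0.
rewrite -Ex_indic// (@Ex_fubini _ _ _ _ _ _ _ _ 1)//.
suff E x : Ex (nlaw 1) (fun z => \1_[set w | smoothed w = y] (x, z) : R) = 0.
  by rewrite (_ : (fun x => _) = fun=> 0) ?Ex_cst//; apply/funext.
pose C := [set z | smoothed (x, z) = y].
have mC : measurable C.
  have := measurable_preimT (measurableT_comp measurable_smoothed (measurable_pair1 x)) (measurable_set1 y).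
  by [].
have -> : (fun z => \1_[set w | smoothed w = y] (x, z) : R) = \1_C.
  by apply/funext => z; rewrite !indicE; congr (_%:R); congr nat_of_bool; apply/idP/idP; rewrite !inE.
apply: EFin_inj; rewrite Ex_indic//.
have [[z0 Cz0]|noz] := pselect (exists z, C z); last first.
  by rewrite (_ : C = set0) ?measure0//; apply/seteqP; split => // z Cz; apply: noz; exists z.
have CS : C `<=` [set z0].
  move=> z; move: Cz0; rewrite /C /smoothed/= => <- /addrI /(mulfI (lt0r_neq0 eta0)).
  by move=> /expR_inj /oppr_inj /expR_inj.
apply/eqP; rewrite eq_le measure_ge0 andbT.
apply: (@le_trans _ _ (nlaw 1 [set z0])); last by rewrite nlaw1_set1.
by apply: le_measure; rewrite ?inE//; exact: measurable_set1.
Qed.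

(** The noise moves V by at most eta; this is paid once in the threshold and once in the comparison
    of expectations. *)
Lemma lipschitz_coupling (kap del : R) : 0 < del ->
  (forall (f : R -> R) (m Mf : R), (forall x y, `|f x - f y| <= `|x - y|) ->
     (forall x, `|f x| <= Mf) -> (forall x, x <= m -> f x = 0) ->
     `|Ex P (fun w => f (V w)) - Ex PB (fun w => f (N w))| <= kap) ->
  exists W0 : W * R -> R, [/\ measurable_fun setT W0, same_law P' W0 PB N &
    (P' [set w | (eta + del < `|V w.1 - W0 w|)%R] <= ((kap + eta) / del)%:E)%E].
Proof.
move=> del0 H; have mS := measurable_smoothed.
have mV1 : measurable_fun setT (fun w : W * R => V w.1).
  exact: (measurableT_comp mV measurable_fst).
have mW0 := @measurable_monotone_coupling _ _ _ P' _ _ _ PB N mS mN.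
have tail : (P' [set w | (del < `|smoothed w - monotone_coupling P' smoothed PB N w|)%R]
    <= ((kap + eta) / del)%:E)%E.
  apply: monotone_coupling_tail => //; first exact: smoothed_atomless.
  move=> f m Mf fL fM fm.
  have h1 : `|Ex P' (fun w => f (smoothed w)) - Ex P' (fun w => f (V w.1))| <= eta.
    have := @lipschitz_Ex_le _ _ _ P' f Mf fL fM _ _ (fun=> eta) mS mV1 (itg_cst _ _) smoothed_close.
    by rewrite Ex_cst.
  have h2 : Ex P' (fun w => f (V w.1)) = Ex P (fun w => f (V w)).
    have law : same_law P' (fun w => V w.1) P V by exact: same_law_fst.
    exact: (same_law_Ex mV1 mV law (lipschitz1_measurable fL)).
  have h3 := H f m Mf fL fM fm; rewrite h2 in h1.
  rewrite [kap + _]addrC; apply: le_trans (lerD h1 h3).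
  by apply: le_trans (ler_normD _ _); rewrite addrA subrK.
exists (monotone_coupling P' smoothed PB N); split => //.
  by apply: same_law_monotone_coupling => //; exact: smoothed_atomless.
apply: le_trans tail; apply: le_measure; rewrite ?inE.
- apply: measurable_gt_set; apply: measurableT_comp => //; exact: measurable_funB.
- apply: measurable_gt_set; apply: measurableT_comp => //; exact: measurable_funB.
move=> w /= h; have := smoothed_close w; rewrite distrC => h'.
have := ler_distD (smoothed w) (V w.1) (monotone_coupling P' smoothed PB N w).
move=> h''; rewrite -(ltrD2l eta); apply: (lt_le_trans h); apply: (le_trans h''); by rewrite lerD2r.
Qed.

End coupling.

(** * Proof of the theorem *)

Lemma K_lower (R : realType) (A a b v sigma : R) (n : nat) :
  128 <= A -> 0 < b -> expR 1 <= a -> 1 <= v -> (0 < n)%N -> 0 < sigma -> sigma ^+ 2 <= b ^+ 2 ->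
  128 * (v * ln a) <= K_ A v n a b sigma /\ 128 * (v * ln n%:R) <= K_ A v n a b sigma.
Proof.
move=> A128 b0 ea v1 n0 s0 sb; have lna := ln_a_ge1 ea.
have a0 : 0 < a by apply: lt_le_trans ea; exact: expR_gt0.
have sb' : sigma <= b by rewrite -(@ler_pXn2r _ 2%N)// nnegrE ltW.
have v0 : 0 <= v by apply: le_trans v1.
have aux t : 0 <= t -> t <= Num.max (ln n%:R) (ln (a * b / sigma)) ->
    128 * (v * t) <= K_ A v n a b sigma.
  move=> t0 tm; rewrite /K_ -mulrA; apply: ler_pM => //; first exact: mulr_ge0.
  exact: ler_pM.
split; apply: aux.
- exact: le_trans lna.
(* Since sigma <= b, the ratio a b / sigma is at least a. *)
- rewrite le_max; apply/orP; right.
  rewrite ler_ln ?posrE ?divr_gt0 ?mulr_gt0//.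
  by rewrite -mulrA ler_peMr ?(ltW a0)// ler_pdivlMr// mul1r.
- by rewrite ln_ge0// ler1n.
- by rewrite le_max lexx.
Qed.

Lemma supnorm_empty (R : realType) (T : Type) (z : T -> R) : (T -> False) -> supnorm z = 0.
Proof.
move=> T0; rewrite /supnorm.
have -> : range (fun t => `|z t|) = set0; last exact: sup0.
by apply/seteqP; split => // y [t _ _]; case: (T0 t).
Qed.

Lemma expectationE (R : realType) d (W : measurableType d) (P : probability W R) (f : W -> R) :
  itg P f -> ('E_P[f] = (Ex P f)%:E)%E.
Proof. by move=> If; rewrite unlock ExE. Qed.

Theorem theoremA2 (R : realType) :
  exists A0 A'' : R, 1 <= A0 /\ 0 < A'' /\
  forall A : R, A0 <= A ->
  forall (dS : measure_display) (S : measurableType dS)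
    (G : set (S -> R)) (b a v sigma : R),
  0 < b -> expR 1 <= a -> 1 <= v ->
  (forall g, G g -> measurable_fun [set: S] g) ->
  pointwise_measurable G ->
  VC_type G b a v ->
  forall (d : measure_display) (Omega : measurableType d)
    (P : probability Omega R) (n : nat) (n_gt0 : (0 < n)%N)
    (X : 'I_n -> {RV P >-> S}) (xi : 'I_n -> {RV P >-> R}),
  iid P X ->
  mutually_independent P xi ->
  (forall i, has_law P (xi i) (normal_prob 0 1)) ->
  independent P (rvec X) (rvec xi) ->
  let X1 := X (Ordinal n_gt0) in
  0 < sigma ->
  (forall g, G g -> ('E_P[fun w => (g (X1 w) ^+ 2)%R] <= (sigma ^+ 2)%:E)%E) ->
  sigma ^+ 2 <= b ^+ 2 ->
  forall (dB : measure_display) (OmegaB : measurableType dB)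
    (PB : probability OmegaB R) (B : OmegaB -> {uniform G -> R^o}),
  centered_tight_gaussian PB B (fun g1 g2 : G =>
    'E_P[fun w => (set_val g1 (X1 w) * set_val g2 (X1 w))%R]
    - 'E_P[fun w => set_val g1 (X1 w)] * 'E_P[fun w => set_val g2 (X1 w)])%E ->
  let K := K_ A v n a b sigma in
  b ^+ 2 * K <= n%:R * sigma ^+ 2 ->
  forall delta : R, 0 < delta ->
  exists S0 : set (n.-tuple S), measurable S0 /\
    ((1 - 3 / n%:R)%:E <= P (rvec X @^-1` S0))%E /\
    forall x, S0 x ->
    exists (d' : measure_display) (Omega' : measurableType d')
      (P' : probability Omega' R) (p : Omega' -> Omega) (W0 : {RV P' >-> R}),
      enrichment P P' p /\
      same_law P' W0 PB (fun w => supnorm (B w)) /\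
      (P' [set w | (psi_n n b sigma K + delta
                     < `|W_tilde G x (fun i => xi i (p w)) - W0 w|)%R]
         <= (A'' * gamma_n n b sigma K delta)%:E)%E.
Proof.
(* 128 is the factor by which K has to dominate v ln a and v ln n in the entropy bounds; 871 is the
   870 of [core_comparison] plus 1 for the smoothing noise. *)
exists 128, 871; split; first by rewrite ler1n.
split; first by rewrite ltr0n.
move=> A A128 dS S G b a v sigma b0 ea v1 Gmeas GPM GVC d Omega P n n_gt0 X xi [iX lX] ixi lxi _ X1
  sigma0 Qs sb dB OmegaB PB B gB K bK delta delta0.
have [Ka Kn] := K_lower A128 b0 ea v1 n_gt0 sigma0 sb; rewrite -/K in Ka Kn.
have K0 : 0 < K by apply: lt_le_trans (K_ge128 ea v1 Ka).
have nR : 0 < n%:R :> R by rewrite ltr0n.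
have th0 := fourth_root_term_gt0 b0 sigma0 K0 n_gt0; set th := fourth_root_term n b sigma K in th0.
have gam_ge : th / delta <= gamma_n n b sigma K delta.
  by rewrite /gamma_n -/th div1r mulrC lerDl divr_ge0// ltW.
have gam0 : 0 <= gamma_n n b sigma K delta.
  by apply: le_trans gam_ge; rewrite divr_ge0// ltW.
have psi_ge : th <= psi_n n b sigma K by rewrite /psi_n -/th lerDr sqrtr_ge0.
have num (t q : R) : t <= q -> 870 * t + t <= 871 * q by move=> *; lra.
(* For n < 4 the required probability 1 - 3 / n is at most 0, and the empty set qualifies. *)
have [n4|n3] := leqP 4 n; last first.
  exists set0; split; first exact: measurable0.
  split=> [|x []]; apply: le_trans (measure_ge0 _ _).
  by rewrite lee_fin subr_le0 ler_pdivlMr// mul1r ler_nat.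
(* For an empty class both suprema are [sup] of the empty set, that is 0, and W0 = 0 works on the
   original space. *)
have [[g Gg]|noG] := pselect (exists g, G g); last first.
  have G0 : G -> False by move=> g; apply: noG; exists (set_val g); exact: set_valP.
  exists setT; split; first exact: measurableT.
  split; first by rewrite preimage_setT probability_setT lee_fin gerBl divr_ge0// ltW.
  move=> x _; exists d, Omega, P, id, (cst 0 : {mfun Omega >-> R}); split.
    by split; [exact: measurable_id|].
  split.
    move=> C mC; have -> : (fun w => supnorm (B w)) = cst 0.
      by apply/funext => w; exact: supnorm_empty.
    by rewrite !preimage_cst; case: ifP => _; rewrite ?probability_setT ?measure0.
  rewrite (_ : [set w | _] = set0).
    by rewrite measure0 lee_fin; exact: mulr_ge0 (ler0n _ _) gam0.
  apply/seteqP; split => // w /=; rewrite /W_tilde supnorm_empty// subrr normr0.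
  by rewrite ltNge addr_ge0// ?ltW//; exact: lt_le_trans psi_ge.
have g0 : G := exist _ g (mem_set Gg).
pose Q : probability S R := distribution P X1.
have mX i : measurable_fun setT (X i) by exact: measurable_funPT.
have mxi i : measurable_fun setT (xi i) by exact: measurable_funPT.
have lQ : same_law P X1 Q id by [].
have lXQ i : same_law P (X i) Q id by move=> C mC; rewrite (lX i (Ordinal n_gt0)).
have Gm (h : G) : measurable_fun setT (set_val h) by apply: Gmeas; exact: set_valP.
have Gb (h : G) s : `|set_val h s| <= b by apply: GVC.1; exact: set_valP.
have toQ (f : S -> R) M : measurable_fun setT f -> (forall s, `|f s| <= M) ->
    ('E_P[fun w => f (X1 w)] = (Ex Q f)%:E)%E.
  move=> mf fM; rewrite expectationE.
    by congr (_%:E); exact: (same_law_Ex (mX _) (@measurable_id _ S setT) lQ mf).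
  by apply: (@itg_bnd _ _ _ _ _ M) => //; exact: measurableT_comp.
have Gbb (h k : G) s : `|set_val h s * set_val k s| <= b * b by rewrite normrM ler_pM.
have Qsig (h : G) : Ex Q (fun s => set_val h s ^+ 2) <= sigma ^+ 2.
  rewrite -lee_fin -(toQ _ (b * b)).
  - by apply: Qs; exact: set_valP.
  - by apply: measurable_funX.
  - by move=> s; rewrite expr2; exact: Gbb.
have covE (s t : G) : ('E_P[fun w => (set_val s (X1 w) * set_val t (X1 w))%R]
    - 'E_P[fun w => set_val s (X1 w)] * 'E_P[fun w => set_val t (X1 w)])%E = (cov_of Q s t)%:E.
  rewrite (toQ _ b (Gm s) (Gb s)) (toQ _ b (Gm t) (Gb t)) -EFinM /cov_of EFinB; congr (_ - _)%E.
  by apply: (toQ _ (b * b)); [exact: measurable_funM|exact: Gbb].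
have [S0 [mS0 PS0 HS]] := core_comparison b0 ea v1 n4 Gmeas GVC GPM Ka Kn sigma0 bK mX iX lXQ mxi ixi lxi
  Qsig gB covE g0.
exists S0; split => //; split => // x xS0.
have mW := measurable_W_tilde x g0 mxi ixi lxi n_gt0 Gb.
have [tB _ _ _] := gB; have mN := measurable_tight_supnorm g0 tB.
(* The noise has amplitude [th], which [psi_n] in the threshold dominates. *)
have [W0 [mW0 lW0 tail]] := lipschitz_coupling mW mN th0 delta0 (HS x xS0).
pose P' := prodP P (nlaw 1 : probability R R).
pose W0' : {mfun (Omega * R)%type >-> R} := HB.pack W0 (isMeasurableFun.Build _ _ _ _ W0 mW0).
exists _, (Omega * R)%type, P', fst, W0'; split.
  split; first exact: measurable_fst.
  have fst_law : same_law P' (id \o fst) P id.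
    by apply: same_law_fst; exact: measurable_id.
  by move=> C mC; exact: (fst_law C mC).
split => //.
apply: (@le_trans _ _ ((870 * th + th) / delta)%:E); last first.
  rewrite lee_fin mulrDl -(mulrA 870); exact: num.
apply: le_trans tail; apply: le_measure; rewrite ?inE.
- apply: measurable_gt_set; apply: measurableT_comp => //; apply: measurable_funB => //.
  exact: (measurableT_comp mW measurable_fst).
- apply: measurable_gt_set; apply: measurableT_comp => //; apply: measurable_funB => //.
  exact: (measurableT_comp mW measurable_fst).
- by move=> w /=; apply: le_lt_trans; rewrite lerD2r.
Qed.
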